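(* Let $\zeta\ge2$, $d\ge1$ and let $K$ be a multi-dot product kernel on $\mathbb{MS}(\zeta,d)$. Then the eigenfunctions of $K$ with respect to the uniform measure on $\mathbb{MS}(\zeta,d)$ are the products of spherical harmonics $$\Big\{Y_{\mathbf k,\mathbf j}(\mathbf x)=\prod_{i=1}^dY_{k_i,j_i}(\mathbf x^{(i)})\Big\}_{\mathbf k\in\mathbb N^d,\;j_i\in[N(\zeta,k_i)]},$$ where $Y_{k,j}$ are the spherical harmonics on $\mathbb S^{\zeta-1}$ and $N(\zeta,k)$ is the number of harmonics of degree $k$ on $\mathbb S^{\zeta-1}$. The corresponding eigenvalues $\lambda_{\mathbf k}$ are given by $$\lambda_{\mathbf k}=C(\zeta,d)\int_{[-1,1]^d}K(\mathbf t)\prod_{i=1}^dQ_{k_i}(t_i)(1-t_i^2)^{\frac{\zeta-3}2}\,d\mathbf t,$$ where $\{Q_k\}$ are the Gegenbauer polynomials orthogonal with respect to the weight $(1-t^2)^{\frac{\zeta-3}2}$ on $[-1,1]$, and $C(\zeta,d)$ is a constant that depends only on $\zeta$ and $d$.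
   Context: $\mathbb N$ includes $0$; $[m]=\{1,\dots,m\}$. The multisphere is $\mathbb{MS}(\zeta,d)=(\mathbb S^{\zeta-1})^d$, points $\mathbf x=(\mathbf x^{(1)},\dots,\mathbf x^{(d)})$, $\mathbf x^{(i)}\in\mathbb S^{\zeta-1}$; the uniform measure is the product of surface measures. A kernel $K:\mathbb{MS}(\zeta,d)\times\mathbb{MS}(\zeta,d)\to\mathbb R$ is multi-dot product if $K(\mathbf x,\mathbf z)=K(\mathbf t)$ with $\mathbf t=(\langle\mathbf x^{(1)},\mathbf z^{(1)}\rangle,\dots,\langle\mathbf x^{(d)},\mathbf z^{(d)}\rangle)\in[-1,1]^d$ (notation overloaded). Standing assumption: kernels, as functions of $\mathbf t$, are infinitely differentiable at zero and their power series converges (to the kernel) on $[-1,1]^d$, with non-negative coefficients. $\{Y_{k,j}\}_{1\le j\le N(\zeta,k)}$ is a real basis of spherical harmonics of degree $k$, orthonormal for the surface measure on $\mathbb S^{\zeta-1}$. $Q_k$ is the Gegenbauer polynomial of degree $k$ normalized by $Q_k(1)=1$, equivalently $\int_{-1}^1Q_k^2(1-t^2)^{(\zeta-3)/2}dt=\frac{|\mathbb S^{\zeta-1}|}{|\mathbb S^{\zeta-2}|N(\zeta,k)}$. *)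

(* Defs.v *)
From HB Require Import structures.
From mathcomp Require Import all_boot all_order all_algebra.
From mathcomp.multinomials Require mpoly.
(* The notations of mpoly are incompatible with those of the analysis library;
   the import is needed for the canonical structures. *)
Import -(notations) mpoly.
From mathcomp Require Import all_classical all_reals all_analysis.
From mathcomp Require Import measurable_realfun.

Set Implicit Arguments.
Unset Strict Implicit.
Unset Printing Implicit Defensive.

Import Order.TTheory GRing.Theory Num.Theory.
Import numFieldNormedType.Exports.

Local Open Scope classical_set_scope.
Local Open Scope ring_scope.

Section product_pushforward.
Local Open Scope ereal_scope.
Context {R : realType} {d1 d2 d3 : measure_display}.
Context {T1 : measurableType d1} {T2 : measurableType d2}.
Context {T3 : measurableType d3}.
Variable m1 : {sigma_finite_measure set T1 -> \bar R}.
Variable m2 : {sigma_finite_measure set T2 -> \bar R}.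
Variables (f : T1 * T2 -> T3) (g : T3 -> T1 * T2).
Hypothesis mf : measurable_fun [set: T1 * T2] f.
Hypothesis mg : measurable_fun [set: T3] g.
Hypothesis fK : cancel f g.

(* The proof arguments are there for the measure instances below. *)
Definition product_pushforward of measurable_fun [set: T1 * T2] f
    & measurable_fun [set: T3] g & cancel f g : set T3 -> \bar R :=
  pushforward (m1 \x m2) f.

Local Notation nu := (product_pushforward mf mg fK).

Let nu0 : nu set0 = 0.
Proof. by rewrite /nu /pushforward preimage_set0 measure0. Qed.

Let nu_ge0 A : 0 <= nu A.
Proof. exact: (measure_ge0 (m1 \x m2)). Qed.

Let nu_sigma_additive : semi_sigma_additive nu.
Proof.
move=> F mF tF mUF; rewrite /nu /pushforward preimage_bigcup.
apply: (@measure_semi_sigma_additive _ _ _ [the measure _ _ of m1 \x m2]).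
- by move=> i; rewrite -[X in measurable X]setTI; exact: mf.
- apply/trivIsetP => /= i j _ _ ij; rewrite -preimage_setI.
  by move/trivIsetP : tF => /(_ _ _ _ _ ij) ->//; rewrite preimage_set0.
- by rewrite -preimage_bigcup -[X in measurable X]setTI; exact: mf.
Qed.

HB.instance Definition _ :=
  isMeasure.Build _ _ _ nu nu0 nu_ge0 nu_sigma_additive.

Let nu_sigma_finite : sigma_finite setT nu.
Proof.
have /sigma_finiteP[F [TF ndF Foo]] := sigma_finiteT m1.
have /sigma_finiteP[G [TG ndG Goo]] := sigma_finiteT m2.
exists (fun n => g @^-1` (F n `*` G n)) => [|k].
  rewrite -preimage_bigcup (_ : \bigcup_n _ = setT) ?preimage_setT//.
  rewrite -subTset => -[x y] _.
  have [n _ Fnx] : (\bigcup_n F n) x by rewrite -TF.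
  have [k _ Gky] : (\bigcup_n G n) y by rewrite -TG.
  exists (maxn n k) => //; split.
  - by move: x Fnx; exact/subsetPset/ndF/leq_maxl.
  - by move: y Gky; exact/subsetPset/ndG/leq_maxr.
have [? ?] := Foo k; have [? ?] := Goo k; split.
  by rewrite -[X in measurable X]setTI; apply: mg => //; exact: measurableX.
rewrite /nu /pushforward -comp_preimage.
rewrite (_ : g \o f = id); last by apply/funext => p /=; rewrite fK.
by rewrite preimage_id product_measure1E// lte_mul_pinfty// ge0_fin_numE.
Qed.

HB.instance Definition _ := Measure_isSigmaFinite.Build _ _ _ nu nu_sigma_finite.

Definition product_pushforward_measure :
  {sigma_finite_measure set T3 -> \bar R} := nu.

End product_pushforward.

Section power_measure.
Context {R : realType} {d : measure_display} {T : measurableType d}.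
Variable mu : {sigma_finite_measure set T -> \bar R}.

Definition cons_pair n (p : T * n.-tuple T) : n.+1.-tuple T :=
  [tuple of p.1 :: p.2].

Definition uncons_pair n (x : n.+1.-tuple T) : T * n.-tuple T :=
  (thead x, [tuple of behead x]).

Lemma measurable_cons_pair n : measurable_fun [set: _] (@cons_pair n).
Proof. exact: measurable_cons. Qed.

Lemma measurable_uncons_pair n : measurable_fun [set: _] (@uncons_pair n).
Proof.
apply/measurable_fun_pairP; split.
  exact: (measurable_tnth (ord0 : 'I_n.+1)).
exact: measurable_behead.
Qed.

Lemma cons_pairK n : cancel (@cons_pair n) (@uncons_pair n).
Proof. by case=> a t; congr pair; apply/val_inj. Qed.

Fixpoint power_measure n : {sigma_finite_measure set (n.-tuple T) -> \bar R} :=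
  if n is m.+1 then
    product_pushforward_measure mu (power_measure m)
      (@measurable_cons_pair m) (@measurable_uncons_pair m) (@cons_pairK m)
  else \d_([tuple] : 0.-tuple T).

Definition box n (A : set T) : set (n.-tuple T) :=
  [set x | forall i, A (tnth x i)].

Lemma measurable_box n A : measurable A -> measurable (@box n A).
Proof.
move=> mA; rewrite (_ : @box n A =
    \big[setI/setT]_(i < n) ((fun x => tnth x i) @^-1` A)).
  apply: bigsetI_measurable => i _.
  by rewrite -[X in measurable X]setTI; apply: measurable_tnth.
apply/seteqP; split => x; rewrite -bigcap_seq /box /=.
  by move=> Ax i _; exact: Ax.
by move=> Ax i; apply: (Ax i); rewrite /= mem_index_enum.
Qed.

Lemma power_measure_box n A : measurable A ->
  power_measure n (@box n A) = (mu A ^+ n)%E.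
Proof.
move=> mA; elim: n => [|n ih].
  by rewrite /= diracE mem_set// => -[].
rewrite expeS [LHS]/= /product_pushforward_measure /= /product_pushforward.
rewrite /pushforward (_ : _ @^-1` _ = A `*` @box n A).
  rewrite product_measure1E//; last exact: measurable_box.
  by rewrite ih.
apply/seteqP; split => -[a x]; rewrite /box /=.
  move=> Ax; split => [|i]; first by have := Ax ord0; rewrite tnth0.
  by have := Ax (lift ord0 i); rewrite tnthS.
move=> [Aa Ax] i; case: (unliftP ord0 i) => [j|] ->; last by rewrite tnth0.
by rewrite tnthS.
Qed.

End power_measure.

Section euclidean.
Context {R : realType}.
Local Notation point n := (n.-tuple (measurableTypeR R)).

Definition lebesgue_power n : {sigma_finite_measure set (point n) -> \bar R} :=
  power_measure (@lebesgue_measure R) n.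

Definition cube n : set (point n) := 
  @box _ (measurableTypeR R) n [set` `[-1, 1]].

Definition dotp n (x y : point n) : R := \sum_(i < n) tnth x i * tnth y i.

Definition enorm n (x : point n) : R := Num.sqrt (dotp x x).

Definition sphere n : set (point n) := [set x | enorm x = 1].

Definition punctured_ball n : set (point n) := [set x | 0 < enorm x <= 1].

Definition normalize n (x : point n) : point n :=
  [tuple tnth x i / enorm x | i < n].

Lemma measurable_tnthR n (i : 'I_n) :
  measurable_fun [set: point n] (fun x => tnth x i : R).
Proof. exact: measurable_tnth. Qed.

Lemma measurable_enorm n : measurable_fun [set: point n] (@enorm n).
Proof.
rewrite (_ : @enorm n = fun x => (\sum_(i < n) tnth x i * tnth x i) `^ 2^-1).
  apply: (@measurableT_comp _ _ _ _ _ _ (fun y : R => y `^ 2^-1)).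
    exact: measurable_powR.
  by apply: measurable_sum => i; apply: measurable_funM; exact: measurable_tnthR.
apply/funext => x; rewrite powR12_sqrt//.
by apply: sumr_ge0 => i _; rewrite -expr2 sqr_ge0.
Qed.

Lemma measurable_punctured_ball n : measurable (@punctured_ball n).
Proof.
rewrite (_ : @punctured_ball n = (@enorm n) @^-1` `]0, 1]%classic); last first.
  by apply/seteqP; split => x; rewrite /punctured_ball /= in_itv.
by rewrite -[X in measurable X]setTI; apply: measurable_enorm.
Qed.

Lemma measurable_cube n : measurable (@cube n).
Proof. exact: measurable_box. Qed.

Lemma punctured_ball_cube n : @punctured_ball n `<=` @cube n.
Proof.
move=> x /andP[_ x1] i; rewrite /= in_itv/= -ler_norml.
apply: le_trans x1; rewrite -sqrtr_sqr ler_wsqrtr//.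
rewrite /dotp (bigD1 i)//= -expr2 lerDl.
by apply: sumr_ge0 => j _; rewrite -expr2 sqr_ge0.
Qed.

Lemma measurable_normalize n : measurable_fun [set: point n] (@normalize n).
Proof.
apply/measurable_fun_tnthP => i.
rewrite (_ : _ \o _ = fun x : point n => tnth x i * enorm x `^ (-1)).
  apply: measurable_funM; first exact: measurable_tnthR.
  apply: (@measurableT_comp _ _ _ _ _ _ (fun y : R => y `^ (-1))).
    exact: measurable_powR.
  exact: measurable_enorm.
by apply/funext => x /=; rewrite tnth_mktuple powR_inv1// sqrtr_ge0.
Qed.

Local Open Scope ereal_scope.

Definition cone_measure n (A : set (point n)) : \bar R :=
  lebesgue_power n (@normalize n @^-1` A `&` @punctured_ball n).

Section cone_measure_measure.
Variable n : nat.

Let mnormalize_ball (A : set (point n)) : measurable A ->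
  measurable (@normalize n @^-1` A `&` @punctured_ball n).
Proof.
move=> mA; apply: measurableI; last exact: measurable_punctured_ball.
by rewrite -[X in measurable X]setTI; exact: measurable_normalize.
Qed.

Let cone0 : @cone_measure n set0 = 0.
Proof. by rewrite /cone_measure preimage_set0 set0I measure0. Qed.

Let cone_ge0 A : 0 <= @cone_measure n A.
Proof. exact: measure_ge0. Qed.

Let cone_sigma_additive : semi_sigma_additive (@cone_measure n).
Proof.
move=> F mF tF mUF; rewrite /cone_measure preimage_bigcup setI_bigcupl.
apply: measure_semi_sigma_additive.
- by move=> i; exact: mnormalize_ball.
- apply/trivIsetP => /= i j _ _ ij.
  rewrite setIACA -preimage_setI.
  by move/trivIsetP : tF => /(_ _ _ _ _ ij) ->//; rewrite preimage_set0 set0I.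
- by rewrite -setI_bigcupl -preimage_bigcup; exact: mnormalize_ball.
Qed.

HB.instance Definition _ := isMeasure.Build _ _ _ (@cone_measure n)
  cone0 cone_ge0 cone_sigma_additive.

Let cone_finite : fin_num_fun (@cone_measure n).
Proof.
move=> A mA; rewrite ge0_fin_numE//.
apply: (@le_lt_trans _ _ (lebesgue_power n (@cube n))).
  rewrite /cone_measure; apply: le_measure; rewrite ?inE.
  - exact: mnormalize_ball.
  - exact: measurable_cube.
  - by move=> x [_ /punctured_ball_cube].
rewrite power_measure_box//= lebesgue_measure_itv/= lte_fin.
by case: ifP => _; rewrite -?EFinB -EFin_expe ltry.
Qed.

HB.instance Definition _ := Measure_isFinite.Build _ _ _ (@cone_measure n)
  cone_finite.

End cone_measure_measure.

(* Surface measure through polar coordinates: the area of A is n times the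
   Lebesgue measure of the cone { r a | a in A, 0 < r <= 1 }. It is a measure on
   the ambient space, carried by the sphere. *)
Definition surface_measure n : {finite_measure set (point n) -> \bar R} :=
  mscale (n%:R%:nng)%R (@cone_measure n).

End euclidean.

Arguments cube {R} n _.
Arguments sphere {R} n _.

Section L2.
Context {R : realType} {d : measure_display} {T : measurableType d}.
Variables (mu : {measure set T -> \bar R}) (D : set T).

Definition square_integrable (f : T -> R) :=
  measurable_fun D f /\ mu.-integrable D (fun x => (f x ^+ 2)%:E).

Definition orthonormal_family (I : eqType) (phi : I -> T -> R) :=
  forall i j, \int[mu]_(x in D) (phi i x * phi j x) = (i == j)%:R.

(* Hilbert basis of L^2(D, mu): orthonormal, with dense linear span. *)
Definition orthonormal_basis (I : eqType) (phi : I -> T -> R) :=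
  [/\ forall i, square_integrable (phi i),
      orthonormal_family phi
    & forall f, square_integrable f -> forall e, 0 < e ->
      exists (s : seq I) (c : I -> R),
        \int[mu]_(x in D) (f x - \sum_(i <- s) c i * phi i x) ^+ 2 < e].

(* Rintegral is total, hence the explicit integrability condition. *)
Definition eigenfunction (K : T -> T -> R) (lambda : R) (f : T -> R) :=
  [/\ square_integrable f,
      ~ {ae mu, forall x, D x -> f x = 0}
    & forall x, D x ->
      mu.-integrable D (fun z => (K x z * f z)%:E) /\
      \int[mu]_(z in D) (K x z * f z) = lambda * f x].

End L2.

Section spherical_harmonics.
Context {R : realType}.
Local Notation point n := (n.-tuple (measurableTypeR R)).

Definition laplacian n (p : mpoly.mpoly n R) : mpoly.mpoly n R :=
  \sum_(i < n) mpoly.mderiv i (mpoly.mderiv i p).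

Definition spherical_harmonic n k (f : point n -> R) :=
  exists p : mpoly.mpoly n R,
    [/\ p \is mpoly.ishomog1 k mpoly.mdeg,
        laplacian p = 0
      & forall x, sphere n x -> f x = mpoly.meval (fun i => tnth x i) p].

(* N is then the dimension of the space of harmonics of degree k. *)
Definition harmonic_basis n k N (Y : 'I_N -> point n -> R) :=
  [/\ forall j, spherical_harmonic k (Y j),
      forall f, spherical_harmonic k f -> exists c : 'I_N -> R,
        forall x, sphere n x -> f x = \sum_(j < N) c j * Y j x
    & orthonormal_family (surface_measure n) (sphere n) Y].

Definition gegenbauer_weight n (t : R) : R := (1 - t ^+ 2) `^ ((n%:R - 3) / 2).

(* Orthogonality and degree determine Q k up to a scalar, fixed by Q k 1 = 1. *)
Definition gegenbauer n (Q : nat -> {poly R}) :=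
  [/\ forall k, size (Q k) = k.+1,
      forall k, (Q k).[1] = 1
    & forall k l, k != l -> \int[lebesgue_measure]_(t in `[-1, 1])
        ((Q k).[t] * (Q l).[t] * gegenbauer_weight n t) = 0].

End spherical_harmonics.

Section multi_dot_product.
Context {R : realType}.
Local Notation point n := (n.-tuple (measurableTypeR R)).
Variables n d : nat.

Definition multisphere : set (d.-tuple (point n)) := @box _ _ d (sphere n).

Definition multisphere_measure :
    {sigma_finite_measure set (d.-tuple (point n)) -> \bar R} :=
  power_measure (surface_measure n) d.

Definition dots (x z : d.-tuple (point n)) : 'rV[R]_d :=
  \row_i dotp (tnth x i) (tnth z i).

Definition iter_partial (s : seq 'I_d) (K : 'rV[R]_d -> R) : 'rV[R]_d -> R :=
  foldr (fun i f x => 'D_(delta_mx 0 i) f x) K s.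

Definition smooth_at (K : 'rV[R]_d -> R) (x : 'rV[R]_d) :=
  forall s, \forall y \near x, differentiable (iter_partial s K) y.

Definition taylor_coef (K : 'rV[R]_d -> R) (a : 'I_d -> nat) : R :=
  iter_partial (flatten [seq nseq (a i) i | i <- enum 'I_d]) K 0 /
  (\prod_(i < d) (a i)`!)%:R.

(* The coefficients being non-negative and the series converging at (1,...,1),
   the choice of cubes as partial sums of the multiple series is immaterial. *)
Definition nonneg_power_series (K : 'rV[R]_d -> R) :=
  [/\ smooth_at K 0,
      forall a, 0 <= taylor_coef K a
    & forall t : 'rV[R]_d, (forall i, -1 <= t 0 i <= 1) ->
      (\sum_(a : {ffun 'I_d -> 'I_m})
         taylor_coef K (fun i => a i) * \prod_(i < d) t 0 i ^+ a i)
        @[m --> \oo] --> K t].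

Definition multi_dot_product_kernel
    (K : d.-tuple (point n) -> d.-tuple (point n) -> R) (Kt : 'rV[R]_d -> R) :=
  nonneg_power_series Kt /\
  forall x z, multisphere x -> multisphere z -> K x z = Kt (dots x z).

Definition eigenvalue_integrand (Kt : 'rV[R]_d -> R) (Q : nat -> {poly R})
    (k : 'I_d -> nat) (t : point d) : R :=
  Kt (\row_i tnth t i) *
  \prod_(i < d) ((Q (k i)).[tnth t i] * gegenbauer_weight n (tnth t i)).

Section harmonic_product.
Variables (N : nat -> nat) (Y : forall k, 'I_(N k) -> point n -> R).

(* p i is the pair (k_i, j_i) *)
Definition harmonic_product (p : {ffun 'I_d -> {k : nat & 'I_(N k)}})
    (x : d.-tuple (point n)) : R :=
  \prod_(i < d) Y (tagged (p i)) (tnth x i).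

End harmonic_product.

End multi_dot_product.

Arguments multisphere {R} n d _.

(* Main.v *)
(* Write L for integration over the sphere S^(n-1) and w for the Gegenbauer
   weight. Gaussian integrals of polynomials, integrated by parts and compared
   with L in polar coordinates, give the Green formula
   L (laplacian p) = k (k + n - 2) L p for p homogeneous of degree k. Hence
   harmonics of different degrees are orthogonal, and, applying the formula to
   <x, .>^a p with p harmonic, induction on a shows that the kernel <x, z>^a acts
   as a scalar on the harmonics of each degree k (Funk-Hecke). The scalar is
   found by taking for p the harmonic part of <x, .>^k: it is z |-> Z_k <x, z>
   for a polynomial Z_k which, by orthogonality of the degrees, is proportional
   to Q_k. Integrating the power series of K term by term, dominated by its value
   at (1, ..., 1), then gives the eigenvalues.
   Completeness: on the sphere |x|^2 = 1, so every polynomial restricts to a sum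
   of harmonics and products of harmonics span an algebra of functions on the
   multisphere; its closure under bounded pointwise limits contains the
   indicators of half-spaces, hence of all measurable sets. *)
Require Import Defs.
From HB Require Import structures.
From mathcomp Require Import all_boot all_order all_algebra.
From mathcomp.multinomials Require mpoly.
Import -(notations) mpoly.
From mathcomp Require Import all_classical all_reals all_analysis.
From mathcomp Require Import measurable_realfun zify ring lra.

Set Implicit Arguments.
Unset Strict Implicit.
Unset Printing Implicit Defensive.

Import Order.TTheory GRing.Theory Num.Theory.
Import numFieldNormedType.Exports.

Local Open Scope classical_set_scope.
Local Open Scope ring_scope.

(** The surface measure is defined by volumes of cones, so the proof reaches it only through
    Lebesgue measure. A Gaussian is the bridge because it is both radial, which isolates the sphere
    integral in polar coordinates, and a product, which reduces integration by parts to one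
    variable. For p homogeneous of degree m the Gaussian integral is c_m L p, and the constants c_m
    are never computed: as |x|^2 = 1 on the sphere, a factor |x|^2 brings both sides of an identity
    to the same degree, where c_m cancels. The Funk-Hecke induction closes because the derivative of
    a harmonic p in the direction x is harmonic of one degree less and, by Euler's identity, takes
    the value k p(x) at x: every term met is again a multiple of p(x). The image of the surface
    measure under <x, .> is not computed either. Its moments and those of w obey the same
    recurrence, so they differ by the factor |S^(n-1)| / (integral of w), classically |S^(n-2)|; the
    constant C is the d-th power of this factor. *)

(** * Integrals of products of one-factor functions *)

Section product_integral.
Context {R : realType} {d : measure_display} {T : measurableType d}.
Variable mu : {sigma_finite_measure set T -> \bar R}.

Lemma integrable_tensor d' (T' : measurableType d')
    (nu : {sigma_finite_measure set T' -> \bar R}) (f : T -> R) (g : T' -> R) :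
  mu.-integrable setT (EFin \o f) -> nu.-integrable setT (EFin \o g) ->
  (mu \x nu)%E.-integrable setT (EFin \o (fun p => f p.1 * g p.2)).
Proof.
move=> /integrableP[mf fi] /integrableP[mg gi].
have mF : measurable_fun setT (fun p : T * T' => f p.1 * g p.2).
  apply: measurable_funM.
  - by apply: measurableT_comp => //; apply/measurable_EFinP.
  - by apply: measurableT_comp => //; apply/measurable_EFinP.
apply/integrable12ltyP; first exact/measurable_EFinP.
rewrite [X in (X < _)%E](_ : _ =
    (\int[mu]_x `|(f x)%:E|) * \int[nu]_y `|(g y)%:E|)%E; last first.
  rewrite -ge0_integralZr//=; last 2 first.
  - by apply/measurable_EFinP/measurableT_comp => //; exact/measurable_EFinP.
  - by apply: integral_ge0 => y _; rewrite lee_fin.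
  apply: eq_integral => x _.
  rewrite -ge0_integralZl//=; last first.
    by apply/measurable_EFinP/measurableT_comp => //; exact/measurable_EFinP.
  by apply: eq_integral => y _; rewrite -EFinM normrM.
by rewrite lte_mul_pinfty// ?integral_ge0// ge0_fin_numE// integral_ge0.
Qed.

Lemma integral_tensor d' (T' : measurableType d')
    (nu : {sigma_finite_measure set T' -> \bar R}) (f : T -> R) (g : T' -> R) :
  mu.-integrable setT (EFin \o f) -> nu.-integrable setT (EFin \o g) ->
  (\int[(mu \x nu)%E]_p (f p.1 * g p.2)%:E =
   (\int[mu]_x (f x)%:E) * \int[nu]_y (g y)%:E)%E.
Proof.
move=> fi gi; rewrite -(integral12_prod_meas1 (integrable_tensor fi gi)) /fubini_F/=.
have /fineK gE := integrable_fin_num measurableT gi.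
rewrite -gE -integralZr//; apply: eq_integral => x _ /=.
under eq_integral do rewrite EFinM.
by rewrite integralZl// -gE.
Qed.

(** Induction on n: [power_measure mu n.+1] is the image of a product measure under [cons_pair], so
    both claims reduce to the tensor case. *)
Lemma power_measure_prod n (f : 'I_n -> T -> R) :
  (forall i, mu.-integrable setT (EFin \o f i)) ->
  (power_measure mu n).-integrable setT
    (EFin \o (fun x => \prod_(i < n) f i (tnth x i))) /\
  (\int[power_measure mu n]_x (\prod_(i < n) f i (tnth x i))%:E =
   \prod_(i < n) \int[mu]_x (f i x)%:E)%E.
Proof.
elim: n f => [|n ih] f fi.
  split.
    rewrite (_ : EFin \o _ = cst 1%E).
      exact: finite_measure_integrable_cst.
    by apply/funext => x /=; rewrite big_ord0.
  rewrite big_ord0 (eq_integral (cst 1%E)); last by move=> x _; rewrite big_ord0.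
  by rewrite integral_cst//= diracT mule1.
have [hi hE] := ih (fun i => f (lift ord0 i)) (fun i => fi _).
pose h (x : n.-tuple T) := \prod_(i < n) f (lift ord0 i) (tnth x i).
have FE (p : T * n.-tuple T) :
    \prod_(i < n.+1) f i (tnth (cons_pair p) i) = f ord0 p.1 * h p.2.
  rewrite big_ord_recl tnth0; congr (_ * _); apply: eq_bigr => i _.
  by rewrite tnthS.
have mF : measurable_fun setT
    (fun x : n.+1.-tuple T => \prod_(i < n.+1) f i (tnth x i)).
  apply: measurable_prod => i _; apply: (measurableT_comp (f := f i)).
    by apply/measurable_EFinP; exact: (measurable_int _ (fi i)).
  exact: measurable_tnth.
have cFi : (mu \x power_measure mu n)%E.-integrable (@cons_pair _ _ n @^-1` setT)
    ((EFin \o (fun x : n.+1.-tuple T => \prod_(i < n.+1) f i (tnth x i)))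
      \o @cons_pair _ _ n).
  rewrite preimage_setT (_ : _ \o _ = EFin \o (fun p => f ord0 p.1 * h p.2)).
    exact: integrable_tensor.
  by apply/funext => p /=; rewrite FE.
have mE := (@measurable_cons_pair _ T n).
split.
  exact: (integrable_pushforward mE ((measurable_EFinP _ _).2 mF) cFi measurableT).
rewrite big_ord_recl -hE -integral_tensor//=.
rewrite [LHS](integral_pushforward mE ((measurable_EFinP _ _).2 mF) cFi measurableT).
by rewrite preimage_setT; apply: eq_integral => p _ /=; rewrite FE.
Qed.

(** The indicator of a box is the product of the indicators of its sides, so each factor can be cut
    off separately. *)
Lemma power_measure_prod_box n (A : set T) (f : 'I_n -> T -> R) :
  measurable A -> (forall i, mu.-integrable A (EFin \o f i)) ->
  (power_measure mu n).-integrable (box A)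
    (EFin \o (fun x => \prod_(i < n) f i (tnth x i))) /\
  \int[power_measure mu n]_(x in box A) \prod_(i < n) f i (tnth x i) =
  \prod_(i < n) \int[mu]_(x in A) f i x.
Proof.
move=> mA fi.
have fAi i : mu.-integrable setT (EFin \o (f i \_ A)).
  by rewrite -restrict_EFin; apply/(integrable_mkcond _ mA).1.
have [Fi FE] := power_measure_prod fAi.
have E : (fun x => \prod_(i < n) f i (tnth x i)) \_ (box A) =
    (fun x : n.-tuple T => \prod_(i < n) (f i \_ A) (tnth x i)).
  apply/funext => x; rewrite patchE; case: ifPn => [/set_mem xA|/negP xA].
    by apply: eq_bigr => i _; rewrite patchE mem_set//; exact: xA.
  have [i Ai] : exists i, ~ A (tnth x i).
    by apply/existsNP => h; apply: xA; rewrite inE.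
  by rewrite (bigD1 i)//= patchE memNset// mul0r.
split.
  by apply/(integrable_mkcond _ (measurable_box mA)).2; rewrite restrict_EFin E.
rewrite Rintegral_mkcond E /Rintegral FE.
rewrite -[RHS]/(fine _%:E) -prodEFin; congr fine; apply: eq_bigr => i _.
rewrite -/(Rintegral _ _ _) Rintegral_mkcond /Rintegral fineK//.
exact: (integrable_fin_num measurableT (fAi i)).
Qed.

End product_integral.

(** * Dominated convergence for real-valued integrals *)

Section dominated_convergence_real.
Context {R : realType} {d : measure_display} {T : measurableType d}.
Variable mu : {measure set T -> \bar R}.

Lemma le_integrableR (D : set T) (f g : T -> R) : measurable D ->
  measurable_fun D f -> mu.-integrable D (EFin \o g) ->
  (forall x, D x -> `|f x| <= g x) -> mu.-integrable D (EFin \o f).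
Proof.
move=> mD mf gi fg; apply: (le_integrable mD _ _ gi); first exact/measurable_EFinP.
by move=> x Dx /=; rewrite lee_fin (le_trans (fg _ Dx))// ler_norm.
Qed.

Lemma bounded_integrableR (D : set T) (f : T -> R) (M : R) : measurable D ->
  (mu D < +oo)%E -> measurable_fun D f -> (forall x, D x -> `|f x| <= M) ->
  mu.-integrable D (EFin \o f).
Proof.
move=> mD muD mf fM; apply: measurable_bounded_integrable => //.
exists M; split; first exact: num_real.
by move=> t Mt x Dx; apply: le_trans (fM _ Dx) (ltW Mt).
Qed.

Lemma integrableRZ (D : set T) (k : R) (f : T -> R) : measurable D ->
  mu.-integrable D (EFin \o f) -> mu.-integrable D (EFin \o (fun x => k * f x)).
Proof. by move=> mD; exact: integrableZl. Qed.

Lemma integrableRD (D : set T) (f g : T -> R) : measurable D ->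
  mu.-integrable D (EFin \o f) -> mu.-integrable D (EFin \o g) ->
  mu.-integrable D (EFin \o (fun x => f x + g x)).
Proof. by move=> mD; exact: integrableD. Qed.

Lemma integrableRB (D : set T) (f g : T -> R) : measurable D ->
  mu.-integrable D (EFin \o f) -> mu.-integrable D (EFin \o g) ->
  mu.-integrable D (EFin \o (fun x => f x - g x)).
Proof. by move=> mD; exact: integrableB. Qed.

Lemma Rintegral_sum (I : Type) (r : seq I) (D : set T) (f : I -> T -> R) :
  measurable D -> (forall i, mu.-integrable D (EFin \o f i)) ->
  mu.-integrable D (EFin \o (fun x => \sum_(i <- r) f i x)) /\
  \int[mu]_(x in D) \sum_(i <- r) f i x = \sum_(i <- r) \int[mu]_(x in D) f i x.
Proof.
move=> mD fi; elim: r => [|i r [ihi ihE]].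
  split.
    rewrite (_ : _ \o _ = cst 0%E); first exact: integrable0.
    by apply/funext => x /=; rewrite big_nil.
  by rewrite big_nil; under eq_Rintegral do rewrite big_nil; rewrite Rintegral_cst// mul0r.
have E : (fun x => \sum_(j <- i :: r) f j x) = (fun x => f i x + \sum_(j <- r) f j x).
  by apply/funext => x; rewrite big_cons.
by rewrite E big_cons RintegralD// ihE; split=> //; exact: integrableRD.
Qed.

(** Integrability is part of the conclusion because [Rintegral] is total: convergence of its values
    alone would say too little. *)
Lemma dominated_convergenceR (D : set T) (u : nat -> T -> R) (f g : T -> R) :
  measurable D -> (forall n, measurable_fun D (u n)) ->
  (forall x, D x -> u ^~ x @ \oo --> f x) ->
  mu.-integrable D (EFin \o g) ->
  (forall n x, D x -> `|u n x| <= g x) ->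
  [/\ mu.-integrable D (EFin \o f),
      forall n, mu.-integrable D (EFin \o u n)
    & \int[mu]_(x in D) u n x @[n --> \oo] --> \int[mu]_(x in D) f x].
Proof.
move=> mD mu_ uf gi ug.
have mf : measurable_fun D f by apply: measurable_fun_cvg mu_ uf.
have fg x : D x -> `|f x| <= g x.
  move=> Dx; apply: (cvgr_to_le (cvg_norm (uf x Dx))).
  by apply: nearW => n; exact: ug.
have fi : mu.-integrable D (EFin \o f) by exact: le_integrableR gi fg.
split=> //; first by move=> n; apply: le_integrableR gi _ => // x; exact: ug.
apply: fine_cvg; rewrite /Rintegral fineK; last exact: integrable_fin_num.
apply: (@dominated_cvg _ _ _ mu D mD (fun n => EFin \o u n) (EFin \o f) (EFin \o g)) => //.
  by move=> n; exact/measurable_EFinP.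
by move=> x Dx; apply: cvg_EFin; [exact: nearW|exact: uf].
Qed.

End dominated_convergence_real.

(** * Fundamental theorem of calculus on the line and on an open interval *)

Section exhaustion.
Context {R : realType}.
Local Notation mu := (@lebesgue_measure R).
Variables (s : nat -> R) (f F : R -> R).
Hypothesis s_gt0 : forall n, 0 < s n.
Hypothesis nd_s : nondecreasing_seq s.
Local Notation D := (\bigcup_n [set` `[- s n, s n]]).
Hypothesis dF : forall x, D x -> is_derive x 1 F (f x).
Hypothesis cf : forall x, D x -> {for x, continuous f}.

Let E n : set R := [set` `[- s n, s n]].

Let mE n : measurable (E n). Proof. exact: measurable_itv. Qed.

Let mD : measurable D. Proof. by apply: bigcup_measurable => n _; exact: mE. Qed.

Let E_D n : E n `<=` D. Proof. by move=> x Ex; exists n. Qed.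

Let ndE : nondecreasing_seq E.
Proof.
move=> m n mn; apply/subsetPset => x; rewrite /E/= !in_itv/= => /andP[ax xb].
have := nd_s mn; lra.
Qed.

Let cfE n : {within E n, continuous f}.
Proof.
by apply: continuous_in_subspaceT => x /set_mem Ex; exact: cf (E_D Ex).
Qed.

Let mfE n : measurable_fun (E n) f.
Proof. exact: subspace_continuous_measurable_fun. Qed.

Lemma measurable_exhaustion : measurable_fun D f.
Proof. by apply/measurable_fun_bigcup => // n; exact: mfE. Qed.

Lemma integral_symitv n :
  (\int[mu]_(x in E n) (f x)%:E = (F (s n) - F (- s n))%:E)%E.
Proof.
have ss : - s n < s n by have := s_gt0 n; lra.
have dFE x : x \in `[- s n, s n] -> is_derive x 1 F (f x).
  by move=> xE; apply: dF; apply: (@E_D n).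
have cF x : x \in `[- s n, s n] -> {for x, continuous F}.
  move=> xE; apply/differentiable_continuous/derivable1_diffP.
  exact: (ex_derive (is_derive := dFE _ xE)).
rewrite (@continuous_FTC2 _ _ F _ _ ss (@cfE n)).
- by rewrite EFinB.
- split.
  + by move=> x xE; apply: ex_derive; apply: dFE; exact: subset_itv_oo_cc.
  + by apply: cvg_at_right_filter; apply: cF; rewrite in_itv/= lexx ltW.
  + by apply: cvg_at_left_filter; apply: cF; rewrite in_itv/= lexx ltW.
- move=> x xE; rewrite derive1E.
  by apply: derive_val; apply: dFE; exact: subset_itv_oo_cc.
Qed.

(** For f >= 0 the integrals over [E n] increase to the integral over the union, so bounded
    increments of a primitive give integrability. *)
Lemma integrable_exhaustion M :
  (forall x, D x -> 0 <= f x) -> (forall n, F (s n) - F (- s n) <= M) ->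
  mu.-integrable D (EFin \o f).
Proof.
move=> f0 FM; apply/integrableP; split.
  by apply/measurable_EFinP; exact: measurable_exhaustion.
have -> : (\int[mu]_(x in D) `|(EFin \o f) x| = \int[mu]_(x in D) (f x)%:E)%E.
  by apply: eq_integral => x /set_mem Dx /=; rewrite ger0_norm// f0.
have := @ge0_nondecreasing_set_cvg_integral _ (measurableTypeR R) R E
  (EFin \o f) mu ndE mE
  (fun i => (measurable_EFinP _ _).2 (@mfE i))
  (fun i x Ex => f0 x (@E_D i x Ex)).
move=> h; apply: (@le_lt_trans _ _ M%:E); last exact: ltry.
apply: (cvge_le _ h); apply: nearW => n /=.
by rewrite integral_symitv lee_fin.
Qed.

Lemma FTC_exhaustion l : mu.-integrable D (EFin \o f) ->
  (fun n => F (s n) - F (- s n)) @ \oo --> l -> \int[mu]_(x in D) f x = l.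
Proof.
move=> fi Fl.
have mf := measurable_exhaustion.
have uf x : D x -> (f \_ (E n)) x @[n --> \oo] --> f x.
  move=> [m _ Em]; apply: cvg_near_cst; near=> n.
  have mn : (m <= n)%N by near: n; exact: nbhs_infty_ge.
  have /subsetPset sE := ndE mn.
  by rewrite patchE mem_set//; exact: sE.
have [|||_ _ h] := dominated_convergenceR (mu := mu) (u := fun n => f \_ (E n))
    (g := Num.norm \o f) mD _ uf.
- move=> n; apply: (measurable_restrict f (mE n) mD).1.
  by apply: measurable_funS mf => // x [].
- exact: integrable_norm.
- move=> n x _; rewrite patchE; case: ifPn => // _.
  (* Outside [E n] the restriction takes the default value [point], which is 0 in R. *)
  by rewrite (_ : point = 0 :> R)// normr0 /=.
- have E1 : (fun n => \int[mu]_(x in D) (f \_ (E n)) x) =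
    (fun n => F (s n) - F (- s n)).
    apply/funext => n; rewrite -Rintegral_mkcondr setIidr; last exact: E_D.
    by rewrite /Rintegral integral_symitv.
  by move: Fl; rewrite -E1 => Fl; exact: (cvg_unique _ h Fl).
Unshelve. all: by end_near. Qed.

End exhaustion.

Lemma is_derive_exprn (R : realType) a (x : R) :
  is_derive x 1 (fun y : R => y ^+ a) (a%:R * x ^+ a.-1).
Proof.
apply: DeriveDef; first exact: exprn_derivable.
by rewrite exp_derive [LHS]mulr1.
Qed.

Lemma is_derive_continuous (R : realType) (f : R -> R) (x d : R) :
  is_derive x 1 f d -> {for x, continuous f}.
Proof.
by move=> df; apply/differentiable_continuous/derivable1_diffP; case: df.
Qed.

Lemma cvg0_le_harmonic (R : realType) (u : nat -> R) (C : R) :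
  (forall n, `|u n| <= C * n.+1%:R^-1) -> u @ \oo --> 0.
Proof.
move=> uC; apply: norm_cvg0.
apply: (@squeeze_cvgr _ _ _ _ (cst 0) (fun n => C * harmonic n)).
- by apply: nearW => n; rewrite normr_ge0 /=; exact: uC.
- exact: cvg_cst.
- by rewrite -(mulr0 C); apply: cvgM; [exact: cvg_cst|exact: cvg_harmonic].
Qed.

(** * Moments of the one-variable Gaussian *)

Section gaussian_moments.
Context {R : realType}.
Local Notation mu := (@lebesgue_measure R).
Implicit Types a : nat.

(** With y = 1 + x^2 one has |x| <= y and y^(a+1) / (a+1)! <= exp y = e exp(x^2), whence the
    constant. The comparison function 1 / (1 + x^2) is chosen for its bounded primitive [atan]. *)
Lemma gauss_fun_decay a (x : R) :
  `|x| ^+ a * gauss_fun x <= a.+1`!%:R * expR 1 * (1 + x ^+ 2)^-1.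
Proof.
have y0 : 0 < 1 + x ^+ 2 by have := sqr_ge0 x; lra.
rewrite ler_pdivlMr//.
have xy : `|x| <= 1 + x ^+ 2.
  have := sqr_ge0 (`|x| - 1); rewrite sqrrB real_normK ?num_real//.
  have := normr_ge0 x; lra.
apply: (@le_trans _ _ ((1 + x ^+ 2) ^+ a.+1 * gauss_fun x)).
  rewrite mulrAC (exprSr (1 + x ^+ 2)) ler_wpM2r ?gauss_fun_ge0//.
  apply: ler_wpM2r; first exact: ltW.
  by apply: lerXn2r => //; rewrite nnegrE// ltW.
have /(_ a) := @expR_ge1Dxn _ (1 + x ^+ 2) _ (ltW y0).
have f0 : 0 < a.+1`!%:R :> R by rewrite ltr0n fact_gt0.
move=> h; have {}h : (1 + x ^+ 2) ^+ a.+1 / a.+1`!%:R <= expR (1 + x ^+ 2).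
  by apply: le_trans h; rewrite lerDr.
rewrite ler_pdivrMr// in h.
apply: le_trans (ler_wpM2r (gauss_fun_ge0 x) h) _.
by rewrite /gauss_fun expRD mulrAC -[X in X * _]mulrA -expRD subrr expR0 mulr1 mulrC.
Qed.

Let s n : R := n.+1%:R.

Let s_gt0 n : 0 < s n. Proof. exact: ltr0Sn. Qed.

Let nd_s : nondecreasing_seq s. Proof. by move=> m n mn; rewrite ler_nat. Qed.

Let UE : \bigcup_n [set` `[- s n, s n]] = [set: R].
Proof.
rewrite -subTset => x _; exists (Num.truncn `|x|) => //=.
by rewrite in_itv/= -ler_norml ltW// truncnS_gt.
Qed.

Lemma integrable_inv1Dsqr :
  mu.-integrable setT (EFin \o (fun x : R => (1 + x ^+ 2)^-1)).
Proof.
rewrite -UE; apply: (@integrable_exhaustion _ s _ atan _ _ _ _ pi) => //.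
- move=> x _; apply: cvgV.
    by have := sqr_ge0 x; lra.
  by apply: cvgD; [exact: cvg_cst|exact: exprn_continuous].
- by move=> x _; rewrite invr_ge0; have := sqr_ge0 x; lra.
- move=> n; have := @atan_ltpi2 R (s n); have := @atan_gtNpi2 R (- s n); lra.
Qed.

Lemma integrable_gauss_moment a :
  mu.-integrable setT (EFin \o (fun x : R => x ^+ a * gauss_fun x)).
Proof.
have := integrableZl measurableT (a.+1`!%:R * expR 1) integrable_inv1Dsqr.
move=> h; apply: (le_integrableR _ _ h) => //.
  by apply: measurable_funM => //; exact: measurable_gauss_fun.
by move=> x _ /=; rewrite normrM normrX (ger0_norm (gauss_fun_ge0 _)) gauss_fun_decay.
Qed.

Definition gauss_moment a : R := \int[mu]_x (x ^+ a * gauss_fun x).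

(** The derivative of x^a exp(-x^2) integrates to 0. For a = 0 the truncated index [a.-1] is
    harmless, being multiplied by 0. *)
Lemma gauss_moment_rec a :
  a%:R * gauss_moment a.-1 = 2 * gauss_moment a.+1.
Proof.
pose f (x : R) := a%:R * (x ^+ a.-1 * gauss_fun x) - 2 * (x ^+ a.+1 * gauss_fun x).
pose F (x : R) := x ^+ a * gauss_fun x.
have fi : mu.-integrable setT (EFin \o f).
  by apply: integrableRB => //; apply: integrableRZ => //;
    exact: integrable_gauss_moment.
have : \int[mu]_x f x = 0.
  rewrite -UE; apply: (@FTC_exhaustion _ s f F) => //.
  - move=> x _.
    have dg : is_derive x 1 (@gauss_fun R) (gauss_fun x * - (2 * x)).
      have dN : is_derive x 1 (fun y : R => - y ^+ 2) (- (2 * x)).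
        by have := is_derive_exprn 2 x; rewrite expr1; exact: is_deriveN.
      exact: (is_derive1_comp (is_derive_expR _) dN).
    apply: (is_derive_eq (is_deriveM (is_derive_exprn a x) dg)).
    by rewrite /f /GRing.scale/= exprSr; ring.
  - move=> x _; apply: cvgB; apply: cvgM; try exact: cvg_cst;
      by apply: cvgM; [exact: exprn_continuous|exact: continuous_gauss_fun].
  - by rewrite UE.
  - pose C : R := a.+1`!%:R * expR 1.
    have C0 : 0 <= C by rewrite mulr_ge0 ?expR_ge0.
    have FC x : `|F x| <= C * (1 + x ^+ 2)^-1.
      by rewrite normrM normrX (ger0_norm (gauss_fun_ge0 _)) gauss_fun_decay.
    apply: (@cvg0_le_harmonic _ _ (2 * C)) => n.
    apply: (le_trans (ler_normB _ _)).
    have sC : C * (1 + s n ^+ 2)^-1 <= C * (s n)^-1.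
      apply: ler_wpM2l => //; rewrite lef_pV2 ?posrE//.
        have := sqr_ge0 (s n - 1); have := s_gt0 n; nra.
      have := sqr_ge0 (s n); lra.
    have h1 := le_trans (FC (s n)) sC.
    have h2 : `|F (- s n)| <= C / s n by apply: le_trans (FC _) _; rewrite sqrrN.
    by rewrite -mulrA mulr_natl mulr2n; exact: lerD.
rewrite RintegralB//; try (apply: integrableRZ => //; exact: integrable_gauss_moment).
rewrite !RintegralZl//; try exact: integrable_gauss_moment.
by move/eqP; rewrite subr_eq0 => /eqP.
Qed.

End gaussian_moments.

(** * The Gegenbauer weight and its moments *)

Section gegenbauer_weight.
Context {R : realType}.
Local Notation mu := (@lebesgue_measure R).
Variable n : nat.
Hypothesis n2 : (2 <= n)%N.
Local Notation w := (@gegenbauer_weight R n).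

(** For n = 2 the weight is unbounded near both ends, so (-1, 1) is exhausted from inside; the shift
    by two keeps s 0 = 1/2 positive. *)
Let s k : R := 1 - k.+2%:R^-1.

Let s_gt0 k : 0 < s k.
Proof. by rewrite /s subr_gt0 invf_lt1// ltr1n. Qed.

Let nd_s : nondecreasing_seq s.
Proof.
by move=> i j ij; rewrite /s lerD2l lerN2 lef_pV2 ?posrE// ler_nat.
Qed.

Let UE : \bigcup_k [set` `[- s k, s k]] = [set` `]-1, 1[] :> set R.
Proof.
apply/seteqP; split => [x [k _]|x]; rewrite /= !in_itv/=.
  have k0 : 0 < k.+2%:R^-1 :> R by rewrite invr_gt0.
  rewrite /s; move: (k.+2%:R^-1) k0 => v v0 /andP[h1 h2].
  by apply/andP; split; lra.
rewrite -ltr_norml => x1; have x0 : 0 < 1 - `|x| by rewrite subr_gt0.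
exists (Num.truncn (1 - `|x|)^-1) => //=; rewrite in_itv/= -ler_norml /s.
rewrite lerBrDr addrC -lerBrDr -[leRHS]invrK lef_pV2 ?posrE ?invr_gt0//.
rewrite ltW// (lt_trans (truncnS_gt _))// ltr_nat.
exact: ltnSn.
Qed.

Lemma onemsqr_gt0 (x : R) : -1 < x < 1 -> 0 < 1 - x ^+ 2.
Proof. by move=> /andP[? ?]; nra. Qed.

Lemma gegenbauer_weight_ge0 x : 0 <= w x. Proof. exact: powR_ge0. Qed.

Lemma is_derive_onemsqr_powR r (x : R) : -1 < x < 1 ->
  is_derive x 1 (fun y => (1 - y ^+ 2) `^ r)
    (- (r * 2) * x * (1 - x ^+ 2) `^ (r - 1)).
Proof.
move=> /onemsqr_gt0 x1.
have dN : is_derive x 1 (fun y : R => 1 - y ^+ 2) (0 - 2 * x).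
  have := is_derive_exprn 2 x; rewrite expr1 => d2.
  exact: (is_deriveB (is_derive_cst (1 : R) _ _) d2).
have := @is_derive1_comp R (fun y => y `^ r) (fun y => 1 - y ^+ 2) x _ _
  (@is_derive1_powR R r _ x1) dN.
by move=> h; apply: (is_derive_eq h); ring.
Qed.

Lemma continuous_gegenbauer_weight x : -1 < x < 1 -> {for x, continuous w}.
Proof.
by move=> /is_derive_onemsqr_powR h; apply: is_derive_continuous (h _).
Qed.

Let U_oo x : (\bigcup_k [set` `[- s k, s k]]) x -> -1 < x < 1.
Proof. by rewrite UE /= in_itv. Qed.

(** For 0 < y <= 1 the power y^r decreases in r, and (n - 3) / 2 >= -1/2. The bound is the
    derivative of [asin], which is bounded; this is how w is shown integrable. *)
Lemma gegenbauer_weight_le_powR x : -1 < x < 1 -> w x <= (1 - x ^+ 2) `^ (- 2^-1).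
Proof.
move=> x1; have h := onemsqr_gt0 x1; apply: ger_powR.
  by rewrite h /= gerBl sqr_ge0.
rewrite ler_pdivlMr// mulNr mulVf ?pnatr_eq0//.
by rewrite lerBrDr (_ : -1 + 3 = 2%:R) ?ler_nat//; ring.
Qed.

Lemma integrable_gegenbauer_weight_oo :
  mu.-integrable `]-1, 1[ (EFin \o w).
Proof.
have asin_i : mu.-integrable `]-1, 1[
    (EFin \o (fun x : R => (1 - x ^+ 2) `^ (- 2^-1))).
  rewrite -UE; apply: (@integrable_exhaustion _ s _ asin _ _ _ _ pi) => //.
  - move=> x /U_oo x1; have h := is_derive1_asin x1.
    apply: (is_derive_eq h); rewrite powRN powR12_sqrt//.
    exact/ltW/onemsqr_gt0.
  - by move=> x /U_oo x1; apply: is_derive_continuous (is_derive_onemsqr_powR _ x1).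
  - by move=> x _; exact: powR_ge0.
  - move=> k; have s1 : s k <= 1 by rewrite /s gerBl invr_ge0.
    have := s_gt0 k => s0.
    have sk : -1 <= s k <= 1 by apply/andP; split; lra.
    have Nsk : -1 <= - s k <= 1 by apply/andP; split; lra.
    have := asin_lepi2 sk; have := asin_geNpi2 Nsk; lra.
apply: (le_integrableR _ _ asin_i) => //.
  rewrite -UE; apply: (@measurable_exhaustion _ s w).
  by move=> x /U_oo; exact: continuous_gegenbauer_weight.
move=> x; rewrite /= in_itv/= => x1.
by rewrite ger0_norm ?gegenbauer_weight_ge0// gegenbauer_weight_le_powR.
Qed.

Lemma measurable_gegenbauer_weight : measurable_fun setT w.
Proof.
apply: (measurableT_comp (measurable_powR _)).
by apply: measurable_funB => //; exact: measurable_funX.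
Qed.

Lemma integrable_itvcc (f : R -> R) : measurable_fun setT f ->
  mu.-integrable `]-1, 1[ (EFin \o f) -> mu.-integrable `[-1, 1] (EFin \o f).
Proof.
move=> mf /integrableP[_ fi]; apply/integrableP; split.
  by apply/measurable_EFinP; exact: measurable_funTS.
rewrite integral_itv_bndoo//.
by apply: measurableT_comp => //; apply/measurable_EFinP; exact: measurable_funTS.
Qed.

Lemma integrable_poly_weight (p : {poly R}) :
  mu.-integrable `[-1, 1] (EFin \o (fun x => p.[x] * w x)).
Proof.
have mp : measurable_fun setT (horner p).
  by apply: continuous_measurable_fun; exact: continuous_horner.
pose M : R := \sum_(i < size p) `|p`_i|.
have pM x : x \in `]-1, 1[ -> `|p.[x]| <= M.
  rewrite in_itv/= -ltr_norml => x1.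
  rewrite horner_coef; apply: le_trans (ler_norm_sum _ _ _) _.
  apply: ler_sum => i _; rewrite normrM normrX ler_piMr//.
  by rewrite exprn_ile1// ltW.
apply: integrable_itvcc.
  by apply: measurable_funM => //; exact: measurable_gegenbauer_weight.
have := integrableRZ M _ integrable_gegenbauer_weight_oo.
move=> /(_ (measurable_itv _)) h.
apply: (le_integrableR _ _ h) => //.
  apply: measurable_funTS.
  by apply: measurable_funM => //; exact: measurable_gegenbauer_weight.
move=> x /= x1; rewrite normrM (ger0_norm (gegenbauer_weight_ge0 _)).
by rewrite ler_wpM2r ?gegenbauer_weight_ge0 ?pM.
Qed.

Definition weight_moment a : R := \int[mu]_(x in `[-1, 1]) (x ^+ a * w x).

Let cvg_sqrt_onem : Num.sqrt (1 - s k ^+ 2) @[k --> \oo] --> 0.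
Proof.
rewrite -[X in _ --> X](sqrtr0 R).
apply: continuous_cvg; first exact: sqrt_continuous.
apply: (@cvg0_le_harmonic _ _ 2) => k; rewrite /s.
have k0 : 0 < k.+2%:R^-1 :> R by rewrite invr_gt0.
have k1 : k.+2%:R^-1 <= k.+1%:R^-1 :> R by rewrite lef_pV2 ?posrE// ler_nat.
have k2 : k.+2%:R^-1 <= 1 :> R by rewrite invf_le1 ?ler1n.
move: (k.+2%:R^-1) (k.+1%:R^-1) k0 k1 k2 => u v u0 uv u1.
by rewrite ger0_norm; nra.
Qed.

(** Integrate the derivative of x^a (1 - x^2)^((n-1)/2), which equals (a x^(a-1) - (a + n - 1)
    x^(a+1)) w. *)
Lemma weight_moment_rec a :
  a%:R * weight_moment a.-1 = (a.-1 + n)%:R * weight_moment a.+1.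
Proof.
pose r : R := (n%:R - 1) / 2.
have r1 : r - 1 = (n%:R - 3) / 2 by rewrite /r; lra.
pose f (x : R) := a%:R * (x ^+ a.-1 * w x) - (a%:R + n%:R - 1) * (x ^+ a.+1 * w x).
pose F (x : R) := x ^+ a * (1 - x ^+ 2) `^ r.
have mi b : mu.-integrable `[-1, 1] (EFin \o (fun x : R => x ^+ b * w x)).
  have := integrable_poly_weight 'X^b.
  rewrite (_ : (fun x => _) = (fun x => x ^+ b * w x))//.
  by apply/funext => x; rewrite hornerXn.
have fi : mu.-integrable `[-1, 1] (EFin \o f).
  by apply: integrableRB => //; apply: integrableRZ.
have : \int[mu]_(x in `]-1, 1[) f x = 0.
  rewrite -UE; apply: (@FTC_exhaustion _ s f F) => //.
  - move=> x /U_oo x1.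
    apply: (is_derive_eq (is_deriveM (is_derive_exprn a x) (is_derive_onemsqr_powR r x1))).
    have -> : (1 - x ^+ 2) `^ r = (1 - x ^+ 2) * w x.
      rewrite /gegenbauer_weight -r1.
      by rewrite mulr_powRB1// ?ltW ?onemsqr_gt0// /r divr_gt0// subr_gt0 ltr1n.
    rewrite r1 -/(w x) /f /GRing.scale/=.
    case: (a) => [|b]; first by rewrite /= expr0 /r; field.
    by rewrite /= !exprS /r; field.
  - move=> x /U_oo x1; have cw := continuous_gegenbauer_weight x1.
    by apply: cvgB; apply: cvgM; try exact: cvg_cst;
      by apply: cvgM; [exact: exprn_continuous|exact: cw].
  - by rewrite UE; apply: integrableS fi => //; exact: subset_itv_oo_cc.
  (* Boundary terms: as r >= 1/2, both values of F are at most sqrt(1 - s^2) in absolute value,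
     which tends to 0. *)
  - apply: norm_cvg0.
    apply: (@squeeze_cvgr _ _ _ _ (cst 0) (fun k => 2 * Num.sqrt (1 - s k ^+ 2))).
    + apply: nearW => k; rewrite normr_ge0/=.
      have s1 : s k < 1 by rewrite /s gtrBl invr_gt0.
      have s0 := s_gt0 k.
      have sk : -1 < s k < 1 by apply/andP; split; lra.
      have le1 : (1 - s k ^+ 2) `^ r <= Num.sqrt (1 - s k ^+ 2).
        rewrite -powR12_sqrt; last exact/ltW/onemsqr_gt0.
        apply: ger_powR; first by rewrite onemsqr_gt0//= gerBl sqr_ge0.
        by rewrite /r ler_pdivlMr// mulVf// lerBrDr (_ : 1 + 1 = 2%:R)// ler_nat.
      have Fs x : `|x| = s k -> `|F x| <= Num.sqrt (1 - s k ^+ 2).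
        move=> xs; rewrite /F normrM normrX xs (ger0_norm (powR_ge0 _ _)).
        have -> : x ^+ 2 = s k ^+ 2 by rewrite -xs real_normK// num_real.
        apply: le_trans le1; rewrite ler_piMl ?powR_ge0//.
        by apply: exprn_ile1; exact: ltW.
      apply: (le_trans (ler_normB _ _)); rewrite mulr_natl mulr2n.
      by apply: lerD; apply: Fs; rewrite ?normrN gtr0_norm.
    + exact: cvg_cst.
    + by rewrite -(mulr0 2); apply: cvgM; [exact: cvg_cst|exact: cvg_sqrt_onem].
have -> : \int[mu]_(x in `]-1, 1[) f x = \int[mu]_(x in `[-1, 1]) f x.
  rewrite /Rintegral [in RHS]integral_itv_bndoo//.
  apply: measurable_funS (measurable_int _ fi) => //; exact: subset_itv_oo_cc.
rewrite RintegralB//; try by apply: integrableRZ.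
rewrite !RintegralZl// -!/(weight_moment _).
(* For a = 0 the statement has the factor n where the computation gives n - 1; either way the first
   moment vanishes. *)
case: (a) => [|b]; last by rewrite -natr1 natrD => /eqP; lra.
have n1 : n%:R - 1 != 0 :> R by rewrite subr_eq0 pnatr_eq1 gtn_eqF.
rewrite !mul0r !add0r => /eqP; rewrite oppr_eq0 mulf_eq0 (negbTE n1) /=.
by move=> /eqP ->; rewrite mulr0.
Qed.

(** On [-1/2, 1/2] the base 1 - x^2 lies in [3/4, 1] and the exponent is at most n, so w >= (3/4)^n
    there. *)
Lemma weight_moment0_gt0 : 0 < weight_moment 0.
Proof.
pose c : R := (3 / 4) ^+ n.
have mw : measurable_fun setT (EFin \o (fun x : R => x ^+ 0 * w x)).
  apply/measurable_EFinP; apply: measurable_funM => //.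
  exact: measurable_gegenbauer_weight.
have wi : mu.-integrable `[-1, 1] (EFin \o (fun x : R => x ^+ 0 * w x)).
  have := integrable_poly_weight 1.
  rewrite (_ : (fun x => _) = (fun x => x ^+ 0 * w x))//.
  by apply/funext => x; rewrite hornerC expr0.
rewrite /weight_moment /Rintegral; apply: fine_gt0; apply/andP; split; last first.
  exact: (integrable_lty _ wi).
have c0 : 0 < c by rewrite exprn_gt0//; lra.
apply: (@lt_le_trans _ _ (\int[mu]_(x in `[(- 2^-1)%R, 2^-1%R]) (c%:E))%E).
  rewrite integral_cst//= lebesgue_measure_itv/= lte_fin.
  rewrite ifT; last by lra.
  by rewrite -EFinD -EFinM lte_fin mulr_gt0//; lra.
apply: (@le_trans _ _ (\int[mu]_(x in `[(- 2^-1)%R, 2^-1%R]) (x ^+ 0 * w x)%:E)%E).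
  apply: ge0_le_integral => //.
  - by move=> x _; rewrite lee_fin ltW.
  - exact: measurable_funTS.
  - move=> x; rewrite /= in_itv/= => /andP[h1 h2]; rewrite lee_fin expr0 mul1r.
    have x2 : 3 / 4 <= 1 - x ^+ 2 by nra.
    have x1 : 0 < 1 - x ^+ 2 <= 1.
      by apply/andP; split; [lra|rewrite gerBl sqr_ge0].
    apply: (@le_trans _ _ ((1 - x ^+ 2) `^ n%:R)).
      rewrite powR_mulrn; last by lra.
      by apply: lerXn2r => //; rewrite nnegrE; lra.
    apply: ger_powR => //.
    have : 0 <= n%:R :> R by [].
    lra.
apply: ge0_subset_integral => //.
- exact: measurable_funTS.
- by move=> x _; rewrite lee_fin expr0 mul1r gegenbauer_weight_ge0.
- by apply: subset_itv; rewrite bnd_simp; lra.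
Qed.

End gegenbauer_weight.

(** Transparent, so that its values stay convertible to those of [pushforward]; several equalities
    below hold by conversion. *)
Definition image_measure {R : realType} d1 d2 (T1 : measurableType d1)
    (T2 : measurableType d2) (m : {measure set T1 -> \bar R}) (f : T1 -> T2)
    (mf : measurable_fun setT f) : {measure set T2 -> \bar R}.
Proof. by refine (pushforward m f : measure _ _). Defined.

Lemma ge0_integral_image {R : realType} d1 d2 (T1 : measurableType d1)
    (T2 : measurableType d2) (m : {measure set T1 -> \bar R}) (f : T1 -> T2)
    (mf : measurable_fun setT f) (h : T2 -> \bar R) :
  measurable_fun setT h -> (forall y, 0 <= h y)%E ->
  (\int[image_measure m mf]_y h y = \int[m]_x h (f x))%E.
Proof.
move=> mh h0.
by have := ge0_integral_pushforward mf m measurableT mh (fun y _ => h0 y).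
Qed.

Lemma integral_image {R : realType} d1 d2 (T1 : measurableType d1)
    (T2 : measurableType d2) (m : {measure set T1 -> \bar R}) (f : T1 -> T2)
    (mf : measurable_fun setT f) (h : T2 -> \bar R) :
  measurable_fun setT h -> m.-integrable setT (h \o f) ->
  (\int[image_measure m mf]_y h y = \int[m]_x h (f x))%E.
Proof.
move=> mh hi.
by have := integral_pushforward mf (D := setT) mh hi measurableT.
Qed.

(** * Lebesgue measure under homotheties *)

Section scaling.
Context {R : realType}.
Local Notation point n := (n.-tuple (measurableTypeR R)).

Lemma measurable_scale (s : R) :
  measurable_fun setT (fun x => s * x : measurableTypeR R).
Proof. exact: mulrl_measurable. Qed.

Lemma lebesgue_measure_scale (s : R) (A : set (measurableTypeR R)) :
  0 < s -> measurable A ->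
  (lebesgue_measure A = s%:E * lebesgue_measure ((fun x => s * x)%R @^-1` A))%E.
Proof.
move=> s0 mA.
apply: (@lebesgue_measure_unique R (mscale (NngNum (ltW s0))
  (image_measure lebesgue_measure (measurable_scale s)))) => // _ [[a b] _ <-].
rewrite [RHS](_ : _ = (s%:E *
  lebesgue_measure ((fun x => s * x)%R @^-1` `]a, b]%classic))%E)//.
have -> : (fun x => s * x) @^-1` `]a, b] = `](a / s), (b / s)]%classic.
  apply/seteqP; split=> x /=; rewrite !in_itv/= ler_pdivlMr// ltr_pdivrMr//;
  by rewrite ![x * s]mulrC.
rewrite !lebesgue_measure_itv/= !lte_fin ltr_pM2r ?invr_gt0//.
case: ifPn => _; last by rewrite mule0.
by rewrite -!EFinD -EFinM -mulrBl mulrC divfK ?gt_eqF.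
Qed.

Definition scale_tuple n (s : R) (x : point n) : point n :=
  [tuple s * tnth x i | i < n].

Lemma measurable_scale_tuple n s : measurable_fun setT (@scale_tuple n s).
Proof.
apply/measurable_fun_tnthP => i.
rewrite (_ : _ \o _ = fun x : point n => s * tnth x i).
  by apply: measurable_funM => //; exact: measurable_tnthR.
by apply/funext => x /=; rewrite tnth_mktuple.
Qed.

(** Induction on n: the rescaled image measure agrees with the product measure on rectangles, and a
    product measure is determined by these. *)
Lemma lebesgue_power_scale n (s : R) (A : set (point n)) :
  0 < s -> measurable A ->
  (lebesgue_power n A = (s ^+ n)%:E * lebesgue_power n (@scale_tuple n s @^-1` A))%E.
Proof.
move=> s0; elim: n A => [|n ih] A mA.
  rewrite expr0 mul1e; congr (_ _); apply/funext => x; congr A.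
  by apply/val_inj; rewrite [in LHS]tuple0 [in RHS]tuple0.
pose P := @lebesgue_power R n.
pose psi (p : measurableTypeR R * point n) := (s * p.1 : measurableTypeR R, scale_tuple s p.2).
have mpsi : measurable_fun setT psi.
  apply/measurable_fun_pairP; split.
    by apply: (measurableT_comp (measurable_scale s)).
  by apply: (measurableT_comp (measurable_scale_tuple s)).
have sn0 : 0 <= s ^+ n.+1 by rewrite exprn_ge0// ltW.
pose m' := mscale (NngNum sn0) (image_measure (lebesgue_measure \x P)%E mpsi).
have m'E (B : set (measurableTypeR R)) (C : set (point n)) :
    measurable B -> measurable C -> m' (B `*` C) = (lebesgue_measure B * P C)%E.
  move=> mB mC.
  have -> : m' (B `*` C) = ((s ^+ n.+1)%:E * (lebesgue_measure \x P)
    (((fun x => s * x)%R @^-1` B) `*` (@scale_tuple n s @^-1` C)))%E by [].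
  rewrite product_measure1E//=; last 2 first.
  - by rewrite -[X in measurable X]setTI; exact: measurable_scale.
  - by rewrite -[X in measurable X]setTI; exact: measurable_scale_tuple.
  rewrite (lebesgue_measure_scale s0 mB) (ih _ mC) exprS EFinM.
  by rewrite !muleA; congr (_ * _)%E; rewrite -!muleA; congr (_ * _)%E; rewrite muleC.
have mcA : measurable (@cons_pair _ _ n @^-1` A).
  by rewrite -[X in measurable X]setTI; exact: measurable_cons_pair.
have := @product_measure_unique _ _ _ _ _ _ P m' m'E _ mcA.
move=> mE; rewrite -[LHS]/((lebesgue_measure \x P)%E (@cons_pair _ _ n @^-1` A)) mE.
rewrite -[LHS]/((s ^+ n.+1)%:E * (lebesgue_measure \x P)%E
  (psi @^-1` (@cons_pair _ _ n @^-1` A)))%E.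
rewrite -[lebesgue_power _ _]/((lebesgue_measure \x P)%E
  (@cons_pair _ _ n @^-1` (scale_tuple s @^-1` A))).
congr (_ * _)%E; congr (_ _); apply/funext => -[a x] /=; congr A.
apply: eq_from_tnth => i; rewrite tnth_mktuple.
case: (unliftP ord0 i) => [j|] ->; first by rewrite !tnthS/= tnth_mktuple.
by rewrite !tnth0.
Qed.

End scaling.

(** * Polar coordinates *)

Section polar.
Context {R : realType}.
Local Notation point n := (n.-tuple (measurableTypeR R)).
Variable n : nat.
Hypothesis n0 : (0 < n)%N.
Local Notation lam := (@lebesgue_power R n).

Lemma dotp_ge0 (x : point n) : 0 <= dotp x x.
Proof. by apply: sumr_ge0 => i _; rewrite -expr2 sqr_ge0. Qed.

Lemma enorm_ge0 (x : point n) : 0 <= enorm x. Proof. exact: sqrtr_ge0. Qed.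

Lemma enorm_sqr (x : point n) : enorm x ^+ 2 = dotp x x.
Proof. by rewrite sqr_sqrtr// dotp_ge0. Qed.

Lemma normr_tnth_le_enorm (x : point n) i : `|tnth x i| <= enorm x.
Proof.
rewrite -sqrtr_sqr ler_wsqrtr// /dotp (bigD1 i)//= -expr2 lerDl.
by apply: sumr_ge0 => j _; rewrite -expr2 sqr_ge0.
Qed.

Lemma enorm_scale s (x : point n) : 0 <= s -> enorm (scale_tuple s x) = s * enorm x.
Proof.
move=> s0; rewrite /enorm.
have -> : dotp (scale_tuple s x) (scale_tuple s x) = s ^+ 2 * dotp x x.
  by rewrite /dotp mulr_sumr; apply: eq_bigr => i _; rewrite tnth_mktuple; ring.
by rewrite sqrtrM ?sqr_ge0// sqrtr_sqr ger0_norm.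
Qed.

Lemma normalize_scale s (x : point n) : 0 < s ->
  normalize (scale_tuple s x) = normalize x.
Proof.
move=> s0; apply: eq_from_tnth => i; rewrite !tnth_mktuple enorm_scale ?ltW//.
by rewrite -mulf_div divff ?mul1r// gt_eqF.
Qed.

Lemma enorm_eq0 (x : point n) : enorm x = 0 <-> forall i, tnth x i = 0.
Proof.
split=> [x0 i|x0].
  by apply/eqP; rewrite -normr_le0 -x0 normr_tnth_le_enorm.
by rewrite /enorm /dotp big1 ?sqrtr0// => i _; rewrite x0 mul0r.
Qed.

Lemma lebesgue_power_enorm0 : lam [set x | enorm x = 0] = 0%E.
Proof.
have -> : [set x : point n | enorm x = 0] = box ([set 0] : set (measurableTypeR R)).
  by apply/seteqP; split=> x; rewrite /= enorm_eq0.
rewrite power_measure_box; last exact: (measurable_set1 (0 : R)).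
transitivity ((0 : \bar R) ^+ n)%E; last by case: (n) n0 => // m _; rewrite expeS mul0e.
by congr (_ ^+ n)%E; exact: lebesgue_measure_set1.
Qed.

Let mN (A : set (point n)) : measurable A -> measurable (@normalize R n @^-1` A).
Proof. by move=> mA; rewrite -[X in measurable X]setTI; exact: measurable_normalize. Qed.

Let mE (B : set R) : measurable B -> measurable (@enorm R n @^-1` B).
Proof. by move=> mB; rewrite -[X in measurable X]setTI; exact: measurable_enorm. Qed.

(** The distribution of the radius on the cone over [A]. *)
Let nu (A : set (point n)) (mA : measurable A) :
    {measure set R -> \bar R} :=
  image_measure (mrestr lam (mN mA)) (@measurable_enorm R n).

Let nuE A (mA : measurable A) B :
  nu mA B = lam (@enorm R n @^-1` B `&` @normalize R n @^-1` A).
Proof. by []. Qed.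

Let b (A : set (point n)) := lam (@enorm R n @^-1` `]0, 1[ `&` @normalize R n @^-1` A).

Let Iio_pos A (mA : measurable A) s : 0 < s ->
  lam (@enorm R n @^-1` `]0, s[ `&` @normalize R n @^-1` A) = ((s ^+ n)%:E * b A)%E.
Proof.
move=> s0; rewrite (lebesgue_power_scale s0); last first.
  by apply: measurableI; [apply: mE|exact: mN].
congr (_ * lam _)%E; apply/seteqP; split=> x /=; rewrite !in_itv/=.
  rewrite normalize_scale// enorm_scale ?ltW// pmulr_rgt0// gtr_pMr//.
rewrite normalize_scale// enorm_scale ?ltW// pmulr_rgt0// gtr_pMr//.
Qed.

Let nu_Iio A (mA : measurable A) s :
  nu mA `]-oo, s[%classic = if 0 < s then ((s ^+ n)%:E * b A)%E else 0%E.
Proof.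
rewrite nuE; case: ifPn => s0.
  rewrite -Iio_pos//; apply/eqP; rewrite eq_le; apply/andP; split; last first.
    apply: le_measure; rewrite ?inE.
    - by apply: measurableI; [apply: mE|exact: mN].
    - by apply: measurableI; [apply: mE|exact: mN].
    - by move=> x /=; rewrite !in_itv/= => -[/andP[]].
  (* The half-line also contains the radius 0, that is the origin, which is a null set. *)
  rewrite -[leRHS]adde0 -lebesgue_power_enorm0.
  apply: le_trans (measureU2 _ _ _).
  - apply: le_measure; rewrite ?inE.
    + by apply: measurableI; [apply: mE|exact: mN].
    + apply: measurableU; last by apply: (mE (B := [set (0 : R)])); exact: measurable_set1.
      by apply: measurableI; [apply: mE|exact: mN].
    + move=> x /=; rewrite !in_itv/= => -[xs Ax].
      have := enorm_ge0 x; rewrite le_eqVlt => /predU1P[<-|x0]; first by right.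
      by left; rewrite x0.
  - by apply: measurableI; [apply: mE|exact: mN].
  - by apply: (mE (B := [set (0 : R)])); exact: measurable_set1.
apply/eqP; rewrite eq_le measure_ge0 andbT.
rewrite (_ : _ `&` _ = set0) ?measure0//; apply/seteqP; split=> x //=.
rewrite in_itv/= => -[xs _]; move: s0; rewrite -leNgt => s0.
by have := enorm_ge0 x; rewrite leNgt (lt_le_trans xs).
Qed.

Let b_fin A : measurable A -> b A \is a fin_num.
Proof.
move=> mA; rewrite ge0_fin_numE ?measure_ge0//.
apply: (@le_lt_trans _ _ (lam (@cube R n))).
  apply: le_measure; rewrite ?inE.
  - by apply: measurableI; [apply: mE|exact: mN].
  - exact: measurable_cube.
  - move=> x [/=]; rewrite in_itv/= => /andP[_ x1] _ i.
    rewrite /= in_itv/= -ler_norml.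
    exact: le_trans (normr_tnth_le_enorm _ _) (ltW x1).
rewrite power_measure_box//= lebesgue_measure_itv/= lte_fin.
by case: ifP => _; rewrite -?EFinB -EFin_expe ltry.
Qed.

(** The ball contains the cube of side v = 1/(n+1) in the positive orthant: each x_i^2 <= v there,
    so |x|^2 <= n/(n+1) < 1. *)
Let bT_gt0 : (0 < b setT)%E.
Proof.
have c0 : 0 < n.+1%:R^-1 :> R by rewrite invr_gt0.
apply: (@lt_le_trans _ _ (lam (@box _ (measurableTypeR R) n [set` `]0, n.+1%:R^-1[]))).
  rewrite power_measure_box//= lebesgue_measure_itv/= lte_fin c0.
  by rewrite oppr0 adde0 -EFin_expe lte_fin exprn_gt0.
apply: le_measure; rewrite ?inE.
- exact: measurable_box.
- by apply: measurableI; [apply: mE|exact: mN].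
move=> x xb; split => //=; rewrite in_itv/=.
have xi i : 0 < tnth x i < n.+1%:R^-1 by have := xb i; rewrite /= in_itv.
apply/andP; split.
  rewrite lt_neqAle enorm_ge0 andbT eq_sym; apply/eqP => /enorm_eq0 /(_ (Ordinal n0)).
  by have /andP[+ _] := xi (Ordinal n0) => /[swap] ->; rewrite ltxx.
rewrite -[ltRHS]sqrtr1 ltr_sqrt// /dotp.
apply: (@le_lt_trans _ _ (\sum_(i < n) n.+1%:R^-1)).
  apply: ler_sum => i _; have /andP[h1 h2] := xi i.
  have : n.+1%:R^-1 <= 1 :> R by rewrite invf_le1 ?ler1n.
  by move: (n.+1%:R^-1) h2 => v h2 v1; nra.
by rewrite sumr_const card_ord -[ltLHS]mulr_natl ltr_pdivrMr// mul1r ltr_nat.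
Qed.

(** By scaling, the cone over A cut at radius s has volume s^n b(A), so the radial distributions for
    A and for the whole space are proportional on half-lines, a generating family stable under
    intersection. The product form avoids a division in the extended reals. *)
Let nu_prop A (mA : measurable A) B : measurable B ->
  (b setT * nu mA B = b A * nu (@measurableT _ _) B)%E.
Proof.
move=> mB.
have bE A' : measurable A' -> (b A' = (fine (b A'))%:E)%E.
  by move=> mA'; rewrite fineK// b_fin.
have b0 A' : 0 <= fine (b A') by rewrite fine_ge0// measure_ge0.
rewrite (bE _ measurableT) (bE _ mA).
pose m1 : {measure set R -> \bar R} := mscale (NngNum (b0 setT)) (nu mA).
pose m2 : {measure set R -> \bar R} := mscale (NngNum (b0 A)) (nu (@measurableT _ (point n))).
have m1E C : m1 C = ((fine (b setT))%:E * nu mA C)%E by [].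
have m2E C : m2 C = ((fine (b A))%:E * nu (@measurableT _ (point n)) C)%E by [].
rewrite -m1E -m2E.
apply: (@measure_unique _ R R (@RGenInftyO.G R)
  (fun k => `]-oo, k%:R[%classic) _ _ _ _ m1 m2) => //.
- exact: RGenInftyO.measurableE.
- move=> _ _ [x ->] [y ->]; exists (Num.min x y).
  apply/seteqP; split=> z /=; rewrite !in_itv/= lt_min; first by case=> -> ->.
  by move/andP.
- by move=> k; exists k%:R.
- rewrite -subTset => x _; exists (Num.truncn `|x|).+1 => //=.
  by rewrite in_itv/= (le_lt_trans (ler_norm _))// truncnS_gt.
- move=> _ [s ->]; rewrite m1E m2E !nu_Iio.
  case: ifPn => _; last by rewrite !mule0.
  rewrite (bE _ measurableT) (bE _ mA) -!EFinM; congr EFin; ring.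
- move=> k; rewrite m1E nu_Iio; case: ifPn => _; last by rewrite mule0 ltry.
  by rewrite (bE _ mA) -!EFinM ltry.
Qed.

Let cone_nu A (mA : measurable A) : cone_measure A = nu mA `]0, 1]%classic.
Proof.
rewrite /cone_measure nuE setIC; congr (lam _); apply/seteqP; split=> x [/= h1 h2];
  by split => //; move: h1; rewrite /punctured_ball /= in_itv.
Qed.

Lemma cone_measureT_gt0 : (0 < cone_measure [set: point n])%E.
Proof.
apply: (lt_le_trans bT_gt0); rewrite (cone_nu measurableT) nuE /b.
apply: le_measure; rewrite ?inE; try by apply: measurableI; [apply: mE|exact: mN].
by move=> x [/=]; rewrite !in_itv/= => /andP[-> /ltW ->].
Qed.

Lemma cone_measure_prop A B : measurable A -> measurable B ->
  (cone_measure [set: point n] *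
    lam (@enorm R n @^-1` B `&` @normalize R n @^-1` A) =
  cone_measure A * lam (@enorm R n @^-1` B))%E.
Proof.
move=> mA mB.
(* The choice B = ]0, 1] expresses [cone_measure] through b; the common factor [b setT], finite and
   nonzero, is then cancelled. *)
have h1 := nu_prop mA mB; have h2 := nu_prop mA (measurable_itv `]0, 1]).
rewrite -!cone_nu in h2.
rewrite !nuE preimage_setT setIT in h1.
have bT0 : (b setT != 0)%E by rewrite gt_eqF.
have bTf := b_fin measurableT.
have inv X : (X = ((fine (b setT))^-1)%:E * (b setT * X))%E.
  rewrite muleA -[X in (_ * X * _)%E](fineK bTf) -EFinM mulVf ?mul1e//.
  by rewrite fine_eq0.
rewrite [lam (_ `&` _)]inv h1 [cone_measure A]inv h2 !muleA; congr (_ * _)%E.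
by rewrite -muleA muleC.
Qed.

(** By [cone_measure_prop], direction and radius are independent: the image of Lebesgue measure is
    multiplicative on rectangles, hence a product measure. The radial factor is the law of |x|
    divided by the total area n k. *)
Lemma polar_product : exists m2 : {sigma_finite_measure set R -> \bar R},
  (exists2 k : R, 0 < k & forall B, m2 B = (k%:E * lam (@enorm R n @^-1` B))%E) /\
  forall X : set (point n * R), measurable X ->
    (surface_measure n \x m2)%E X =
    lam ((fun x => (normalize x, enorm x)) @^-1` X).
Proof.
have kf : cone_measure [set: point n] \is a fin_num.
  by rewrite fin_num_measure.
pose k := fine (cone_measure [set: point n]).
have k0 : 0 < k by rewrite fine_gt0// cone_measureT_gt0 ltey_eq kf.
have nk0 : 0 < n%:R * k by rewrite mulr_gt0// ltr0n.
pose m : {measure set R -> \bar R} := mscale (NngNum (ltW (divr_gt0 ltr01 nk0)))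
  (image_measure lam (@measurable_enorm R n)).
have mEq C : m C = ((1 / (n%:R * k))%:E * lam (@enorm R n @^-1` C))%E by [].
have msf : sigma_finite setT m.
  exists (fun j => [set` `]-oo, j%:R[]).
    apply/esym; rewrite -subTset => x _; exists (Num.truncn `|x|).+1 => //=.
    by rewrite in_itv/= (le_lt_trans (ler_norm _))// truncnS_gt.
  move=> j; split=> //; rewrite mEq.
  have := nu_Iio measurableT j%:R; rewrite nuE preimage_setT setIT => ->.
  case: ifP => _; last by rewrite mule0 ltry.
  by rewrite -(fineK (b_fin measurableT)) -!EFinM ltry.
pose m2 : {sigma_finite_measure set R -> \bar R} :=
  HB.pack (m : set R -> \bar R) (Measure.class m)
    (Measure_isSigmaFinite.Build _ _ _ m msf).
have mpsi : measurable_fun setT (fun x : point n => (normalize x, enorm x)).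
  apply/measurable_fun_pairP; split; first exact: measurable_normalize.
  exact: measurable_enorm.
exists m2; split; first by exists (1 / (n%:R * k)) => //; rewrite divr_gt0.
move=> X mX.
apply: (@product_measure_unique _ _ _ _ _ (surface_measure n) m2
  (image_measure lam mpsi)) => // A B mA mB.
rewrite -[RHS]/((n%:R)%:E * cone_measure A *
  ((1 / (n%:R * k))%:E * lam (@enorm R n @^-1` B)))%E.
rewrite -[LHS]/(lam (@normalize R n @^-1` A `&` @enorm R n @^-1` B)).
have := cone_measure_prop mA mB; rewrite -(fineK kf) -/k => h.
have -> : (n%:R%:E * cone_measure A * ((1 / (n%:R * k))%:E * lam (enorm (n:=n) @^-1` B))
  = (n%:R * (1 / (n%:R * k)))%:E * (cone_measure A * lam (enorm (n:=n) @^-1` B)))%E.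
  by rewrite EFinM muleACA.
have nkE : n%:R * (1 / (n%:R * k)) * k = 1 by rewrite mul1r mulrAC divff// gt_eqF.
by rewrite -h muleA -EFinM nkE mul1e setIC.
Qed.

Lemma measurable_sphere : measurable (@sphere R n).
Proof. exact: (mE (B := [set (1 : R)])). Qed.

Lemma enorm_normalize (x : point n) : enorm x != 0 -> enorm (normalize x) = 1.
Proof.
move=> x0; have xp : 0 < enorm x by rewrite lt_neqAle eq_sym x0 enorm_ge0.
rewrite (_ : normalize x = scale_tuple (enorm x)^-1 x); last first.
  by apply: eq_from_tnth => i; rewrite !tnth_mktuple mulrC.
by rewrite enorm_scale ?mulVf// invr_ge0 enorm_ge0.
Qed.

Lemma gauss_fun_enorm (x : point n) :
  gauss_fun (enorm x) = \prod_(i < n) gauss_fun (tnth x i).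
Proof.
rewrite /gauss_fun enorm_sqr -expR_sum; congr expR.
by rewrite /dotp -sumrN; apply: eq_bigr => i _; rewrite -expr2.
Qed.

(** A dominating function in product form is built so that [power_measure_prod] applies: |x|^m <= (1
    + |x|^2)^m <= prod_i (1 + x_i^2)^m, and (1 + y)^m <= 2^m (1 + y^m) turns each factor into the
    moments in [h]. *)
Lemma integrable_enorm_gauss m :
  lam.-integrable setT (EFin \o (fun x => enorm x ^+ m * gauss_fun (enorm x))).
Proof.
pose h (y : R) := 2 ^+ m * (y ^+ 0 * gauss_fun y + y ^+ (m.*2) * gauss_fun y).
have hi : (@lebesgue_measure R).-integrable setT (EFin \o h).
  by apply: integrableRZ => //; apply: integrableRD => //; exact: integrable_gauss_moment.
have [Hi _] := @power_measure_prod _ _ _ (@lebesgue_measure R) n (fun=> h) (fun=> hi).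
apply: (le_integrableR _ _ Hi) => //.
  apply: measurable_funM; first by apply: measurable_funX; exact: measurable_enorm.
  by apply: measurableT_comp; [exact: measurable_gauss_fun|exact: measurable_enorm].
move=> x _; rewrite ger0_norm ?mulr_ge0 ?exprn_ge0 ?gauss_fun_ge0 ?enorm_ge0//.
rewrite gauss_fun_enorm.
have hE i : h (tnth x i) = 2 ^+ m * (1 + (tnth x i ^+ 2) ^+ m) * gauss_fun (tnth x i).
  by rewrite /h expr0 -exprM mul2n; ring.
under [leRHS]eq_bigr do rewrite hE.
rewrite big_split/= ler_wpM2r ?prodr_ge0//.
  by move=> i _; exact: gauss_fun_ge0.
have key (y : R) : 0 <= y -> (1 + y) ^+ m <= 2 ^+ m * (1 + y ^+ m).
  move=> y0; have ym := exprn_ge0 m y0.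
  have p2 : 0 <= 2 ^+ m :> R by rewrite exprn_ge0.
  have [y1|y1] := leP y 1.
    apply: (@le_trans _ _ (2 ^+ m)); last by rewrite ler_peMr// lerDl.
    by apply: lerXn2r; rewrite ?nnegrE; lra.
  apply: (@le_trans _ _ ((2 * y) ^+ m)).
    by apply: lerXn2r; rewrite ?nnegrE; lra.
  by rewrite exprMn ler_wpM2l// lerDr.
apply: (@le_trans _ _ ((1 + enorm x ^+ 2) ^+ m)).
  apply: lerXn2r; rewrite ?nnegrE ?enorm_ge0//.
    by have := sqr_ge0 (enorm x); lra.
  have := sqr_ge0 (enorm x - 1); have := enorm_ge0 x; nra.
apply: (@le_trans _ _ (\prod_(i < n) (1 + tnth x i ^+ 2) ^+ m)).
  rewrite prodrXl lerXn2r ?nnegrE//.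
  - by rewrite addr_ge0// sqr_ge0.
  - by apply: prodr_ge0 => i _; rewrite addr_ge0// sqr_ge0.
  rewrite enorm_sqr /dotp.
  suff [] : 0 <= \sum_(i < n) tnth x i * tnth x i /\
    1 + \sum_(i < n) tnth x i * tnth x i <= \prod_(i < n) (1 + tnth x i ^+ 2) by [].
  elim/big_rec2 : _ => [|i y1 y2 _ [h1 h2]]; first by rewrite addr0.
  by have := sqr_ge0 (tnth x i); rewrite -expr2 => *; split; nra.
apply: ler_prod => i _; rewrite key ?sqr_ge0// andbT.
by rewrite exprn_ge0// addr_ge0// sqr_ge0.
Qed.

Lemma ae_enorm_neq0 : {ae lam, forall x, enorm x != 0}.
Proof.
exists [set x | enorm x = 0]; split.
- exact: (mE (B := [set (0 : R)])).
- exact: lebesgue_power_enorm0.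
- by move=> x /= /negP; rewrite negbK => /eqP.
Qed.

(** For f homogeneous of degree m the integrand separates in polar coordinates into f(x/|x|) and
    g(|x|). The order of the quantifiers matters: c depends on the degree but not on f. *)
Lemma polar_homogeneous m : exists2 c : R, 0 < c & forall (f : point n -> R) (M : R),
  measurable_fun setT f -> (forall x, sphere n x -> `|f x| <= M) ->
  (forall x, enorm x != 0 -> f x = enorm x ^+ m * f (normalize x)) ->
  lam.-integrable setT (EFin \o (fun x => f x * gauss_fun (enorm x))) /\
  \int[lam]_x (f x * gauss_fun (enorm x)) = c * \int[surface_measure n]_(x in sphere n) f x.
Proof.
have [m2 [[k k0 m2k] m2E]] := polar_product.
pose g (r : R) := r ^+ m * gauss_fun r.
have mg : measurable_fun setT g.
  by apply: measurable_funM; [exact: exprn_measurable|exact: measurable_gauss_fun].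
have gi := integrable_enorm_gauss m.
have mpsi : measurable_fun setT (fun x : point n => (normalize x, enorm x)).
  apply/measurable_fun_pairP; split; first exact: measurable_normalize.
  exact: measurable_enorm.
have g0 r : 0 <= r -> 0 <= g r.
  by move=> r0; rewrite mulr_ge0 ?gauss_fun_ge0// exprn_ge0.
have abs_g : (\int[m2]_r `|(g r)%:E| = k%:E * \int[lam]_x `|(g (enorm x))%:E|)%E.
  rewrite (eq_measure_integral (mscale (NngNum (ltW k0))
    (image_measure lam (@measurable_enorm R n)))); last first.
    by move=> A mA _; exact: m2k.
  have mag : measurable_fun setT (fun r => `|(g r)%:E|%E).
    by apply: measurableT_comp => //; exact/measurable_EFinP.
  rewrite ge0_integral_mscale//; congr (_ * _)%E.
  exact: ge0_integral_image.
have gi2 : m2.-integrable setT (EFin \o g).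
  apply/integrableP; split; first exact/measurable_EFinP.
  rewrite abs_g lte_mul_pinfty//; first by rewrite lee_fin ltW.
  by move/integrableP : gi => [].
pose c := \int[m2]_r g r.
have intE (f : point n -> R) : measurable_fun setT f ->
    (surface_measure n).-integrable setT (EFin \o f) ->
    lam.-integrable setT (EFin \o (fun x => f (normalize x) * g (enorm x))) /\
    \int[lam]_x (f (normalize x) * g (enorm x)) =
    c * \int[surface_measure n]_x f x.
  move=> mf fi.
  pose F (p : point n * R) := f p.1 * g p.2.
  have mF : measurable_fun setT F.
    by apply: measurable_funM; [exact: (measurableT_comp mf)|exact: (measurableT_comp mg)].
  have Fi := integrable_tensor fi gi2.
  have Fi' : lam.-integrable setT (EFin \o (fun x => f (normalize x) * g (enorm x))).
    apply/integrableP; split.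
      apply/measurable_EFinP.
      exact: (measurableT_comp mF mpsi).
    move/integrableP : Fi => [_].
    rewrite (eq_measure_integral (image_measure lam mpsi)); last first.
      by move=> A mA _; exact: m2E.
    rewrite ge0_integral_image//.
    by apply: measurableT_comp => //; exact/measurable_EFinP.
  split=> //.
  rewrite mulrC /c /Rintegral -fineM; try exact: integrable_fin_num.
  rewrite -integral_tensor//.
  rewrite (eq_measure_integral (image_measure lam mpsi)); last first.
    by move=> A mA _; exact: m2E.
  congr fine; apply/esym.
  by rewrite integral_image//; exact/measurable_EFinP.
(* For f = 1 the formula gives the Lebesgue integral of g(|x|) as c times the total area; that
   integral is positive since g(|x|) > 0 on the punctured open unit ball, which has positive
   volume. *)
have c0 : 0 < c.
  have mge : measurable_fun setT (fun x : point n => (g (enorm x))%:E).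
    exact: (measurable_int _ gi).
  have I0 : 0 < \int[lam]_x g (enorm x).
    rewrite lt_neqAle; apply/andP; split; last first.
      by apply: Rintegral_ge0 => x _; exact/g0/enorm_ge0.
    apply/eqP => /esym I0.
    have : (\int[lam]_x `|(g (enorm x))%:E| = 0)%E.
      rewrite -[RHS]/(0%R%:E) -I0 /Rintegral fineK; last exact: (integrable_fin_num _ gi).
      by apply: eq_integral => x _; rewrite gee0_abs// lee_fin g0// enorm_ge0.
    move=> /(ae_eq_integral_abs _ measurableT mge).1 [N [mN' N0 subN]].
    have : (b setT <= lam N)%E.
      apply: le_measure; rewrite ?inE//.
        by apply: measurableI; [apply: mE|exact: mN].
      move=> x [/=]; rewrite in_itv/= => /andP[x0 _] _; apply: subN => /= /(_ I) [].
      by apply/eqP; rewrite gt_eqF// mulr_gt0 ?exprn_gt0// expR_gt0.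
    by rewrite N0 leNgt bT_gt0.
  have ci : (surface_measure n).-integrable setT (EFin \o (fun=> 1 : R)).
    exact: finite_measure_integrable_cst.
  have [_] := intE (fun=> 1) (@measurable_cst _ _ _ _ _ _) ci.
  have -> : \int[surface_measure n]_x (1 : R) = n%:R * fine (cone_measure [set: point n]).
    rewrite Rintegral_cst// mul1r -[LHS]/(fine ((n%:R)%:E * cone_measure setT)%E).
    by rewrite fineM// fin_num_measure.
  have n0R : 0 < n%:R :> R by rewrite ltr0n.
  have k1 : 0 < fine (cone_measure [set: point n]).
    by rewrite fine_gt0// cone_measureT_gt0 ltey_eq fin_num_measure.
  under eq_Rintegral do rewrite mul1r.
  move=> IE; move: I0; rewrite IE pmulr_lgt0// mulr_gt0//.
exists c => // f M mf fM fh.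
(* [surface_measure] lives on the ambient space, where f need not be bounded. Cutting f off outside
   the sphere is harmless: [normalize] lands on the sphere for x != 0. *)
pose f' := f \_ (@sphere R n).
have mf' : measurable_fun setT f'.
  apply: (measurable_restrictT f measurable_sphere).1.
  exact: measurable_funTS.
have fi' : (surface_measure n).-integrable setT (EFin \o f').
  rewrite -restrict_EFin; apply/(integrable_mkcond _ measurable_sphere).1.
  apply: (bounded_integrableR (M := M)) => //.
  - exact: measurable_sphere.
  - by rewrite -ge0_fin_numE// fin_num_measure//; exact: measurable_sphere.
  - exact: measurable_funTS.
have [Fi FE] := intE _ mf' fi'.
have ffE x : enorm x != 0 -> f x * gauss_fun (enorm x) = f' (normalize x) * g (enorm x).
  move=> x0; rewrite fh// /f' patchE mem_set; last exact: enorm_normalize.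
  by rewrite /g; ring.
have mfg : measurable_fun setT (fun x : point n => f x * gauss_fun (enorm x)).
  apply: measurable_funM => //.
  by apply: measurableT_comp; [exact: measurable_gauss_fun|exact: measurable_enorm].
have aeE : ae_eq lam setT (EFin \o (fun x => f' (normalize x) * g (enorm x)))
    (EFin \o (fun x => f x * gauss_fun (enorm x))).
  by apply: filterS ae_enorm_neq0 => x x0 _ /=; rewrite ffE.
split.
  apply/integrableP; split; first exact/measurable_EFinP.
  move/integrableP : Fi => [mF']; rewrite (ae_eq_integral
    (abse \o (EFin \o (fun x => f x * gauss_fun (enorm x)))))//.
  - exact: measurableT_comp.
  - by apply: measurableT_comp => //; exact/measurable_EFinP.
  - by apply: filterS ae_enorm_neq0 => x x0 _ /=; rewrite ffE.
rewrite [in RHS]Rintegral_mkcond -/f' -FE /Rintegral.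
congr fine; apply/esym; apply: ae_eq_integral aeE => //; first exact: (measurable_int _ Fi).
exact/measurable_EFinP.
Qed.

End polar.

(** * Homogeneous polynomials, the Laplacian and harmonic projection *)

Section polynomials.
Context {R : realType} {n : nat}.
Local Notation mp := (mpoly.mpoly n R).
Local Notation D := mpoly.mderiv.
Local Notation homog m p := (p \is mpoly.ishomog1 m mpoly.mdeg).
Implicit Types (p q : mp) (i j : 'I_n).

Definition mvar i : mp := mpoly.mpolyX R (mpoly.mnm1 i).

Lemma mpoly_span (P : mp -> Prop) :
  P 0 -> (forall c p q, P p -> P q -> P (c *: p + q)) ->
  (forall a, P (mpoly.mpolyX R a)) -> forall p, P p.
Proof. by move=> P0 PD PX; elim/mpoly.mpolyind => // c a p _ _ Pp; exact: PD. Qed.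

(** All monomials of a homogeneous polynomial have its degree, so a statement linear in p has only
    to be checked on these. *)
Lemma homog_span m (P : mp -> Prop) :
  P 0 -> (forall c p q, P p -> P q -> P (c *: p + q)) ->
  (forall a, mpoly.mdeg a = m -> P (mpoly.mpolyX R a)) ->
  forall p, homog m p -> P p.
Proof.
move=> P0 PD PX p /mpoly.dhomogP hp; rewrite (mpoly.mpolyE p).
rewrite big_seq; elim/big_rec: _ => // a q ap Pq.
by apply: PD => //; apply: PX; exact: hp.
Qed.

Lemma mvar_mpolyX i a :
  mvar i * mpoly.mpolyX R a = mpoly.mpolyX R (mpoly.mnm_add (mpoly.mnm1 i) a).
Proof. by rewrite mpoly.mpolyXD. Qed.

Lemma mvar_mderivX i a :
  mvar i * D i (mpoly.mpolyX R a) = (a i)%:R *: mpoly.mpolyX R a.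
Proof.
rewrite mpoly.mderivX -scalerAr mvar_mpolyX.
(* When x_i does not occur, the truncated exponent is wrong but its coefficient is 0. *)
have [->|ai] := eqVneq (a i) 0%N; first by rewrite !scale0r.
congr (_ *: mpoly.mpolyX R _); apply/mpoly.mnmP => j.
rewrite mpoly.mnmDE mpoly.mnmBE mpoly.mnm1E.
by case: eqP => [<-|_]; rewrite ?subn0 ?add0n// addnC subnK// lt0n.
Qed.

Lemma euler_homog m p : homog m p -> \sum_i mvar i * D i p = m%:R *: p.
Proof.
move: p; apply: homog_span.
- by rewrite scaler0 big1// => i _; rewrite mpoly.mderiv0 mulr0.
- move=> c p q hp hq; rewrite scalerDr scalerA mulrC -scalerA -hp -hq scaler_sumr -big_split.
  apply: eq_bigr => i _.
  by rewrite mpoly.mderivD mpoly.mderivZ mulrDr scalerAr.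
- move=> a <-; rewrite mpoly.mdegE natr_sum scaler_suml.
  by apply: eq_bigr => i _; rewrite mvar_mderivX.
Qed.

Lemma homog_mvar i : homog 1 (mvar i).
Proof. by rewrite mpoly.dhomogX; apply/eqP; exact: mpoly.mdeg1. Qed.

Lemma homog_mderiv m i p : homog m p -> homog m.-1 (D i p).
Proof.
move: p; apply: homog_span.
- by rewrite mpoly.mderiv0 mpoly.dhomog0.
- move=> c p q hp hq; rewrite mpoly.mderivD mpoly.mderivZ.
  by rewrite mpoly.dhomogD// mpoly.dhomogZ.
- move=> a am; rewrite mpoly.mderivX.
  have [->|ai] := eqVneq (a i) 0%N; first by rewrite scale0r mpoly.dhomog0.
  apply: mpoly.dhomogZ; rewrite mpoly.dhomogX; apply/eqP.
  have e : mpoly.mnm_add (mpoly.mnm1 i) (mpoly.mnm_sub a (mpoly.mnm1 i)) = a.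
    apply/mpoly.mnmP => j; rewrite mpoly.mnmDE mpoly.mnmBE mpoly.mnm1E.
    by case: eqP => [<-|_]; rewrite ?subn0 ?add0n// addnC subnK// lt0n.
  by rewrite -am -[in RHS]e mpoly.mdegD mpoly.mdeg1.
Qed.

Lemma mderiv_homog0 i p : homog 0 p -> D i p = 0.
Proof.
move: p; apply: homog_span.
- exact: mpoly.mderiv0.
- by move=> c p q hp hq; rewrite mpoly.mderivD mpoly.mderivZ hp hq scaler0 addr0.
- move=> a /eqP; rewrite mpoly.mdeg_eq0 => /eqP ->.
  by rewrite mpoly.mderivX mpoly.mnmE scale0r.
Qed.

Lemma laplacianD p q : laplacian (p + q) = laplacian p + laplacian q.
Proof.
by rewrite -big_split; apply: eq_bigr => i _; rewrite !mpoly.mderivD.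
Qed.

Lemma laplacianZ c p : laplacian (c *: p) = c *: laplacian p.
Proof.
by rewrite scaler_sumr; apply: eq_bigr => i _; rewrite !mpoly.mderivZ.
Qed.

Lemma laplacian0 : laplacian (0 : mp) = 0.
Proof. by rewrite /laplacian big1// => i _; rewrite !mpoly.mderiv0. Qed.

Lemma laplacian_sum I (r : seq I) (F : I -> mp) :
  laplacian (\sum_(k <- r) F k) = \sum_(k <- r) laplacian (F k).
Proof. exact: (big_morph _ laplacianD laplacian0). Qed.

Lemma laplacianM p q : laplacian (p * q) =
  laplacian p * q + 2 *: (\sum_i D i p * D i q) + p * laplacian q.
Proof.
rewrite scaler_sumr mulr_suml mulr_sumr -!big_split; apply: eq_bigr => i _ /=.
by rewrite mpoly.mderivM mpoly.mderivD !mpoly.mderivM scaler_nat mulr2n; ring.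
Qed.

Lemma laplacian_mderiv i p : laplacian (D i p) = D i (laplacian p).
Proof.
rewrite /laplacian (raddf_sum (mpoly.mderiv i)); apply: eq_bigr => j _.
by rewrite (mpoly.mderiv_comm i j) (mpoly.mderiv_comm i j).
Qed.

Lemma homog_laplacian m p : homog m p -> homog m.-2 (laplacian p).
Proof.
move=> hp; rewrite /laplacian; elim/big_rec: _ => [|i q _ hq].
  exact: mpoly.dhomog0.
by rewrite mpoly.dhomogD//; do 2 apply: homog_mderiv.
Qed.

Lemma laplacian_small m p : (m < 2)%N -> homog m p -> laplacian p = 0.
Proof.
move=> m2 hp; rewrite /laplacian big1// => i _; apply: mderiv_homog0.
by have := homog_mderiv i hp; case: m m2 {hp} => [|[]].
Qed.

Definition r2 : mp := \sum_i mvar i ^+ 2.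

Lemma homog_r2 : homog 2 r2.
Proof.
rewrite /r2; elim/big_rec: _ => [|i q _ hq]; first exact: mpoly.dhomog0.
by rewrite mpoly.dhomogD// (mpoly.dhomogMn 2 (homog_mvar i)).
Qed.

Lemma mderiv_mvar i j : D i (mvar j) = (i == j)%:R.
Proof.
rewrite /mvar mpoly.mderivX mpoly.mnm1E eq_sym.
case: eqP => [->|_]; last by rewrite scale0r.
rewrite scale1r [X in mpoly.mpolyX R X](_ : _ = mpoly.mnm0).
  by rewrite mpoly.mpolyX0.
by apply/mpoly.mnmP => k; rewrite mpoly.mnmBE [RHS]mpoly.mnmE subnn.
Qed.

Lemma mderiv_nat i k : D i (k%:R : mp) = 0.
Proof. by rewrite -mpoly.mpolyC_nat mpoly.mderivC. Qed.

Lemma mderiv_r2 i : D i r2 = 2 *: mvar i.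
Proof.
rewrite /r2 (raddf_sum (mpoly.mderiv i)) (bigD1 i)//= big1 ?addr0 => [|j ji].
  by rewrite expr2 mpoly.mderivM mderiv_mvar eqxx mul1r mulr1 scaler_nat mulr2n.
by rewrite expr2 mpoly.mderivM mderiv_mvar eq_sym (negbTE ji) mul0r mulr0 addr0.
Qed.

Lemma laplacian_r2M m p : homog m p ->
  laplacian (r2 * p) = (2 * (n%:R + 2 * m%:R)) *: p + r2 * laplacian p.
Proof.
move=> hp; rewrite laplacianM; congr (_ + _).
have -> : laplacian r2 = (2 * n%:R)%:A.
  rewrite /laplacian (eq_bigr (fun=> 2 *: (1 : mp))); last first.
    by move=> i _; rewrite mderiv_r2 mpoly.mderivZ mderiv_mvar eqxx.
  by rewrite sumr_const card_ord -scaler_nat scalerA mulrC.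
under eq_bigr do rewrite mderiv_r2 -scalerAl.
rewrite -scaler_sumr (euler_homog hp) -scalerAl mul1r !scalerA -scalerDl.
by congr (_ *: _); ring.
Qed.

Lemma laplacian_r2Xn m (b : nat) p : homog m p ->
  laplacian (r2 ^+ b.+1 * p) =
  (2 * b.+1%:R * (n%:R + 2 * m%:R + 2 * b%:R)) *: (r2 ^+ b * p)
  + r2 ^+ b.+1 * laplacian p.
Proof.
move=> hp; elim: b => [|b ih].
  by rewrite expr1 expr0 mul1r (laplacian_r2M hp); congr (_ *: _ + _); ring.
have hj : homog (2 * b.+1 + m)%N (r2 ^+ b.+1 * p).
  by apply: mpoly.dhomogM => //; apply: mpoly.dhomogMn; exact: homog_r2.
have -> : r2 ^+ b.+2 * p = r2 * (r2 ^+ b.+1 * p) by rewrite exprS mulrA.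
have e c q : r2 * (c *: (r2 ^+ b * q)) = c *: (r2 ^+ b.+1 * q).
  by rewrite -scalerAr mulrA -exprS.
have -> : r2 ^+ b.+2 * laplacian p = r2 * (r2 ^+ b.+1 * laplacian p).
  by rewrite mulrA -exprS.
rewrite (laplacian_r2M hj) ih [r2 * (_ + _)]mulrDr e addrA -scalerDl.
by congr (_ *: _ + _); rewrite natrD natrM -!natr1; ring.
Qed.

(* Harmonicity of \sum_b c_b |x|^(2b) laplacian^b p, with c_0 = 1, forces c_b. *)
Fixpoint projection_coef (m b : nat) : R :=
  if b is b'.+1 then
    - projection_coef m b' / (2 * b%:R * (n%:R + 2 * m%:R - 2 * b%:R - 2))
  else 1.

Definition harmonic_projection (m : nat) p : mp :=
  \sum_(b < m./2.+1) projection_coef m b *: (r2 ^+ b * iter b (@laplacian R n) p).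

Lemma homog_iter_laplacian m (b : nat) p :
  homog m p -> homog (m - b.*2)%N (iter b (@laplacian R n) p).
Proof.
move=> hp; elim: b => [|b ih]; first by rewrite subn0.
rewrite iterS doubleS -addn2 subnDA subn2; exact: homog_laplacian.
Qed.

Lemma iter_laplacian_big m p : homog m p -> iter m./2.+1 (@laplacian R n) p = 0.
Proof.
move=> hp; rewrite iterS; apply: (laplacian_small (m := (m - m./2.*2)%N)).
  by rewrite -{1}(odd_double_half m) addnK; case: odd.
exact: homog_iter_laplacian.
Qed.

(** The recurrence of [projection_coef] makes the Laplacian of the sum telescope to its last term,
    which contains an iterated Laplacian too high for the degree m. For the indices b.+1 that occur,
    2 (b + 1) <= m and n >= 2 keep the denominators positive. *)
Lemma laplacian_projection m p : (2 <= n)%N -> homog m p ->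
  laplacian (harmonic_projection m p) = 0.
Proof.
move=> n2 hp; rewrite laplacian_sum.
pose T (b : nat) := projection_coef m b *: (r2 ^+ b * iter b.+1 (@laplacian R n) p).
have lapE (b : nat) : (b.+1 < m./2.+1)%N ->
    laplacian (projection_coef m b.+1 *: (r2 ^+ b.+1 * iter b.+1 (@laplacian R n) p)) =
    T b.+1 - T b.
  move=> bm; have b2 : (b.+1.*2 <= m)%N.
    by lia.
  rewrite laplacianZ (laplacian_r2Xn _ (homog_iter_laplacian _ hp)).
  rewrite scalerDr addrC; congr (_ + _); rewrite scalerA -scaleNr.
  congr (_ *: _); rewrite [projection_coef m b.+1]/=.
  rewrite natrB// -muln2 natrM.
  have n2R : 2 <= n%:R :> R by rewrite ler_nat.
  have bmR : b.+1%:R * 2 <= m%:R :> R by rewrite -natrM ler_nat muln2.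
  have b0 : 0 < b.+1%:R :> R by rewrite ltr0n.
  have bE : b.+1%:R = b%:R + 1 :> R by rewrite natr1.
  have -> : n%:R + 2 * (m%:R - b.+1%:R * 2) + 2 * b%:R =
    n%:R + 2 * m%:R - 2 * b.+1%:R - 2 :> R by rewrite bE; ring.
  rewrite divfK//; apply/lt0r_neq0/mulr_gt0; first by rewrite mulr_gt0.
  lra.
rewrite -(big_mkord xpredT (fun b => laplacian (projection_coef m b *: (r2 ^+ b * iter b (@laplacian R n) p)))).
rewrite big_nat_recl//= big_nat (eq_bigr (fun b => T b.+1 - T b)); last first.
  by move=> b /andP[_ bm]; exact: lapE.
rewrite -big_nat telescope_sumr// expr0 mul1r scale1r /T expr0 mul1r scale1r.
by rewrite addrC subrK iter_laplacian_big// mulr0 scaler0.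
Qed.

Lemma homog_r2M m p : (2 <= m)%N -> homog m.-2 p -> homog m (r2 * p).
Proof.
move=> m2 hp; rewrite (_ : m = (2 + m.-2)%N); last by case: m m2 {hp} => [|[]].
by apply: mpoly.dhomogM => //; exact: homog_r2.
Qed.

(** The clause for m < 2 makes up for the truncation of [m.-2]: a nonzero constant q would give r2 *
    q the degree 2. *)
Lemma projection_decomposition m p : homog m p -> exists q,
  [/\ homog m.-2 q, (m < 2)%N -> q = 0 & harmonic_projection m p = p + r2 * q].
Proof.
move=> hp.
exists (\sum_(b < m./2) projection_coef m b.+1 *: (r2 ^+ b * iter b.+1 (@laplacian R n) p)).
split.
- elim/big_rec: _ => [|b q _ hq]; first exact: mpoly.dhomog0.
  have b2 : (b.+1.*2 <= m)%N.
    by have := ltn_ord b; lia.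
  apply: mpoly.dhomogD => //; apply: mpoly.dhomogZ.
  rewrite (_ : m.-2 = (2 * b + (m - b.+1.*2))%N).
    apply: mpoly.dhomogM; first exact/mpoly.dhomogMn/homog_r2.
    exact: homog_iter_laplacian.
  by lia.
- by case: (m) => [|[|]] //= _; rewrite big_ord0.
- rewrite /harmonic_projection big_ord_recl /= expr0 mul1r scale1r mulr_sumr.
  congr (_ + _); apply: eq_bigr => b _.
  by rewrite -scalerAr mulrA -exprS.
Qed.

Lemma homog_projection m p : homog m p -> homog m (harmonic_projection m p).
Proof.
move=> hp; have [q [hq q0 ->]] := projection_decomposition hp.
apply: mpoly.dhomogD => //; have [m2|m2] := ltnP m 2.
  by rewrite q0// mulr0 mpoly.dhomog0.
exact: homog_r2M.
Qed.

Definition linform (x : 'I_n -> R) : mp := \sum_i x i *: mvar i.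

Lemma homog_linform x : homog 1 (linform x).
Proof.
rewrite /linform; elim/big_rec: _ => [|i q _ hq]; first exact: mpoly.dhomog0.
by rewrite mpoly.dhomogD// mpoly.dhomogZ// homog_mvar.
Qed.

Lemma mderiv_linform x i : D i (linform x) = (x i)%:A.
Proof.
rewrite /linform (raddf_sum (mpoly.mderiv i)) (bigD1 i)//= big1 ?addr0 => [|j ji].
  by rewrite mpoly.mderivZ mderiv_mvar eqxx.
by rewrite mpoly.mderivZ mderiv_mvar eq_sym (negbTE ji) scaler0.
Qed.

Lemma mderiv_linformX x i (a : nat) :
  D i (linform x ^+ a) = (a%:R * x i) *: linform x ^+ a.-1.
Proof.
elim: a => [|a ih]; first by rewrite mul0r scale0r expr0 -[1]/(1%:R) mderiv_nat.
rewrite exprS mpoly.mderivM mderiv_linform ih -scalerAl mul1r -scalerAr.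
case: a {ih} => [|a]; first by rewrite !mul0r scale0r addr0 mul1r.
by rewrite -exprS -scalerDl -[in RHS]natr1; congr (_ *: _); ring.
Qed.

Lemma laplacian_linformX x (a : nat) : \sum_i x i ^+ 2 = 1 ->
  laplacian (linform x ^+ a) = (a%:R * a.-1%:R) *: linform x ^+ a.-2.
Proof.
move=> x1; rewrite /laplacian.
rewrite (eq_bigr (fun i => ((a%:R * a.-1%:R) * x i ^+ 2) *: linform x ^+ a.-2)).
  by rewrite -scaler_suml -mulr_sumr x1 mulr1.
move=> i _; rewrite mderiv_linformX mpoly.mderivZ mderiv_linformX scalerA.
by congr (_ *: _); ring.
Qed.

Lemma iter_laplacian_linformX x (a b : nat) : \sum_i x i ^+ 2 = 1 ->
  iter b (@laplacian R n) (linform x ^+ a) = (a ^_ b.*2)%:R *: linform x ^+ (a - b.*2).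
Proof.
move=> x1; elim: b => [|b ih]; first by rewrite ffactn0 scale1r subn0.
rewrite iterS ih laplacianZ laplacian_linformX// scalerA doubleS !ffactnSr.
have -> : (a - b.*2).-2 = (a - b.*2.+2)%N by lia.
have -> : (a - b.*2).-1 = (a - b.*2.+1)%N by lia.
by rewrite -!natrM mulnA.
Qed.

End polynomials.

(** * Green's formula and Funk-Hecke for powers on the sphere *)

Section sphere_integrals.
Context {R : realType} {n : nat}.
Local Notation point n := (n.-tuple (measurableTypeR R)).
Local Notation mp := (mpoly.mpoly n R).
Local Notation D := mpoly.mderiv.
Local Notation homog m p := (p \is mpoly.ishomog1 m mpoly.mdeg).
Local Notation lam := (@lebesgue_power R n).
Local Notation sigma := (@surface_measure R n).
Implicit Types (p q : mp) (x : point n).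

Definition mev p x : R := mpoly.meval (fun i => tnth x i) p.

Lemma mevD p q x : mev (p + q) x = mev p x + mev q x.
Proof. exact: mpoly.mevalD. Qed.

Lemma mevZ c p x : mev (c *: p) x = c * mev p x.
Proof. exact: mpoly.mevalZ. Qed.

Lemma mevM p q x : mev (p * q) x = mev p x * mev q x.
Proof. exact: mpoly.mevalM. Qed.

Lemma mevXn p k x : mev (p ^+ k) x = mev p x ^+ k.
Proof. by rewrite /mev rmorphXn. Qed.

Lemma mev0 x : mev 0 x = 0.
Proof. exact: mpoly.meval0. Qed.

Lemma mev_sum I (r : seq I) (F : I -> mp) x :
  mev (\sum_(i <- r) F i) x = \sum_(i <- r) mev (F i) x.
Proof. by rewrite /mev raddf_sum. Qed.

Lemma mev_mpolyX a x : mev (mpoly.mpolyX R a) x = \prod_(i < n) tnth x i ^+ a i.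
Proof. exact: mpoly.mevalX. Qed.

Lemma mev_mvar i x : mev (mvar i) x = tnth x i.
Proof. exact: mpoly.mevalXU. Qed.

Lemma mev_r2 x : mev r2 x = dotp x x.
Proof.
by rewrite /r2 mev_sum; apply: eq_bigr => i _; rewrite mevXn mev_mvar expr2.
Qed.

Lemma mev_linform x y : mev (linform (fun i => tnth x i)) y = dotp x y.
Proof.
by rewrite /linform mev_sum; apply: eq_bigr => i _; rewrite mevZ mev_mvar.
Qed.

Lemma measurable_mev p : measurable_fun setT (mev p).
Proof.
move: p; apply: mpoly_span => [|c p q hp hq|a].
- by rewrite (_ : mev 0 = cst 0)//; apply/funext => x; rewrite mev0.
- rewrite (_ : mev _ = fun x => c * mev p x + mev q x).
    by apply: measurable_funD => //; apply: measurable_funM.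
  by apply/funext => x; rewrite mevD mevZ.
- rewrite (_ : mev _ = fun x => \prod_(i < n) tnth x i ^+ a i).
    by apply: measurable_prod => i _; apply: measurable_funX; exact: measurable_tnthR.
  by apply/funext => x; rewrite mev_mpolyX.
Qed.

Lemma sphere_tnth_le1 x i : sphere n x -> `|tnth x i| <= 1.
Proof. by move=> <-; exact: normr_tnth_le_enorm. Qed.

Lemma mev_bounded p : exists M : R, forall x, sphere n x -> `|mev p x| <= M.
Proof.
move: p; apply: mpoly_span => [|c p q [M hM] [M' hM']|a].
- by exists 0 => x _; rewrite mev0 normr0.
- exists (`|c| * M + M') => x xS; rewrite mevD mevZ.
  by rewrite (le_trans (ler_normD _ _))// normrM lerD ?ler_wpM2l ?hM ?hM'.
- exists 1 => x xS; rewrite mev_mpolyX normr_prod; apply: prodr_ile1 => i _.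
  by rewrite normr_ge0 normrX exprn_ile1 ?sphere_tnth_le1.
Qed.

Lemma surface_measure_fin (A : set (point n)) : measurable A -> (sigma A < +oo)%E.
Proof. by move=> mA; rewrite -ge0_fin_numE// fin_num_measure. Qed.

Lemma sphere_bounded_integrable (f : point n -> R) M :
  measurable_fun (@sphere R n) f -> (forall x, sphere n x -> `|f x| <= M) ->
  sigma.-integrable (sphere n) (EFin \o f).
Proof.
move=> mf fM; apply: bounded_integrableR fM => //; first exact: measurable_sphere.
by apply: surface_measure_fin; exact: measurable_sphere.
Qed.

Lemma sphere_integrable p : sigma.-integrable (sphere n) (EFin \o mev p).
Proof.
have [M pM] := mev_bounded p; apply: sphere_bounded_integrable pM.
by apply: measurable_funTS; exact: measurable_mev.
Qed.

Definition sphere_integral p : R := \int[sigma]_(x in sphere n) mev p x.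
Local Notation L := sphere_integral.

Lemma sphere_integralD p q : L (p + q) = L p + L q.
Proof.
rewrite /L; under eq_Rintegral do rewrite mevD.
by rewrite RintegralD//; [exact: measurable_sphere|exact: sphere_integrable..].
Qed.

Lemma sphere_integralZ c p : L (c *: p) = c * L p.
Proof.
rewrite /L; under eq_Rintegral do rewrite mevZ.
by rewrite RintegralZl//; [exact: measurable_sphere|exact: sphere_integrable].
Qed.

Lemma sphere_integral0 : L 0 = 0.
Proof. by rewrite -(scale0r (0 : mp)) sphere_integralZ mul0r. Qed.

Lemma sphere_integral_sum I (r : seq I) (F : I -> mp) :
  L (\sum_(k <- r) F k) = \sum_(k <- r) L (F k).
Proof. exact: (big_morph _ sphere_integralD sphere_integral0). Qed.

Lemma eq_sphere_integral p q : (forall x, sphere n x -> mev p x = mev q x) -> L p = L q.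
Proof. by move=> pq; apply: eq_Rintegral => x /set_mem; exact: pq. Qed.

Definition gauss_integral p : R := \int[lam]_x (mev p x * gauss_fun (enorm x)).
Local Notation G := gauss_integral.

Lemma gauss_mpolyX a :
  lam.-integrable setT (EFin \o (fun x => mev (mpoly.mpolyX R a) x * gauss_fun (enorm x))) /\
  G (mpoly.mpolyX R a) = \prod_(i < n) gauss_moment (a i).
Proof.
have E : (fun x => mev (mpoly.mpolyX R a) x * gauss_fun (enorm x)) =
    (fun x => \prod_(i < n) (tnth x i ^+ a i * gauss_fun (tnth x i))).
  by apply/funext => x; rewrite mev_mpolyX gauss_fun_enorm big_split.
have [h1 h2] := @power_measure_prod _ _ _ (@lebesgue_measure R) n
  (fun i (t : R) => t ^+ a i * gauss_fun t) (fun i => integrable_gauss_moment (a i)).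
rewrite /G E; split=> //; rewrite /Rintegral [X in fine X = _]h2.
rewrite -[RHS]/(fine _%:E) -prodEFin; congr fine; apply: eq_bigr => i _.
rewrite /gauss_moment /Rintegral fineK//.
exact: (integrable_fin_num _ (integrable_gauss_moment _)).
Qed.

Lemma gauss_integrable p :
  lam.-integrable setT (EFin \o (fun x => mev p x * gauss_fun (enorm x))).
Proof.
move: p; apply: mpoly_span => [|c p q hp hq|a].
- rewrite (_ : _ \o _ = cst 0%E); first exact: integrable0.
  by apply/funext => x /=; rewrite mev0 mul0r.
- have h := integrableRD measurableT (integrableRZ c measurableT hp) hq.
  rewrite (_ : (fun x => mev (c *: p + q) x * gauss_fun (enorm x)) = (fun x =>
    c * (mev p x * gauss_fun (enorm x)) + mev q x * gauss_fun (enorm x)))//.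
  by apply/funext => x; rewrite mevD mevZ; ring.
- by have [] := gauss_mpolyX a.
Qed.

Lemma gauss_integralD p q : G (p + q) = G p + G q.
Proof.
rewrite /G; under eq_Rintegral do rewrite mevD mulrDl.
by rewrite RintegralD//; exact: gauss_integrable.
Qed.

Lemma gauss_integralZ c p : G (c *: p) = c * G p.
Proof.
rewrite /G; under eq_Rintegral do rewrite mevZ -mulrA.
by rewrite RintegralZl//; exact: gauss_integrable.
Qed.

Lemma gauss_integral0 : G 0 = 0.
Proof. by rewrite -(scale0r (0 : mp)) gauss_integralZ mul0r. Qed.

Lemma gauss_integral_sum I (r : seq I) (F : I -> mp) :
  G (\sum_(k <- r) F k) = \sum_(k <- r) G (F k).
Proof. exact: (big_morph _ gauss_integralD gauss_integral0). Qed.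

(** On a monomial the integral factors over the coordinates, and only the i-th factor changes, by
    [gauss_moment_rec]. *)
Lemma gauss_integral_mderiv i p : G (D i p) = 2 * G (mvar i * p).
Proof.
move: p; apply: mpoly_span => [|c p q hp hq|a].
- by rewrite mpoly.mderiv0 mulr0 gauss_integral0 mulr0.
- rewrite mpoly.mderivD mpoly.mderivZ mulrDr -scalerAr !gauss_integralD.
  by rewrite !gauss_integralZ hp hq; ring.
- rewrite mpoly.mderivX gauss_integralZ mvar_mpolyX.
  rewrite (gauss_mpolyX _).2 (gauss_mpolyX _).2.
  rewrite (bigD1 i)//= [in RHS](bigD1 i)//= !mulrA.
  rewrite mpoly.mnmBE mpoly.mnmDE mpoly.mnm1E eqxx add1n subn1 gauss_moment_rec.
  congr (_ * _); apply: eq_bigr => j ji.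
  by rewrite mpoly.mnmBE mpoly.mnmDE mpoly.mnm1E eq_sym (negbTE ji) subn0 add0n.
Qed.

(** Sum [gauss_integral_mderiv] over the polynomials x_i p and use Euler's identity. This compares
    degrees m and m + 2 with an explicit factor, without the radial constants. *)
Lemma gauss_integral_r2 m p : homog m p -> 2 * G (r2 * p) = (n + m)%:R * G p.
Proof.
move=> hp; rewrite /r2 mulr_suml gauss_integral_sum mulr_sumr.
rewrite (eq_bigr (fun i => G p + G (mvar i * D i p))); last first.
  move=> i _; rewrite expr2 -mulrA -gauss_integral_mderiv mpoly.mderivM.
  by rewrite mderiv_mvar eqxx mul1r gauss_integralD.
rewrite big_split/= sumr_const card_ord -gauss_integral_sum (euler_homog hp).
by rewrite gauss_integralZ natrD mulrDl -[G p *+ n]mulr_natl.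
Qed.

Lemma mev_homog m p x : homog m p -> enorm x != 0 ->
  mev p x = enorm x ^+ m * mev p (normalize x).
Proof.
move=> hp x0; move: p hp; apply: homog_span.
- by rewrite !mev0 mulr0.
- by move=> c p q hp hq; rewrite !mevD !mevZ hp hq; ring.
- move=> a <-; rewrite !mev_mpolyX mpoly.mdegE -prodrXr -big_split/=.
  by apply: eq_bigr => i _; rewrite -exprMn tnth_mktuple mulrC divfK.
Qed.

Hypothesis n2 : (2 <= n)%N.

Let n0 : (0 < n)%N. Proof. exact: ltnW. Qed.

Lemma gauss_sphere m : exists2 c : R, 0 < c &
  forall p, homog m p -> G p = c * L p.
Proof.
have [c c0 cE] := polar_homogeneous n0 m (R := R).
exists c => // p hp; have [M pM] := mev_bounded p.
by have [_ h] := cE (mev p) M (measurable_mev p) pM (fun x => mev_homog hp).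
Qed.

Lemma sphere_integral_r2 q : L (r2 * q) = L q.
Proof.
apply: eq_sphere_integral => x xS.
by rewrite mevM mev_r2 -enorm_sqr xS expr1n mul1r.
Qed.

(** D_i p and x_i p have degrees m - 1 and m + 1, hence different constants in [gauss_sphere].
    Multiplying D_i p by |x|^2 keeps its sphere integral and equalizes the degrees, so the constant
    cancels. *)
Lemma sphere_integral_mderiv m i p : homog m p ->
  L (D i p) = (m + n).-1%:R * L (mvar i * p).
Proof.
move=> hp; have [c c0 cE] := gauss_sphere m.+1.
apply: (mulfI (lt0r_neq0 c0)); rewrite [RHS]mulrCA -(cE (mvar i * p)); last first.
  by rewrite -add1n mpoly.dhomogM// homog_mvar.
have h := gauss_integral_mderiv i p.
have [m0|m0] := posnP m.
  rewrite m0 in hp; move: h; rewrite mderiv_homog0//.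
  rewrite gauss_integral0 sphere_integral0 mulr0 => /esym/eqP.
  by rewrite mulf_eq0 pnatr_eq0/= => /eqP ->; rewrite mulr0.
have hr : homog m.+1 (r2 * D i p) by apply: homog_r2M => //; exact: homog_mderiv.
rewrite -sphere_integral_r2 -(cE (r2 * D i p))//.
have := gauss_integral_r2 (homog_mderiv i hp); rewrite h.
have -> : (n + m.-1 = (m + n).-1)%N by lia.
by rewrite mulrCA => /(mulfI _) ->//; rewrite pnatr_eq0.
Qed.

Lemma sphere_green m p : homog m p -> L (laplacian p) = (m * (m + n - 2))%:R * L p.
Proof.
move=> hp; have [m0|m0] := posnP m.
  by rewrite (laplacian_small _ hp) ?m0// sphere_integral0 mul0r.
rewrite /laplacian sphere_integral_sum.
rewrite (eq_bigr (fun i => (m + n - 2)%:R * L (mvar i * D i p))).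
  by rewrite -mulr_sumr -sphere_integral_sum (euler_homog hp) sphere_integralZ natrM; ring.
move=> i _; rewrite (sphere_integral_mderiv _ (homog_mderiv i hp)).
by congr (_%:R * _); lia.
Qed.

(** Apply [sphere_integral_mderiv] to p D_i q and sum with Euler's identity. The left side is
    symmetric in p and q while the factor l on the right is not: exchanging the roles yields
    orthogonality for k != l. *)
Lemma sphere_harmonic_dirichlet k l p q : homog k p -> homog l q ->
  laplacian q = 0 ->
  \sum_i L (D i p * D i q) = ((k + l + n - 2) * l)%:R * L (p * q).
Proof.
move=> hp hq q0.
have [l0|l0] := posnP l.
  rewrite l0 in hq *; rewrite muln0 mul0r big1// => i _.
  by rewrite (mderiv_homog0 i hq) mulr0 sphere_integral0.
have hi i : homog (k + l.-1)%N (p * D i q) by apply: mpoly.dhomogM => //; exact: homog_mderiv.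
rewrite (eq_bigr (fun i => L (D i (p * D i q)) - L (p * D i (D i q)))); last first.
  move=> i _; rewrite mpoly.mderivM sphere_integralD; ring.
rewrite sumrB -[X in _ - X]sphere_integral_sum -mulr_sumr -/(laplacian q) q0.
rewrite mulr0 sphere_integral0 subr0.
rewrite (eq_bigr (fun i => (k + l + n - 2)%:R * L (p * (mvar i * D i q)))).
  rewrite -mulr_sumr -sphere_integral_sum -mulr_sumr (euler_homog hq).
  by rewrite -scalerAr sphere_integralZ natrM mulrA.
move=> i _; rewrite (sphere_integral_mderiv _ (hi i)) mulrCA.
by congr (_%:R * _); lia.
Qed.

Lemma sphere_harmonic_orthogonal k l p q : k != l -> homog k p -> homog l q ->
  laplacian p = 0 -> laplacian q = 0 -> L (p * q) = 0.
Proof.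
move=> kl hp hq p0 q0.
have h1 := sphere_harmonic_dirichlet hp hq q0.
have h2 := sphere_harmonic_dirichlet hq hp p0.
have hE : \sum_i L (D i p * D i q) = \sum_i L (D i q * D i p).
  by apply: eq_bigr => i _; rewrite mulrC.
rewrite hE h2 mulrC (addnC l k) in h1.
move/eqP: h1; rewrite [q * p]mulrC mulrC -subr_eq0 -mulrBl mulf_eq0 !natrM -mulrBr mulf_eq0.
have -> : ((k + l + n - 2)%:R == 0 :> R) = false by rewrite pnatr_eq0; lia.
by rewrite subr_eq0 eqr_nat (negbTE kl) /= => /eqP.
Qed.

(** Green's formula for <x, .>^a p leaves two terms: <x, .>^(a-2) p, and <x, .>^(a-1) times the
    derivative of p in the direction x. Both fall under the induction hypothesis, the second in
    degree k - 1 with value k p(x) at x. *)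
Lemma funk_hecke_power : exists mu : nat -> nat -> R,
  forall a k x p, sphere n x -> homog k p -> laplacian p = 0 ->
  L (linform (fun i => tnth x i) ^+ a * p) = mu a k * mev p x.
Proof.
suff h a : exists f : nat -> R, forall k x p, sphere n x -> homog k p ->
    laplacian p = 0 ->
    L (linform (fun i => tnth x i) ^+ a * p) = f k * mev p x.
  have /choice[mu muE] := h; exists mu => a k x p; exact: muE.
(* The recurrence reaches back two steps in a, so a and a + 1 are carried together. *)
suff [] : (exists f : nat -> R, forall k x p, sphere n x -> homog k p ->
    laplacian p = 0 ->
    L (linform (fun i => tnth x i) ^+ a * p) = f k * mev p x) /\
  (exists f : nat -> R, forall k x p, sphere n x -> homog k p ->
    laplacian p = 0 ->
    L (linform (fun i => tnth x i) ^+ a.+1 * p) = f k * mev p x) by [].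
have rec b k x p : sphere n x -> homog k p -> laplacian p = 0 ->
    ((b + k) * (b + k + n - 2))%:R * L (linform (fun i => tnth x i) ^+ b * p) =
    (b * b.-1)%:R * L (linform (fun i => tnth x i) ^+ b.-2 * p) +
    2 * b%:R * L (linform (fun i => tnth x i) ^+ b.-1 *
                  \sum_i tnth x i *: D i p).
  move=> xS hp p0.
  have x1 : \sum_i tnth x i ^+ 2 = 1.
    have := enorm_sqr x; rewrite xS expr1n => ->.
    by apply: eq_bigr => i _; rewrite expr2.
  have hb : homog (b + k)%N (linform (fun i => tnth x i) ^+ b * p).
    apply: mpoly.dhomogM => //.
    by rewrite -[X in homog X _]mul1n mpoly.dhomogMn// homog_linform.
  rewrite -(sphere_green hb) laplacianM p0 mulr0 addr0 laplacian_linformX//.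
  rewrite sphere_integralD -scalerAl sphere_integralZ natrM; congr (_ + _).
  rewrite sphere_integralZ -mulrA; congr (_ * _).
  rewrite (eq_bigr (fun i => b%:R *: (linform (fun i => tnth x i) ^+ b.-1 *
    (tnth x i *: D i p)))); last first.
    by move=> i _; rewrite mderiv_linformX -scalerAl -scalerAr scalerA.
  by rewrite -scaler_sumr sphere_integralZ -mulr_sumr.
have dirE k x p : homog k p -> mev (\sum_i tnth x i *: D i p) x = k%:R * mev p x.
  move=> hp; rewrite -mevZ -(euler_homog hp) !mev_sum; apply: eq_bigr => i _.
  by rewrite mevZ mevM mev_mvar.
have dirH k x p : homog k p -> laplacian p = 0 ->
    homog k.-1 (\sum_i tnth x i *: D i p) /\ laplacian (\sum_i tnth x i *: D i p) = 0.
  move=> hp p0; split.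
    elim/big_rec: _ => [|i q _ hq]; first exact: mpoly.dhomog0.
    by apply: mpoly.dhomogD => //; apply: mpoly.dhomogZ; exact: homog_mderiv.
  rewrite laplacian_sum big1// => i _.
  by rewrite laplacianZ laplacian_mderiv p0 mpoly.mderiv0 scaler0.
elim: a => [|a [[f0 h0] [f1 h1]]].
  (* For a = 0, Green's formula kills the integral of a harmonic of positive degree, and in degree 0
     the polynomial p is constant. *)
  have h0 : forall k x p, sphere n x -> homog k p -> laplacian p = 0 ->
      L (linform (fun i => tnth x i) ^+ 0 * p) =
      (if k == 0%N then L 1 else 0) * mev p x.
    move=> k x p xS hp p0; rewrite expr0 mul1r.
    have [k0|k0] := eqVneq k 0%N.
      rewrite k0 in hp; move: p hp {p0}; apply: homog_span.
      - by rewrite sphere_integral0 mev0 mulr0.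
      - move=> c p q hp hq; rewrite sphere_integralD sphere_integralZ hp hq.
        by rewrite mevD mevZ; ring.
      - move=> b /eqP; rewrite mpoly.mdeg_eq0 => /eqP ->.
        by rewrite mpoly.mpolyX0 /mev mpoly.meval1 mulr1.
    have := sphere_green hp; rewrite p0 sphere_integral0 mul0r => /esym/eqP.
    rewrite mulf_eq0 pnatr_eq0 muln_eq0 => /orP[|/eqP //]; lia.
  split; first by exists (fun k => if k == 0%N then L 1 else 0).
  exists (fun k => 2 * (if k.-1 == 0%N then L 1 else 0) * k%:R / ((1 + k) * (1 + k + n - 2))%:R).
  move=> k x p xS hp p0.
  have [hd hd0] := dirH k x p hp p0.
  have := rec 1%N k x p xS hp p0.
  rewrite muln0 mul0r add0r /= (h0 _ _ _ xS hd hd0) (dirE _ _ _ hp).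
  have nz : ((1 + k) * (1 + k + n - 2))%:R != 0 :> R by rewrite pnatr_eq0 muln_eq0; lia.
  by move: (_%:R) nz => d nz /(canRL (mulKf nz)) ->; ring.
split; first by exists f1.
exists (fun k => ((a.+2 * a.+1)%:R * f0 k + 2 * a.+2%:R * k%:R * f1 k.-1) /
  ((a.+2 + k) * (a.+2 + k + n - 2))%:R).
move=> k x p xS hp p0.
have [hd hd0] := dirH k x p hp p0.
have := rec a.+2 k x p xS hp p0.
rewrite (h0 _ _ _ xS hp p0) /= (h1 _ _ _ xS hd hd0) (dirE _ _ _ hp).
have nz : ((a.+2 + k) * (a.+2 + k + n - 2))%:R != 0 :> R by rewrite pnatr_eq0 muln_eq0; lia.
by move: (_%:R) nz => d nz /(canRL (mulKf nz)) ->; ring.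
Qed.

End sphere_integrals.

Lemma poly_basis_span (R : realType) (P : nat -> {poly R}) k (f : {poly R}) :
  (forall j, size (P j) = j.+1) -> (size f <= k)%N ->
  exists c : nat -> R, f = \sum_(j < k) c j *: P j.
Proof.
move=> sP; elim: k f => [|k ih] f.
  by rewrite leqn0 size_poly_eq0 => /eqP ->; exists (fun=> 0); rewrite big_ord0.
move=> sf; have Pk : (P k)`_k != 0.
  by rewrite -[k in _`_k]/(k.+1.-1) -sP -lead_coefE lead_coef_eq0 -size_poly_gt0 sP.
pose a := f`_k / (P k)`_k.
have sg : (size (f - a *: P k)%R <= k)%N.
  apply/leq_sizeP => j; rewrite leq_eqVlt => /predU1P[<-|kj].
    by rewrite coefB coefZ divfK// subrr.
  rewrite coefB coefZ (nth_default _ (leq_trans sf kj)) nth_default ?sP//.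
  by rewrite mulr0 subr0.
have [c cE] := ih _ sg; exists (fun j => if j == k then a else c j).
rewrite big_ord_recr /= eqxx -[LHS](subrK (a *: P k)) cE; congr (_ + _).
by apply: eq_bigr => j _; rewrite (ltn_eqF (ltn_ord j)).
Qed.

(** * Polynomials integrated against the Gegenbauer weight *)

Section weight_integral.
Context {R : realType} {n : nat}.
Hypothesis n2 : (2 <= n)%N.
Local Notation mu := (@lebesgue_measure R).
Local Notation w := (@gegenbauer_weight R n).
Implicit Types f g : {poly R}.

Definition weight_integral f : R := \int[mu]_(t in `[-1, 1]) (f.[t] * w t).
Local Notation M := weight_integral.

Lemma weight_integralD f g : M (f + g) = M f + M g.
Proof.
rewrite /M; under eq_Rintegral do rewrite hornerD mulrDl.
by rewrite RintegralD//; exact: integrable_poly_weight.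
Qed.

Lemma weight_integralZ c f : M (c *: f) = c * M f.
Proof.
rewrite /M; under eq_Rintegral do rewrite hornerZ -mulrA.
by rewrite RintegralZl//; exact: integrable_poly_weight.
Qed.

Lemma weight_integral0 : M 0 = 0.
Proof. by rewrite -(scale0r (0 : {poly R})) weight_integralZ mul0r. Qed.

Lemma weight_integral_sum I (r : seq I) (F : I -> {poly R}) :
  M (\sum_(k <- r) F k) = \sum_(k <- r) M (F k).
Proof. exact: (big_morph _ weight_integralD weight_integral0). Qed.

Lemma weight_integralXn a : M 'X^a = weight_moment n a.
Proof. by apply: eq_Rintegral => t _; rewrite hornerXn. Qed.

Lemma finite_roots f : f != 0 -> finite_set [set t | root f t].
Proof.
move=> f0; apply: contrapT => /(infinite_set_fset (size f))[B Bf].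
rewrite leqNgt => /negP; apply.
apply: max_poly_roots => //; last exact: finmap.fset_uniq.
by apply/allP => x xB; exact: Bf.
Qed.

(** A vanishing integral makes f^2 w zero almost everywhere. As w > 0 on ]-1, 1[, this interval
    would be covered by a null set and the finitely many roots of f. *)
Lemma weight_integral_definite f : M (f * f) = 0 -> f = 0.
Proof.
move=> Mf; apply/eqP/negPn/negP => f0.
have fi := integrable_poly_weight n2 (f * f).
have Ff t : 0 <= (f * f).[t] * w t.
  by rewrite mulr_ge0 ?gegenbauer_weight_ge0// hornerM -expr2 sqr_ge0.
have : (\int[mu]_(t in `[(-1)%R, 1%R]) `|((f * f).[t] * w t)%:E| = 0)%E.
  rewrite -[RHS]/(0%R%:E) -Mf /M /Rintegral fineK; last exact: (integrable_fin_num _ fi).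
  by apply: eq_integral => t _; rewrite gee0_abs// lee_fin.
have mF := measurable_int _ fi.
move=> h; have [N [mN N0 subN]] := (ae_eq_integral_abs mu (measurable_itv _) mF).1 h.
have : (mu `](-1)%R, 1%R[ <= mu (N `|` [set t | root f t]))%E.
  apply: le_measure; rewrite ?inE//.
    apply: measurableU => //; apply: countable_measurable => //.
    exact/finite_set_countable/finite_roots.
  move=> t /=; rewrite in_itv/= => t1.
  have [ft|ft] := boolP (root f t); first by right.
  left; apply: subN => /=; rewrite in_itv/= => ht.
  have {ht} : ((f * f).[t] * w t)%:E = 0%E.
    by apply: ht; case/andP: t1 => /ltW -> /ltW ->.
  move/eqP; rewrite eqe mulf_eq0 hornerM mulf_eq0 orbb -rootE (negbTE ft)/=.
  by rewrite gt_eqF// powR_gt0// onemsqr_gt0.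
rewrite lebesgue_measure_itv/= lte_fin ifT; last by lra.
rewrite leNgt => /negP; apply.
have -> : mu (N `|` [set t | root f t]) = 0%E.
  apply: null_set_setU => //.
  - apply: countable_measurable => //; exact/finite_set_countable/finite_roots.
  - apply: countable_lebesgue_measure0; exact/finite_set_countable/finite_roots.
by rewrite -EFinD lte_fin; lra.
Qed.

End weight_integral.

(** * Zonal harmonics and the Funk-Hecke formula *)

Section zonal.
Context {R : realType} {n : nat}.
Hypothesis n2 : (2 <= n)%N.
Local Notation point n := (n.-tuple (measurableTypeR R)).
Local Notation mp := (mpoly.mpoly n R).
Local Notation homog m p := (p \is mpoly.ishomog1 m mpoly.mdeg).
Local Notation L := (@sphere_integral R n).
Local Notation M := (@weight_integral R n).
Implicit Types (f g : {poly R}) (x z : point n).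

(** The monic Gegenbauer polynomial; its falling factorials come from the iterated Laplacians of <x,
    .>^k for a unit vector x. *)
Definition zonal (k : nat) : {poly R} :=
  \sum_(b < k./2.+1) (@projection_coef R n k b * (k ^_ b.*2)%:R) *: 'X^(k - b.*2).

Lemma sphere_sum_sqr x : sphere n x -> \sum_i tnth x i ^+ 2 = 1.
Proof.
move=> xS; have := enorm_sqr x; rewrite xS expr1n => ->.
by apply: eq_bigr => i _; rewrite expr2.
Qed.

Lemma zonalE k x z : sphere n x -> sphere n z ->
  mev (harmonic_projection k (linform (fun i => tnth x i) ^+ k)) z =
  (zonal k).[dotp x z].
Proof.
move=> xS zS; rewrite /harmonic_projection mev_sum /zonal horner_sum.
apply: eq_bigr => b _; rewrite iter_laplacian_linformX ?sphere_sum_sqr//.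
rewrite mevZ mevM mevXn mev_r2 -enorm_sqr zS !expr1n mul1r mevZ mevXn mev_linform.
by rewrite hornerZ hornerXn mulrA.
Qed.

Lemma zonal_monic k : size (zonal k) = k.+1 /\ (zonal k)`_k = 1.
Proof.
have sz : (size (zonal k) <= k.+1)%N.
  apply: (leq_trans (size_sum _ _ _)); apply/bigmax_leqP => b _.
  by rewrite (leq_trans (size_scale_leq _ _))// size_polyXn ltnS leq_subr.
have ck : (zonal k)`_k = 1.
  rewrite /zonal big_ord_recl coefD coef_sum big1 ?addr0 => [|b _].
    by rewrite coefZ coefXn subn0 eqxx ffactn0 /= !mulr1.
  rewrite coefZ coefXn; case: eqP => [e|_]; last by rewrite mulr0.
  move: e; rewrite lift0 => e; exfalso.
  by have : (b.+1.*2 <= k)%N; have := ltn_ord b; lia.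
split=> //; apply/eqP; rewrite eqn_leq sz /= ltnNge; apply/negP => h.
by have := oner_neq0 R; rewrite -ck nth_default ?eqxx.
Qed.

Definition sphere_point : point n :=
  [tuple (if i == 0%N :> nat then 1 else 0 : R) | i < n].

Lemma sphere_point_sphere : sphere n sphere_point.
Proof.
have n0 : (0 < n)%N by exact: ltnW.
rewrite /sphere /= /enorm /dotp (bigD1 (Ordinal n0))//= big1 => [|i i0].
  by rewrite !tnth_mktuple eqxx mulr1 addr0 sqrtr1.
rewrite !tnth_mktuple ifF ?mulr0//.
by apply/negP => h; move: i0; rewrite -val_eqE /= h.
Qed.

(** The total area of the sphere over the mass of w, classically the area of S^(n-2). *)
Definition dim_ratio : R := L 1 / M 1.

Lemma weight_integral1_gt0 : 0 < M 1.
Proof.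
have -> : (1 : {poly R}) = 'X^0 by rewrite expr0.
by rewrite weight_integralXn; exact: weight_moment0_gt0.
Qed.

Lemma sphere_integral1_gt0 : 0 < L 1.
Proof.
have n0 : (0 < n)%N by exact: ltnW.
have -> : L 1 = fine (surface_measure n (sphere n)).
  rewrite /sphere_integral; under eq_Rintegral do rewrite /mev mpoly.meval1.
  by rewrite Rintegral_cst ?mul1r//; exact: measurable_sphere.
have mS := @measurable_sphere R n.
rewrite fine_gt0// surface_measure_fin// andbT.
(* Every nonzero vector normalizes into the sphere, so the cone over the sphere is the whole
   punctured ball. *)
have -> : surface_measure n (sphere n) = (n%:R%:E * cone_measure [set: point n])%E.
  rewrite -[LHS]/(n%:R%:E * cone_measure (@sphere R n))%E; congr (_ * _)%E.
  rewrite /cone_measure preimage_setT setTI; congr (lebesgue_power n _).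
  apply/seteqP; split=> [x []//|x xB]; split=> //.
  by apply: enorm_normalize; move: xB => /andP[+ _]; exact: lt0r_neq0.
by rewrite mule_gt0 ?cone_measureT_gt0// lte_fin ltr0n.
Qed.

(** Green's formula and [weight_moment_rec] give both sides the same two-step recurrence. They agree
    at a = 0 by the choice of [dim_ratio], and both vanish at a = 1. *)
Lemma sphere_integral_linformX a x : sphere n x ->
  L (linform (fun i => tnth x i) ^+ a) = dim_ratio * M 'X^a.
Proof.
move=> xS; have homX b : homog b (linform (fun i => tnth x i) ^+ b).
  by rewrite -[X in homog X _]mul1n mpoly.dhomogMn// homog_linform.
have rec b : (b * (b + n - 2))%:R * L (linform (fun i => tnth x i) ^+ b) =
    (b%:R * b.-1%:R) * L (linform (fun i => tnth x i) ^+ b.-2).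
  rewrite -(sphere_green n2 (homX b)) laplacian_linformX ?sphere_sum_sqr//.
  by rewrite sphere_integralZ.
have wrec b : (b * (b + n - 2))%:R * M 'X^b = (b%:R * b.-1%:R) * M 'X^(b.-2).
  rewrite !weight_integralXn; case: b => [|[|b]]; first by rewrite !mul0r.
    have := @weight_moment_rec R n n2 0; rewrite mulr0n mul0r => /esym/eqP.
    by rewrite mulf_eq0 pnatr_eq0 add0n gtn_eqF 1?ltnW//= => /eqP ->; rewrite !mulr0 mul0r.
  have := weight_moment_rec n2 b.+1 => /= e.
  rewrite natrM -mulrA (_ : b.+2 + n - 2 = b + n)%N; last by lia.
  by rewrite -e mulrA.
have nz b : (0 < b)%N -> (b * (b + n - 2))%:R != 0 :> R.
  by move=> b0; rewrite pnatr_eq0 muln_eq0; lia.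
suff [] : L (linform (fun i => tnth x i) ^+ a) = dim_ratio * M 'X^a /\
  L (linform (fun i => tnth x i) ^+ a.+1) = dim_ratio * M 'X^(a.+1) by [].
elim: a => [|a [ih0 ih1]].
  split; first by rewrite !expr0 divfK// gt_eqF// weight_integral1_gt0.
  apply: (mulfI (nz 1%N isT)); rewrite rec mulrCA wrec /= !mulr0 !mul0r mulr0 //.
split=> //; apply: (mulfI (nz a.+2 isT)); rewrite rec mulrCA wrec /= ih0; ring.
Qed.

Definition dot_poly x f : mp := \sum_(i < size f) f`_i *: linform (fun j => tnth x j) ^+ i.

Lemma mev_dot_poly x f z : mev (dot_poly x f) z = f.[dotp x z].
Proof.
rewrite /dot_poly mev_sum horner_coef; apply: eq_bigr => i _.
by rewrite mevZ mevXn mev_linform.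
Qed.

Lemma sphere_integral_dot_poly x f : sphere n x ->
  L (dot_poly x f) = dim_ratio * M f.
Proof.
move=> xS; rewrite /dot_poly sphere_integral_sum -[in RHS](coefK f) poly_def.
rewrite weight_integral_sum// mulr_sumr; apply: eq_bigr => i _.
by rewrite sphere_integralZ weight_integralZ// sphere_integral_linformX// mulrCA.
Qed.

Let zon k x := harmonic_projection k (linform (fun i => tnth x i) ^+ k).

Let homog_zon k x : homog k (zon k x).
Proof.
apply: homog_projection; rewrite -[X in homog X _]mul1n.
by rewrite mpoly.dhomogMn// homog_linform.
Qed.

Let harmonic_zon k x : laplacian (zon k x) = 0.
Proof.
apply: laplacian_projection => //; rewrite -[X in homog X _]mul1n.
by rewrite mpoly.dhomogMn// homog_linform.
Qed.

(** Two zonal harmonics with the same pole are orthogonal on the sphere; since their product is a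
    polynomial in <x, .>, this transfers to the weight. *)
Lemma zonal_orthogonal k l : k != l -> M (zonal k * zonal l) = 0.
Proof.
move=> kl; have e0 := sphere_point_sphere; set x := sphere_point in e0.
have h : L (zon k x * zon l x) = 0.
  by apply: sphere_harmonic_orthogonal kl _ _ _ _ => //; exact: homog_zon.
have : L (dot_poly x (zonal k * zonal l)) = 0.
  rewrite -h; apply: eq_sphere_integral => z zS.
  by rewrite mev_dot_poly hornerM mevM !zonalE.
rewrite sphere_integral_dot_poly// => /eqP; rewrite mulf_eq0 => /orP[|/eqP//].
rewrite /dim_ratio mulf_eq0 invr_eq0 [M 1 == 0]gt_eqF ?weight_integral1_gt0// orbF.
by rewrite gt_eqF// sphere_integral1_gt0.
Qed.

Variable Q : nat -> {poly R}.
Hypothesis gQ : gegenbauer n Q.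

(** With a the leading coefficient of Q k, the difference Q k - a Z_k has degree less than k and is
    orthogonal to all such polynomials, hence to itself. The normalization Q k 1 = 1 then gives a
    Z_k(1) = 1. *)
Lemma gegenbauer_zonal k : zonal k = (zonal k).[1] *: Q k /\ (zonal k).[1] != 0.
Proof.
have [sQ Q1 oQ] := gQ.
have oQ' i j : i != j -> M (Q i * Q j) = 0.
  by move=> /oQ <-; apply: eq_Rintegral => t _; rewrite hornerM.
have sz j : size (zonal j) = j.+1 by have [] := zonal_monic j.
have Qf f : (size f <= k)%N -> M (Q k * f) = 0.
  move=> sf; have [c ->] := poly_basis_span sQ sf.
  rewrite mulr_sumr weight_integral_sum// big1// => j _.
  by rewrite -scalerAr weight_integralZ// oQ' ?mulr0// gtn_eqF.
have Zf f : (size f <= k)%N -> M (zonal k * f) = 0.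
  move=> sf; have [c ->] := poly_basis_span sz sf.
  rewrite mulr_sumr weight_integral_sum// big1// => j _.
  by rewrite -scalerAr weight_integralZ// zonal_orthogonal ?mulr0// gtn_eqF.
pose a := (Q k)`_k.
have a0 : a != 0.
  by rewrite /a -[k in _`_k]/(k.+1.-1) -sQ -lead_coefE lead_coef_eq0 -size_poly_gt0 sQ.
pose E := Q k - a *: zonal k.
have sE : (size E <= k)%N.
  apply/leq_sizeP => j; rewrite leq_eqVlt => /predU1P[<-|kj].
    by rewrite coefB coefZ (zonal_monic k).2 mulr1 subrr.
  by rewrite coefB coefZ !nth_default ?sQ ?sz// mulr0 subr0.
have EE : E = 0.
  apply: (weight_integral_definite n2).
  rewrite {1}/E mulrBl -scaleN1r weight_integralD// Qf// -scalerAl scalerA.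
  by rewrite weight_integralZ// Zf// mulr0 addr0.
have QE : Q k = a *: zonal k by apply/eqP; rewrite -subr_eq0; apply/eqP.
have aZ : a * (zonal k).[1] = 1 by have := Q1 k; rewrite QE hornerZ.
split; first by rewrite QE scalerA mulrC aZ scale1r.
by apply/eqP => z0; move: aZ; rewrite z0 mulr0 => /eqP; rewrite eq_sym oner_eq0.
Qed.

(** The scalar depends on neither x nor p, so it can be read off at the pole e of a zonal harmonic,
    where the value Z_k(1) is nonzero and cancels. *)
Lemma funk_hecke a k x p : sphere n x -> homog k p -> laplacian p = 0 ->
  L (linform (fun i => tnth x i) ^+ a * p) =
  dim_ratio * M ('X^a * Q k) * mev p x.
Proof.
have [mu muE] := @funk_hecke_power R n n2.
move=> xS hp p0; rewrite (muE a k x p xS hp p0); congr (_ * _).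
have e0 := sphere_point_sphere; set e := sphere_point in e0.
have ee : dotp e e = 1 by rewrite -enorm_sqr e0 expr1n.
have := muE a k e _ e0 (homog_zon k e) (harmonic_zon k e).
rewrite zonalE// ee.
have [ZE Z1] := gegenbauer_zonal k.
have -> : L (linform (fun i => tnth e i) ^+ a * zon k e) =
    L (dot_poly e ('X^a * zonal k)).
  apply: eq_sphere_integral => z zS.
  by rewrite mevM zonalE// mevXn mev_linform mev_dot_poly hornerM hornerXn.
rewrite sphere_integral_dot_poly// {1}ZE -scalerAr weight_integralZ// mulrCA mulrC.
by move/(mulIf Z1).
Qed.

End zonal.

(** * Bounded pointwise closure of an algebra of functions *)

Section bounded_closure.
Context {R : realType} {d : measure_display} {T : measurableType d}.
Variables (D : set T) (P : (T -> R) -> Prop).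

(** Limits are iterated without end, as needed to reach a whole sigma-algebra; the uniform bound at
    each stage is what lets dominated convergence turn them into limits in L^2. *)
Inductive bounded_closure : (T -> R) -> Prop :=
| closure_base f : P f -> bounded_closure f
| closure_lim u f (M : R) : (forall k, bounded_closure (u k)) ->
    (forall k x, D x -> `|u k x| <= M) ->
    (forall x, D x -> u k x @[k --> \oo] --> f x) -> bounded_closure f.

Hypothesis Pm : forall f, P f -> measurable_fun D f.
Hypothesis Pb : forall f, P f -> exists M : R, forall x, D x -> `|f x| <= M.

Lemma bounded_closure_bounded f : bounded_closure f ->
  measurable_fun D f /\ exists M : R, forall x, D x -> `|f x| <= M.
Proof.
elim=> [g Pg|u g M _ ih uM ug]; first by split; [exact: Pm|exact: Pb].
split; first by apply: (measurable_fun_cvg (h := u)) => // k; have [] := ih k.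
exists M => x Dx; apply: (cvgr_to_le (cvg_norm (ug x Dx))).
by apply: nearW => k; exact: uM.
Qed.

Lemma eq_bounded_closure f g : (forall x, D x -> f x = g x) ->
  bounded_closure f -> bounded_closure g.
Proof.
move=> fg cf; have [_ [M fM]] := bounded_closure_bounded cf.
apply: (@closure_lim (fun=> f) _ M) => // x Dx.
by rewrite -fg//; exact: cvg_cst.
Qed.

Hypothesis P1 : P (fun=> 1).
Hypothesis PD : forall f g, P f -> P g -> P (fun x => f x + g x).
Hypothesis PZ : forall c f, P f -> P (fun x => c * f x).
Hypothesis PM : forall f g, P f -> P g -> P (fun x => f x * g x).

(** Induction on the construction of f, and on that of g only when f lies in P: adding a fixed
    bounded function preserves bounded pointwise limits. *)
Lemma bounded_closureD f g : bounded_closure f -> bounded_closure g ->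
  bounded_closure (fun x => f x + g x).
Proof.
move=> cf cg; elim: cf => {f} [f Pf|u f M cu ih uM uf].
  elim: cg => {g} [g Pg|v g M cv ih vM vg]; first exact/closure_base/PD.
  have [K fK] := Pb Pf.
  apply: (@closure_lim (fun k x => f x + v k x) _ (K + M)) => // [k x Dx|x Dx].
    by rewrite (le_trans (ler_normD _ _))// lerD ?fK ?vM.
  by apply: cvgD; [exact: cvg_cst|exact: vg].
have [_ [K gK]] := bounded_closure_bounded cg.
apply: (@closure_lim (fun k x => u k x + g x) _ (M + K)) => // [k x Dx|x Dx].
  by rewrite (le_trans (ler_normD _ _))// lerD ?gK ?uM.
by apply: cvgD; [exact: uf|exact: cvg_cst].
Qed.

Lemma bounded_closureM f g : bounded_closure f -> bounded_closure g ->
  bounded_closure (fun x => f x * g x).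
Proof.
move=> cf cg; elim: cf => {f} [f Pf|u f M cu ih uM uf].
  elim: cg => {g} [g Pg|v g M cv ih vM vg]; first exact/closure_base/PM.
  have [K fK] := Pb Pf.
  apply: (@closure_lim (fun k x => f x * v k x) _ (K * M)) => // [k x Dx|x Dx].
    by rewrite normrM ler_pM ?fK ?vM.
  by apply: cvgM; [exact: cvg_cst|exact: vg].
have [_ [K gK]] := bounded_closure_bounded cg.
apply: (@closure_lim (fun k x => u k x * g x) _ (M * K)) => // [k x Dx|x Dx].
  by rewrite normrM ler_pM ?gK ?uM.
by apply: cvgM; [exact: uf|exact: cvg_cst].
Qed.

Lemma bounded_closure_cst c : bounded_closure (fun=> c).
Proof.
apply: closure_base; rewrite (_ : (fun=> c) = fun=> c * 1); first exact: PZ.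
by apply/funext => x; rewrite mulr1.
Qed.

Lemma bounded_closureZ c f : bounded_closure f -> bounded_closure (fun x => c * f x).
Proof. by move=> cf; apply: bounded_closureM => //; exact: bounded_closure_cst. Qed.

Lemma bounded_closureX k f : bounded_closure f -> bounded_closure (fun x => f x ^+ k).
Proof.
move=> cf; elim: k => [|k ih]; first by under eq_fun do rewrite expr0; exact: bounded_closure_cst.
by under eq_fun do rewrite exprS; exact: bounded_closureM.
Qed.

Lemma bounded_closure_onem f : bounded_closure f -> bounded_closure (fun x => 1 - f x).
Proof.
move=> cf; rewrite (_ : (fun x => _) = fun x => 1 + (-1) * f x).
  by apply: bounded_closureD; [exact: bounded_closure_cst|exact: bounded_closureZ].
by apply/funext => x; rewrite mulN1r.
Qed.

Lemma bounded_closure_sum I (r : seq I) (F : I -> T -> R) :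
  (forall i, bounded_closure (F i)) -> bounded_closure (fun x => \sum_(i <- r) F i x).
Proof.
move=> cF; elim: r => [|i r ih].
  by under eq_fun do rewrite big_nil; exact: bounded_closure_cst.
by under eq_fun do rewrite big_cons; exact: bounded_closureD.
Qed.

(** Complements are 1 - f, finite unions come from products of complements, and a countable union is
    the limit of its finite parts, all bounded by 1. *)
Lemma bounded_closure_sigma_algebra :
  sigma_algebra setT [set A | bounded_closure (\1_A)].
Proof.
split=> /=.
- by rewrite indic0; exact: bounded_closure_cst.
- move=> A cA; apply: eq_bounded_closure (bounded_closure_onem cA) => x _.
  rewrite !indicE in_setD in_setT; case: (x \in A) => /=; lra.
- move=> A cA.
  have cU k : bounded_closure (\1_(\bigcup_(i < k) A i)).
    elim: k => [|k ih].
      by rewrite II0 bigcup_set0 indic0; exact: bounded_closure_cst.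
    rewrite IIS bigcup_setU bigcup_set1.
    have h := bounded_closure_onem (bounded_closureM (bounded_closure_onem (cA k))
      (bounded_closure_onem ih)).
    apply: eq_bounded_closure h => x _; rewrite !indicE in_setU.
    by case: (x \in A k); case: (x \in _) => /=; lra.
  apply: (@closure_lim (fun k => \1_(\bigcup_(i < k) A i)) _ 1) => //.
    by move=> k x _; rewrite indicE normr_nat -[1]/(1%:R) ler_nat leq_b1.
  move=> x _; rewrite [X in _ --> X]indicE; have [|xA] := boolP (x \in \bigcup_k A k).
    move=> /set_mem[i _ Aix]; apply: cvg_near_cst; near=> k.
    rewrite indicE mem_set//; exists i => //=.
    by near: k; exact: nbhs_infty_gt.
  rewrite (_ : (fun k => _) = fun=> 0); first exact: cvg_cst.
  apply/funext => k; rewrite indicE memNset// => -[i _ Aix].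
  by move/negP: xA; apply; rewrite inE; exists i.
Unshelve. all: by end_near. Qed.

(* (1 - s^k)^(2^k) tends to 1 for s < 1/2 and to 0 for s > 1/2; the second
   factor removes the limit exp(-1) at s = 1/2. *)
Lemma cvg_threshold (s : R) : 0 <= s <= 1 ->
  (1 - s ^+ k) ^+ (2 ^ k) * (1 - (1 - (s - 2^-1) ^+ 2) ^+ k) @[k --> \oo] -->
  ((s < 2^-1)%R%:R : R).
Proof.
move=> /andP[s0 s1].
have sk k : 0 <= s ^+ k <= 1 by rewrite exprn_ge0//= exprn_ile1.
have bernoulli (y : R) m : 0 <= y <= 1 -> 1 - m%:R * y <= (1 - y) ^+ m.
  move=> /andP[y0 y1]; elim: m => [|m ih]; first by rewrite mul0r subr0 expr0.
  rewrite exprS; apply: (@le_trans _ _ ((1 - y) * (1 - m%:R * y))).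
    have : 0 <= m%:R :> R by []. rewrite -natr1; nra.
  by rewrite ler_wpM2l// subr_ge0.
have pow2 k : (2 ^ k)%:R * s ^+ k = (2 * s) ^+ k by rewrite natrX exprMn.
have cvg2 : s != 2^-1 -> 1 - (1 - (s - 2^-1) ^+ 2) ^+ k @[k --> \oo] --> (1 : R).
  move=> sn; rewrite -[X in _ --> X]subr0; apply: cvgB; first exact: cvg_cst.
  apply: cvg_expr.
  have : 0 < (s - 2^-1) ^+ 2 by rewrite exprn_even_gt0//= subr_eq0.
  have : (s - 2^-1) ^+ 2 <= 1 by rewrite expr2; nra.
  move=> h1 h2; rewrite ger0_norm; lra.
have [slt|sgt|se] := ltgtP s 2^-1.
- rewrite -[X in _ --> X]mulr1; apply: cvgM; last by apply: cvg2; rewrite lt_eqF.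
  apply: (@squeeze_cvgr _ _ _ _ (fun k => 1 - (2 * s) ^+ k) (fun=> 1)).
  + apply: nearW => k; rewrite -pow2 bernoulli//=.
    have /andP[? ?] := sk k; rewrite exprn_ile1//; lra.
  + rewrite -[X in _ --> X]subr0; apply: cvgB; first exact: cvg_cst.
    by apply: cvg_expr; rewrite ger0_norm; lra.
  + exact: cvg_cst.
- rewrite -[X in _ --> X](mul0r 1); apply: cvgM; last by apply: cvg2; rewrite gt_eqF.
  apply: (@squeeze_cvgr _ _ _ _ (fun=> 0) (fun k => (2 * s)^-1 ^+ k)).
  + apply: nearW => k; have /andP[h0 h1] := sk k.
    have e0 : 0 <= (1 - s ^+ k) ^+ (2 ^ k) by rewrite exprn_ge0// subr_ge0.
    rewrite e0 /= exprVn -[leRHS]div1r ler_pdivlMr; last by rewrite exprn_gt0//; lra.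
    rewrite -pow2.
    (* With y = s^k, (1 - y)(1 + y) <= 1 turns Bernoulli's lower bound for powers of 1 + y into an
       upper bound for powers of 1 - y. *)
    apply: (@le_trans _ _ ((1 - s ^+ k) ^+ (2 ^ k) * (1 + s ^+ k) ^+ (2 ^ k))).
      rewrite ler_wpM2l//.
      have bern2 m : 1 + m%:R * s ^+ k <= (1 + s ^+ k) ^+ m.
        elim: m => [|m ih]; first by rewrite mul0r addr0 expr0.
        rewrite exprS; apply: (@le_trans _ _ ((1 + s ^+ k) * (1 + m%:R * s ^+ k))).
          have : 0 <= m%:R :> R by []. rewrite -natr1; nra.
        by rewrite ler_wpM2l// addr_ge0.
      by apply: le_trans (bern2 _); rewrite lerDr.
    rewrite -exprMn exprn_ile1//; nra.
  + exact: cvg_cst.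
  + apply: cvg_expr; rewrite ger0_norm ?invr_ge0; last by lra.
    by rewrite invf_lt1; lra.
- rewrite (_ : (fun k => _) = fun=> 0); first exact: cvg_cst.
  by apply/funext => k; rewrite se subrr expr0n/= subr0 expr1n subrr mulr0.
Qed.

Lemma bounded_closure_halfspace (t : T -> R) c : P t ->
  (forall x, D x -> `|t x| <= 1) ->
  bounded_closure (\1_[set x | t x < c]).
Proof.
move=> Pt t1.
have [c1|c1] := ltP 1 c.
  apply: eq_bounded_closure (bounded_closure_cst 1) => x Dx.
  rewrite indicE mem_set//=; have := t1 x Dx; rewrite ler_norml => /andP[_ h].
  exact: le_lt_trans h c1.
have [c2|c2] := leP c (-1).
  apply: eq_bounded_closure (bounded_closure_cst 0) => x Dx.
  rewrite indicE memNset//=; have := t1 x Dx; rewrite ler_norml => /andP[h _].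
  by apply/negP; rewrite -leNgt (le_trans c2).
(* For -1 < c <= 1 one has |t - c| <= 2, so the division by 4 keeps s in [0, 1], and t < c becomes s
   < 1/2. *)
pose s x := 2^-1 + (t x - c) / 4.
have cs : bounded_closure s.
  rewrite (_ : s = fun x => 4^-1 * t x + (2^-1 - c / 4)).
    apply: bounded_closureD; last exact: bounded_closure_cst.
    exact/bounded_closureZ/closure_base.
  by apply/funext => x; rewrite /s; lra.
have s01 x : D x -> 0 <= s x <= 1.
  move=> /t1; rewrite ler_norml => /andP[h1 h2]; rewrite /s; apply/andP; split; lra.
pose u k x := (1 - s x ^+ k) ^+ (2 ^ k) * (1 - (1 - (s x - 2^-1) ^+ 2) ^+ k).
apply: (@closure_lim u _ 1) => [k|k x Dx|x Dx].
- rewrite /u; apply: bounded_closureM.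
    exact/bounded_closureX/bounded_closure_onem/bounded_closureX.
  apply/bounded_closure_onem/bounded_closureX/bounded_closure_onem/bounded_closureX.
  by apply: bounded_closureD => //; exact: bounded_closure_cst.
- have /andP[h0 h1] := s01 x Dx; rewrite /u.
  have sk : 0 <= s x ^+ k <= 1 by rewrite exprn_ge0//= exprn_ile1.
  have b1 : 0 <= 1 - (s x - 2^-1) ^+ 2 <= 1.
    apply/andP; split; last by rewrite gerBl sqr_ge0.
    by rewrite expr2; nra.
  have b2 : 0 <= (1 - (s x - 2^-1) ^+ 2) ^+ k <= 1.
    by case/andP: b1 => ? ?; rewrite exprn_ge0//= exprn_ile1.
  case/andP: sk => ? ?; case/andP: b2 => ? ?.
  have a0 : 0 <= (1 - s x ^+ k) ^+ (2 ^ k) by rewrite exprn_ge0// subr_ge0.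
  have a1 : (1 - s x ^+ k) ^+ (2 ^ k) <= 1 by rewrite exprn_ile1// ?subr_ge0 ?gerBl.
  by rewrite ger0_norm ?mulr_ge0 ?mulr_ile1 ?subr_ge0 ?gerBl.
- have := cvg_threshold (s01 x Dx).
  rewrite indicE (_ : (x \in _) = (s x < 2^-1)%R)//.
  apply/idP/idP => [/set_mem/=|h]; rewrite /s; first by lra.
  by rewrite inE /=; move: h; rewrite /s; lra.
Qed.

End bounded_closure.

(** * From bounded closure to density in L^2 *)

Section L2_density.
Context {R : realType} {d : measure_display} {T : measurableType d}.
Variables (mu : {measure set T -> \bar R}) (D : set T) (P : (T -> R) -> Prop).
Hypothesis mD : measurable D.
Hypothesis muD : (mu D < +oo)%E.

Lemma square_integrableB (f g : T -> R) :
  square_integrable mu D f -> square_integrable mu D g ->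
  square_integrable mu D (fun x => f x - g x).
Proof.
move=> [mf fi] [mg gi]; split; first exact: measurable_funB.
have h := integrableRD mD (integrableRZ 2 mD fi) (integrableRZ 2 mD gi).
apply: (le_integrableR mD _ h).
  by apply: measurable_funX; exact: measurable_funB.
move=> x _; rewrite ger0_norm ?sqr_ge0//.
have := sqr_ge0 (f x + g x); rewrite !expr2; nra.
Qed.

Definition L2_approximable (f : T -> R) := forall e, 0 < e ->
  exists2 g, P g & \int[mu]_(x in D) (f x - g x) ^+ 2 < e.

Hypothesis Psq : forall f, P f -> square_integrable mu D f.

Lemma L2_approximable_lim (u : nat -> T -> R) (f : T -> R) :
  square_integrable mu D f -> (forall k, square_integrable mu D (u k)) ->
  (forall k, L2_approximable (u k)) ->
  \int[mu]_(x in D) (f x - u k x) ^+ 2 @[k --> \oo] --> (0 : R) ->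
  L2_approximable f.
Proof.
(* The quarter comes from (a + b)^2 <= 2 a^2 + 2 b^2, used in place of the triangle inequality of
   the norm. *)
move=> sf su au uf e e0; have e4 : 0 < e / 4 by rewrite divr_gt0.
have /cvgr0_norm_lt /(_ _ e4) [N _ hN] := uf.
have [g Pg ug] := au N _ e4; exists g => //.
have := hN N (leqnn N) => /= {}hN.
have [_ i1] := square_integrableB sf (su N).
have [_ i2] := square_integrableB (su N) (Psq Pg).
have [_ i3] := square_integrableB sf (Psq Pg).
apply: (@le_lt_trans _ _ (2 * \int[mu]_(x in D) (f x - u N x) ^+ 2 +
    2 * \int[mu]_(x in D) (u N x - g x) ^+ 2)).
  rewrite -!RintegralZl// -RintegralD//; try exact: integrableRZ.
  apply: le_Rintegral => //; first by apply: integrableRD => //; exact: integrableRZ.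
  move=> x _; have := sqr_ge0 (f x - u N x - (u N x - g x)); rewrite !expr2; nra.
rewrite ger0_norm in hN; first lra.
by apply: Rintegral_ge0 => x _; exact: sqr_ge0.
Qed.

Hypothesis Pb : forall f, P f -> exists M : R, forall x, D x -> `|f x| <= M.
Hypothesis P1 : P (fun=> 1).
Hypothesis PD : forall f g, P f -> P g -> P (fun x => f x + g x).
Hypothesis PZ : forall c f, P f -> P (fun x => c * f x).
Hypothesis PM : forall f g, P f -> P g -> P (fun x => f x * g x).

Let Pm f : P f -> measurable_fun D f. Proof. by move=> /Psq []. Qed.

Lemma bounded_square_integrable (f : T -> R) (M : R) : measurable_fun D f ->
  (forall x, D x -> `|f x| <= M) -> square_integrable mu D f.
Proof.
move=> mf fM; split=> //.
apply: (bounded_integrableR (M := M ^+ 2)) => //; first exact: measurable_funX.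
move=> x Dx; rewrite normrX; have := fM x Dx; have := normr_ge0 (f x).
by move=> h1 h2; rewrite !expr2 ler_pM.
Qed.

Lemma bounded_closure_approximable f : bounded_closure D P f -> L2_approximable f.
Proof.
elim=> {f} [f Pf e e0|u f M cu ih uM uf].
  exists f => //; under eq_Rintegral do rewrite subrr expr0n/=.
  by rewrite Rintegral_cst// mul0r.
have cf : bounded_closure D P f by apply: closure_lim cu uM uf.
have [mf [K fK]] := bounded_closure_bounded Pm Pb cf.
have mu_ k : measurable_fun D (u k) by have [] := bounded_closure_bounded Pm Pb (cu k).
have sf := bounded_square_integrable mf fK.
have su k := bounded_square_integrable (mu_ k) (uM k).
apply: (L2_approximable_lim sf su ih).
have [||||_ _] := dominated_convergenceR (mu := mu)
    (u := fun k x => (f x - u k x) ^+ 2) (f := fun=> 0) (g := fun=> (K + M) ^+ 2) mD.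
- by move=> k; apply: measurable_funX; exact: measurable_funB.
- move=> x Dx; rewrite -[X in _ --> X](expr0n R 2) -(subrr (f x)).
  by apply: cvgM; apply: cvgB; [exact: cvg_cst|exact: uf|exact: cvg_cst|exact: uf].
- apply: (bounded_integrableR (M := (K + M) ^+ 2)) => // x _.
  by rewrite ger0_norm// sqr_ge0.
- move=> k x Dx; rewrite normrX.
  have h : `|f x - u k x| <= K + M.
    by rewrite (le_trans (ler_normB _ _))// lerD ?fK ?uM.
  by rewrite !expr2 ler_pM.
- by rewrite Rintegral_cst// mul0r.
Qed.

Import HBNNSimple.

(** Simple functions lie in the closure; a nonnegative f is approached from below by simple
    functions with error at most f, so f^2 dominates; a general f is split into its positive and
    negative parts. *)
Lemma L2_density : measurable `<=` [set A | bounded_closure D P (\1_A)] ->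
  forall f, square_integrable mu D f -> L2_approximable f.
Proof.
move=> mS.
have nnsfun_app (h : {nnsfun T >-> R}) : bounded_closure D P h.
  apply: (eq_bounded_closure Pm Pb (f := fun x =>
    \sum_(y <- finmap.enum_fset (fset_set (range h))) (y * \1_(h @^-1` [set y]) x))).
    by move=> x _; rewrite [RHS]fimfunE fsbig_finite.
  apply: (bounded_closure_sum Pm Pb) => // y.
  apply: (bounded_closureZ Pm Pb) => //.
  by apply: mS; exact: measurable_sfunP.
have nneg f : square_integrable mu D f -> (forall x, D x -> 0 <= f x) -> L2_approximable f.
  move=> sf f0; have [mf fi] := sf.
  have mEf : measurable_fun D (EFin \o f) by exact/measurable_EFinP.
  pose u := nnsfun_approx mD mEf.
  have f0' x : D x -> (0 <= (EFin \o f) x)%E by move=> /f0; rewrite lee_fin.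
  have uf x : D x -> u k x @[k --> \oo] --> f x.
    by move=> Dx; have := cvg_nnsfun_approx mD mEf f0' Dx => /fine_cvg.
  have ule k x : D x -> u k x <= f x.
    move=> Dx; apply: (cvgr_to_ge (uf x Dx)); near=> m.
    have /nd_nnsfun_approx : (k <= m)%N by near: m; exact: nbhs_infty_ge.
    by move=> /(_ _ _ _ _ mD _ mEf)/lefP.
  have su k : square_integrable mu D (u k).
    split; first exact: measurable_funTS.
    apply: (le_integrableR mD _ fi).
      by apply: measurable_funX; exact: measurable_funTS.
    move=> x Dx; rewrite ger0_norm ?sqr_ge0// !expr2 ler_pM ?ule//.
  apply: (L2_approximable_lim sf su) => [k|].
    exact/bounded_closure_approximable/nnsfun_app.
  have [||||_ _] := dominated_convergenceR (mu := mu)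
      (u := fun k x => (f x - u k x) ^+ 2) (f := fun=> 0) (g := fun x => f x ^+ 2) mD.
  - by move=> k; apply: measurable_funX; apply: measurable_funB => //; exact: measurable_funTS.
  - move=> x Dx; rewrite -[X in _ --> X](expr0n R 2) -(subrr (f x)).
    by apply: cvgM; apply: cvgB; [exact: cvg_cst|exact: uf|exact: cvg_cst|exact: uf].
  - exact: fi.
  - move=> k x Dx; rewrite ger0_norm ?sqr_ge0//.
    have : 0 <= u k x by []. have := ule k x Dx; rewrite !expr2; nra.
  - by rewrite Rintegral_cst// mul0r.
move=> f sf e e0; have [mf fi] := sf.
have sp : square_integrable mu D (fun x => Num.max (f x) 0).
  split; first exact: measurable_maxr.
  apply: (le_integrableR mD _ fi); first by apply: measurable_funX; exact: measurable_maxr.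
  move=> x Dx; rewrite ger0_norm ?sqr_ge0// maxEle; case: ifP => // _.
  by rewrite expr0n sqr_ge0.
have sn : square_integrable mu D (fun x => Num.max (- f x) 0).
  split; first by apply: measurable_maxr => //; exact: measurable_funN.
  apply: (le_integrableR mD _ fi).
    by apply: measurable_funX; apply: measurable_maxr => //; exact: measurable_funN.
  move=> x Dx; rewrite ger0_norm ?sqr_ge0// maxEle; case: ifP => // _.
    by rewrite expr0n sqr_ge0.
  by rewrite sqrrN.
have e4 : 0 < e / 4 by rewrite divr_gt0.
have [|g Pg fg] := nneg _ sp _ _ e4; first by move=> x _; rewrite le_max lexx orbT.
have [|h Ph fh] := nneg _ sn _ _ e4; first by move=> x _; rewrite le_max lexx orbT.
exists (fun x => g x + (-1) * h x); first exact/PD/PZ.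
have [_ i1] := square_integrableB sp (Psq Pg).
have [_ i2] := square_integrableB sn (Psq Ph).
have Pgh : P (fun x => g x + (-1) * h x) by exact/PD/PZ.
have [_ i3] := square_integrableB sf (Psq Pgh).
apply: (@le_lt_trans _ _ (2 * \int[mu]_(x in D) (Num.max (f x) 0 - g x) ^+ 2 +
    2 * \int[mu]_(x in D) (Num.max (- f x) 0 - h x) ^+ 2)); last by lra.
rewrite -!RintegralZl// -RintegralD//; try exact: integrableRZ.
apply: le_Rintegral => //; first by apply: integrableRD => //; exact: integrableRZ.
move=> x _.
have : f x = Num.max (f x) 0 - Num.max (- f x) 0.
  rewrite !maxEle oppr_le0; case: (leP (f x) 0); case: (leP 0 (f x)); lra.
move: (Num.max (f x) 0) (Num.max (- f x) 0) => a b ->.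
have := sqr_ge0 ((a - g x) + (b - h x)); rewrite !expr2; nra.
Unshelve. all: by end_near. Qed.

End L2_density.

(** * Linear spans of families of functions *)

Section span.
Context {R : realType} {T I : Type}.
Variables (D : set T) (phi : I -> T -> R).
Implicit Types f g : T -> R.

(** Pairs with possibly repeated indices make sums concatenations and need no decidable equality on
    I; [in_span_coef] merges the repetitions at the end. *)
Definition in_span f := exists l : seq (R * I),
  forall x, D x -> f x = \sum_(u <- l) u.1 * phi u.2 x.

Lemma in_span_base i : in_span (phi i).
Proof. by exists [:: (1, i)] => x _; rewrite big_seq1 mul1r. Qed.

Lemma in_span0 : in_span (fun=> 0).
Proof. by exists [::] => x _; rewrite big_nil. Qed.

Lemma in_spanD f g : in_span f -> in_span g -> in_span (fun x => f x + g x).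
Proof.
move=> [l fl] [m gm]; exists (l ++ m) => x Dx.
by rewrite big_cat -fl// -gm.
Qed.

Lemma in_spanZ c f : in_span f -> in_span (fun x => c * f x).
Proof.
move=> [l fl]; exists [seq (c * u.1, u.2) | u <- l] => x Dx.
by rewrite fl// big_map mulr_sumr; apply: eq_bigr => u _ /=; rewrite mulrA.
Qed.

Lemma in_span_sum J (r : seq J) (F : J -> T -> R) :
  (forall j, in_span (F j)) -> in_span (fun x => \sum_(j <- r) F j x).
Proof.
move=> cF; elim: r => [|j r ih].
  by under eq_fun do rewrite big_nil; exact: in_span0.
by under eq_fun do rewrite big_cons; exact: in_spanD.
Qed.

Lemma eq_in_span f g : (forall x, D x -> f x = g x) -> in_span f -> in_span g.
Proof. by move=> fg [l fl]; exists l => x Dx; rewrite -fg// fl. Qed.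

Lemma in_spanM (op : I -> I -> I) f g :
  (forall i j x, phi (op i j) x = phi i x * phi j x) ->
  in_span f -> in_span g -> in_span (fun x => f x * g x).
Proof.
move=> phiM [l fl] [m gm].
apply: (@eq_in_span (fun x =>
    \sum_(u <- l) u.1 * \sum_(v <- m) v.1 * phi (op u.2 v.2) x)).
  move=> x Dx; rewrite fl// gm// mulr_suml; apply: eq_bigr => u _.
  rewrite -mulrA; congr (_ * _); rewrite mulr_sumr; apply: eq_bigr => v _.
  by rewrite phiM mulrCA.
apply: in_span_sum => u; apply: in_spanZ; apply: in_span_sum => v.
by apply: in_spanZ; exact: in_span_base.
Qed.

End span.

Lemma in_span_trans (R : realType) (T I J : Type) (D : set T) (phi : I -> T -> R)
    (psi : J -> T -> R) f :
  (forall i, in_span D psi (phi i)) -> in_span D phi f -> in_span D psi f.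
Proof.
move=> ps [l fl]; apply: (eq_in_span (fun x Dx => esym (fl x Dx))).
by apply: in_span_sum => u; exact: in_spanZ.
Qed.

Lemma in_span_coef (R : realType) (T : Type) (I : eqType) (D : set T)
    (phi : I -> T -> R) f : in_span D phi f ->
  exists (s : seq I) (c : I -> R),
    forall x, D x -> f x = \sum_(i <- s) c i * phi i x.
Proof.
move=> [l fl]; exists (undup [seq u.2 | u <- l]).
exists (fun i => \sum_(u <- l | u.2 == i) u.1) => x /fl ->.
under [RHS]eq_bigr do rewrite mulr_suml big_mkcond.
rewrite exchange_big/= !big_seq; apply: eq_bigr => u ul.
rewrite (bigD1_seq u.2) ?undup_uniq ?mem_undup ?map_f//= eqxx.
by rewrite big1 ?addr0// => i /negbTE; rewrite eq_sym => ->.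
Qed.

(** Padding with a zero term gives sums of different lengths the same index type, as
    [bigA_distr_bigA] requires for expanding a product of sums. *)
Lemma big_ord_nth_pad (R : realType) (I : Type) (l : seq I) (u0 : I) (F : I -> R) m :
  F u0 = 0 -> (size l <= m)%N -> \sum_(u <- l) F u = \sum_(j < m) F (nth u0 l j).
Proof.
move=> F0 lm; rewrite (big_nth u0) big_mkord (big_ord_widen _ (fun j => F (nth u0 l j)) lm).
rewrite big_mkcond; apply: eq_bigr => j _; case: ltnP => // lj.
by rewrite nth_default.
Qed.

(** * Products of harmonics form a Hilbert basis *)

Section harmonics.
Context {R : realType} {n d : nat}.
Hypothesis n2 : (2 <= n)%N.
Local Notation point n := (n.-tuple (measurableTypeR R)).
Local Notation mp := (mpoly.mpoly n R).
Local Notation homog m p := (p \is mpoly.ishomog1 m mpoly.mdeg).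
Local Notation L := (@sphere_integral R n).
Local Notation MS := (@multisphere R n d).
Local Notation mu := (@multisphere_measure R n d).

Definition mev_prod (q : 'I_d -> mp) (x : d.-tuple (point n)) : R :=
  \prod_(i < d) mev (q i) (tnth x i).

Lemma mev_prodM p q x :
  mev_prod (fun i => p i * q i) x = mev_prod p x * mev_prod q x.
Proof. by rewrite /mev_prod -big_split; apply: eq_bigr => i _; rewrite mevM. Qed.

Lemma mev1 (x : point n) : mev 1 x = 1.
Proof. by rewrite /mev rmorph1. Qed.

Lemma measurable_multisphere : measurable MS.
Proof. by rewrite /multisphere; apply: measurable_box; exact: measurable_sphere. Qed.

Lemma multisphere_measure_fin : (mu MS < +oo)%E.
Proof.
rewrite /multisphere_measure power_measure_box; last exact: measurable_sphere.
have h : surface_measure n (@sphere R n) \is a fin_num.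
  by apply: fin_num_measure; exact: measurable_sphere.
by have := fin_numX d h; rewrite fin_numElt => /andP[].
Qed.

Lemma measurable_mev_prod q : measurable_fun setT (mev_prod q).
Proof.
apply: measurable_prod => i _.
apply: (measurableT_comp (@measurable_mev _ _ (q i))).
exact: measurable_tnth.
Qed.

Lemma mev_prod_bounded q : exists M : R, forall x, MS x -> `|mev_prod q x| <= M.
Proof.
have /choice[M hM] i := mev_bounded (q i).
exists (\prod_i M i) => x Dx; rewrite normr_prod; apply: ler_prod => i _.
by rewrite normr_ge0 hM//; exact: Dx.
Qed.

Lemma integral_mev_prod q : mu.-integrable MS (EFin \o mev_prod q) /\
  \int[mu]_(x in MS) mev_prod q x = \prod_(i < d) L (q i).
Proof.
have := @power_measure_prod_box _ _ _ (surface_measure n) d (@sphere R n) (fun i => mev (q i)).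
apply.
- exact: measurable_sphere.
- by move=> i; exact: sphere_integrable.
Qed.

Lemma in_span_mev_prod_bounded f : in_span MS mev_prod f ->
  measurable_fun MS f /\ exists M : R, forall x, MS x -> `|f x| <= M.
Proof.
move=> [l fl]; split.
  apply: (eq_measurable_fun (fun x => \sum_(u <- l) u.1 * mev_prod u.2 x)).
    by move=> x /set_mem Dx; rewrite -fl.
  apply: measurable_sum => u; apply: measurable_funM => //.
  by apply: measurable_funTS; exact: measurable_mev_prod.
have /choice[M hM] := mev_prod_bounded.
exists (\sum_(u <- l) `|u.1| * M u.2) => x Dx; rewrite fl//.
rewrite (le_trans (ler_norm_sum _ _ _))//; apply: ler_sum => u _.
by rewrite normrM ler_wpM2l// hM.
Qed.

Lemma in_span_mev_prod1 : in_span MS mev_prod (fun=> 1).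
Proof.
apply: eq_in_span (in_span_base _ _ (fun=> 1)) => x _.
by rewrite /mev_prod big1// => i _; rewrite mev1.
Qed.

Lemma in_span_mev_prodM f g : in_span MS mev_prod f -> in_span MS mev_prod g ->
  in_span MS mev_prod (fun x => f x * g x).
Proof. by apply: in_spanM => p q x; exact: mev_prodM. Qed.

(** The half-spaces given by single coordinates generate the measurable sets, and every coordinate
    is bounded by 1 on the multisphere. *)
Lemma bounded_closure_measurable : measurable `<=`
  [set A : set (d.-tuple (point n)) | bounded_closure MS (in_span MS mev_prod) (\1_A)].
Proof.
pose G := [set [set x : d.-tuple (point n) | (tnth (tnth x a.1.1) a.1.2 : R) < a.2] |
  a in [set: 'I_d * 'I_n * R]].
have Pm f : in_span MS mev_prod f -> measurable_fun MS f.
  by case/in_span_mev_prod_bounded.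
have Pb f : in_span MS mev_prod f -> exists M : R, forall x, MS x -> `|f x| <= M.
  by case/in_span_mev_prod_bounded.
have P1 := in_span_mev_prod1.
have PM := in_span_mev_prodM.
have PD := @in_spanD R _ _ MS mev_prod.
have PZ := @in_spanZ R _ _ MS mev_prod.
have sG : <<s G >> `<=` [set A | bounded_closure MS (in_span MS mev_prod) (\1_A)].
  apply: smallest_sub; first exact: bounded_closure_sigma_algebra.
  move=> _ [[[i j] c] _ <-] /=.
  apply: (bounded_closure_halfspace Pm Pb P1 PD PZ PM) => [|x Dx]; last first.
    exact/sphere_tnth_le1/Dx.
  apply: eq_in_span (in_span_base _ _ (fun i' => if i' == i then mvar j else 1)) => x _.
  rewrite /mev_prod (bigD1 i)//= eqxx mev_mvar big1 ?mulr1// => i' /negbTE ->.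
  exact: mev1.
apply: subset_trans sG => A mA.
(* Measurability of the identity out of the sigma-algebra generated by G, checked coordinate by
   coordinate, says exactly that G generates. *)
pose h (x : g_sigma_algebraType G) : d.-tuple (point n) := x.
suff mh : measurable_fun setT h.
  by have := mh measurableT _ mA; rewrite setTI.
apply/measurable_fun_tnthP => i; apply/measurable_fun_tnthP => j.
apply: (measurability _ (RGenInftyO.measurableE R)) => _ [_ [c ->] <-].
apply: sub_sigma_algebra; exists (i, j, c) => //.
by apply/seteqP; split => x /=; rewrite in_itv/=; [|case].
Qed.

Variables (N : nat -> nat) (Y : forall k, 'I_(N k) -> point n -> R).
Hypothesis hY : forall k, harmonic_basis k (@Y k).
Local Notation idx := {k : nat & 'I_(N k)}.
Let phi (u : idx) := Y (tagged u).

(** [Y] is polynomial only on the sphere; fixing polynomials once turns integrals of harmonics into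
    [sphere_integral]. *)
Lemma harmonic_representative : exists rep : idx -> mp, forall u,
  [/\ homog (tag u) (rep u), laplacian (rep u) = 0
    & forall x, sphere n x -> Y (tagged u) x = mev (rep u) x].
Proof.
have /choice[rep h] (u : idx) : exists p : mp, [/\ homog (tag u) p, laplacian p = 0
    & forall x, sphere n x -> Y (tagged u) x = mev p x].
  by case: u => k j; have [/(_ j)[p [hp lp pY]] _ _] := hY k; exists p.
by exists rep.
Qed.

Lemma homog_in_span m (p : mp) : homog m p -> in_span (sphere n) phi (mev p).
Proof.
elim/ltn_ind: m p => m ih p hp.
have [q [hq q0 E]] := projection_decomposition hp.
have hh : spherical_harmonic m (mev (harmonic_projection m p)).
  exists (harmonic_projection m p); split => //.
  - exact: homog_projection.
  - exact: laplacian_projection.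
have [_ Ysp _] := hY m; have [c hc] := Ysp _ hh.
apply: (eq_in_span (f := fun x => \sum_(j < N m) c j * Y j x + (-1) * mev q x)).
  move=> x sx; rewrite -hc// E mevD mevM mev_r2.
  have -> : dotp x x = 1 by rewrite -enorm_sqr sx expr1n.
  by rewrite mul1r mulN1r addrK.
apply: in_spanD.
  apply: in_span_sum => j; apply: in_spanZ.
  exact: (in_span_base _ _ (existT _ m j : idx)).
apply: in_spanZ; case: (ltnP m 2) => m2.
  by apply: eq_in_span (in_span0 _ _) => x _; rewrite q0// mev0.
by apply: ih hq; lia.
Qed.

Lemma mev_in_span (p : mp) : in_span (sphere n) phi (mev p).
Proof.
move: p; apply: mpoly_span => [|c p q hp hq|a].
- by apply: eq_in_span (in_span0 _ _) => x _; rewrite mev0.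
- apply: eq_in_span (in_spanD (in_spanZ c hp) hq) => x _.
  by rewrite mevD mevZ.
- by apply: (@homog_in_span (mpoly.mdeg a)); rewrite mpoly.dhomogX.
Qed.

Lemma mev_prod_in_span q : in_span MS (harmonic_product Y) (mev_prod q).
Proof.
have /choice[l hl] i := mev_in_span (q i).
(* [nth] requires a default index; one exists because the constant 1 is not an empty combination of
   harmonics. *)
have [u0] : inhabited idx.
  have [[|u r] h] := mev_in_span 1; last by constructor; exact: u.2.
  have := h _ (sphere_point_sphere n2); rewrite mev1 big_nil => /eqP.
  by rewrite oner_eq0.
pose m := \max_i size (l i).
apply: (eq_in_span (f := fun x => \sum_(f : {ffun 'I_d -> 'I_m})
    (\prod_i (nth (0, u0) (l i) (f i)).1) *
    harmonic_product Y [ffun i => (nth (0, u0) (l i) (f i)).2] x)).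
  move=> x Dx; rewrite /mev_prod.
  under [RHS]eq_bigr => i _.
    rewrite hl; last exact: Dx.
    rewrite (@big_ord_nth_pad _ _ _ (0, u0) _ m) ?mul0r//; last exact: leq_bigmax.
    over.
  rewrite bigA_distr_bigA/=; apply: eq_bigr => f _.
  rewrite /harmonic_product -big_split/=; apply: eq_bigr => i _.
  by rewrite ffunE.
apply: in_span_sum => f; apply: in_spanZ; exact: in_span_base.
Qed.

Theorem harmonic_product_basis :
  orthonormal_basis mu MS (harmonic_product Y).
Proof.
have mMS := measurable_multisphere; have fMS := multisphere_measure_fin.
have [rep hrep] := harmonic_representative.
have hpE p x : MS x -> harmonic_product Y p x = mev_prod (fun i => rep (p i)) x.
  move=> Dx; apply: eq_bigr => i _; have [_ _ ->//] := hrep (p i); exact: Dx.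
have sqi f : in_span MS mev_prod f -> square_integrable mu MS f.
  by move=> /in_span_mev_prod_bounded[mf [M fM]]; exact: bounded_square_integrable fM.
split.
- move=> p; apply: sqi; apply: eq_in_span (in_span_base _ _ (fun i => rep (p i))).
  by move=> x Dx; rewrite hpE.
- move=> p q.
  rewrite (@eq_Rintegral _ _ _ _ _ (mev_prod (fun i => rep (p i) * rep (q i)))); last first.
    by move=> x /set_mem Dx; rewrite mev_prodM !hpE.
  have [_ ->] := integral_mev_prod (fun i => rep (p i) * rep (q i)).
  (* On one sphere: different degrees are orthogonal by Green's formula, equal degrees by the
     hypothesis on [Y]. *)
  have Luv u v : L (rep u * rep v) = (u == v)%:R.
    have [hu lu uY] := hrep u; have [hv lv vY] := hrep v.
    have [uv|uv] := eqVneq (tag u) (tag v); last first.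
      rewrite (sphere_harmonic_orthogonal n2 uv)//.
      by case: eqVneq => // E; move: uv; rewrite E eqxx.
    case: u v uv hu lu uY hv lv vY => k i [k' j] /= E; case: _ / E j => j _ _ uY _ _ vY.
    rewrite -tag_eqE /tag_eq eqxx /= tagged_asE.
    have [_ _ /(_ i j) <-] := hY k; rewrite /sphere_integral.
    by apply: eq_Rintegral => x /set_mem sx; rewrite mevM -uY// -vY.
  under eq_bigr do rewrite Luv.
  have [->|] := eqVneq p q; first by rewrite big1// => i _; rewrite eqxx.
  move=> pq; have /existsP[i /negbTE pqi] : [exists i, p i != q i].
    apply: contraNT pq; rewrite negb_exists => /forallP h.
    by apply/eqP/ffunP => i; apply/eqP; have := h i; rewrite negbK.
  by rewrite (bigD1 i)//= pqi mul0r.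
- move=> f sf e e0.
  have Pb g : in_span MS mev_prod g -> exists M : R, forall x, MS x -> `|g x| <= M.
    by case/in_span_mev_prod_bounded.
  have [g gs fg] := L2_density mMS fMS sqi Pb in_span_mev_prod1
    (@in_spanD _ _ _ _ _) (@in_spanZ _ _ _ _ _) in_span_mev_prodM
    bounded_closure_measurable sf e0.
  have [s [c gc]] := in_span_coef (in_span_trans mev_prod_in_span gs).
  exists s, c; rewrite (@eq_Rintegral _ _ _ _ _ (fun x => (f x - g x) ^+ 2))// => x /set_mem Dx.
  by rewrite gc.
Qed.

End harmonics.

(** * Term-by-term integration of the kernel *)

Section kernel_expansion.
Context {R : realType} {n d : nat}.
Hypothesis n2 : (2 <= n)%N.
Local Notation point n := (n.-tuple (measurableTypeR R)).
Local Notation mp := (mpoly.mpoly n R).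
Local Notation homog m p := (p \is mpoly.ishomog1 m mpoly.mdeg).
Local Notation L := (@sphere_integral R n).
Local Notation M := (@weight_integral R n).
Local Notation MS := (@multisphere R n d).
Local Notation mu := (@multisphere_measure R n d).
Local Notation w := (@gegenbauer_weight R n).
Variable Kt : 'rV[R]_d -> R.
Hypothesis hK : nonneg_power_series Kt.

Definition partial_series m (t : 'rV[R]_d) : R :=
  \sum_(a : {ffun 'I_d -> 'I_m})
    taylor_coef Kt (fun i => a i) * \prod_(i < d) t 0 i ^+ a i.
Local Notation S := partial_series.

Lemma partial_series_bounded : exists B : R,
  forall m (t : 'rV[R]_d), (forall i, -1 <= t 0 i <= 1) -> `|S m t| <= B.
Proof.
have [_ c0 cvgK] := hK.
have /(_ _)/cvgP/cvg_seq_bounded/pinfty_ex_gt0[|B _ SB] := cvgK (const_mx 1).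
  by move=> i; rewrite mxE lexx andbT; lra.
exists B => m t t1; apply: le_trans (SB m I); apply: (@le_trans _ _ (S m (const_mx 1))).
  rewrite (le_trans (ler_norm_sum _ _ _))//; apply: ler_sum => a _.
  rewrite normrM ger0_norm// ler_wpM2l// normr_prod; apply: ler_prod => i _.
  by rewrite normr_ge0 normrX mxE expr1n exprn_ile1// ler_norml.
exact: ler_norm.
Qed.

Lemma dotp_sphere_bound (x z : point n) : sphere n x -> sphere n z ->
  -1 <= dotp x z <= 1.
Proof.
move=> sx sz; have dx : dotp x x = 1 by rewrite -enorm_sqr sx expr1n.
have dz : dotp z z = 1 by rewrite -enorm_sqr sz expr1n.
have h1 : 0 <= \sum_i (tnth x i + tnth z i) ^+ 2.
  by apply: sumr_ge0 => i _; exact: sqr_ge0.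
have h2 : 0 <= \sum_i (tnth x i - tnth z i) ^+ 2.
  by apply: sumr_ge0 => i _; exact: sqr_ge0.
have e1 : \sum_i (tnth x i + tnth z i) ^+ 2 = dotp x x + dotp z z + 2 * dotp x z.
  rewrite /dotp mulr_sumr -!big_split/=; apply: eq_bigr => i _; ring.
have e2 : \sum_i (tnth x i - tnth z i) ^+ 2 = dotp x x + dotp z z - 2 * dotp x z.
  rewrite /dotp mulr_sumr -sumrN -!big_split/=; apply: eq_bigr => i _; ring.
move: h1 h2; rewrite e1 e2 dx dz => h1 h2; apply/andP; split; lra.
Qed.

Variable Q : nat -> {poly R}.

Lemma integral_poly_weight (f : 'I_d -> {poly R}) :
  (lebesgue_power d).-integrable (cube d)
    (EFin \o (fun t : point d => \prod_(i < d) ((f i).[tnth t i] * w (tnth t i)))) /\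
  \int[lebesgue_power d]_(t in cube d) \prod_(i < d) ((f i).[tnth t i] * w (tnth t i)) =
  \prod_(i < d) M (f i).
Proof.
have := @power_measure_prod_box _ _ _ (@lebesgue_measure R) d
  [set` `[-1, 1]] (fun i t => (f i).[t] * w t).
apply; first exact: measurable_itv.
by move=> i; exact: integrable_poly_weight.
Qed.

(** The eigenvalue integral with Kt replaced by its m-th partial sum. It also appears when the
    partial sums are integrated over the multisphere, and so links the two limits. *)
Definition cube_moment m (k : 'I_d -> nat) : R :=
  \sum_(a : {ffun 'I_d -> 'I_m})
    taylor_coef Kt (fun i => a i) * \prod_(i < d) M ('X^(a i) * Q (k i)).

(** The dominating function is B |W| rather than a constant, since the weight is unbounded for n =
    2. *)
Lemma eigenvalue_integrand_expansion k :
  (lebesgue_power d).-integrable (cube d)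
    (EFin \o eigenvalue_integrand n Kt Q k) /\
  cube_moment m k @[m --> \oo] -->
    \int[lebesgue_power d]_(t in cube d) eigenvalue_integrand n Kt Q k t.
Proof.
have mcube := @measurable_cube R d.
have [B SB] := partial_series_bounded; have [_ _ cvgK] := hK.
pose W (t : point d) := \prod_(i < d) ((Q (k i)).[tnth t i] * w (tnth t i)).
pose u m (t : point d) := S m (\row_i tnth t i) * W t.
have uE m t : u m t = \sum_(a : {ffun 'I_d -> 'I_m}) taylor_coef Kt (fun i => a i) *
    \prod_(i < d) (('X^(a i) * Q (k i)).[tnth t i] * w (tnth t i)).
  rewrite /u /S mulr_suml; apply: eq_bigr => a _; rewrite -mulrA; congr (_ * _).
  rewrite /W -big_split/=; apply: eq_bigr => i _.
  by rewrite hornerM hornerXn mxE mulrA.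
have iu m : (lebesgue_power d).-integrable (cube d) (EFin \o u m) /\
    \int[lebesgue_power d]_(t in cube d) u m t = cube_moment m k.
  have it (a : {ffun 'I_d -> 'I_m}) := integral_poly_weight (fun i => 'X^(a i) * Q (k i)).
  have [|h1 h2] := @Rintegral_sum _ _ _ (lebesgue_power d) _
    (index_enum {ffun 'I_d -> 'I_m}) (cube d) (fun a t => taylor_coef Kt (fun i => a i) *
    \prod_(i < d) (('X^(a i) * Q (k i)).[tnth t i] * w (tnth t i))) mcube.
    by move=> a; apply: integrableRZ => //; have [] := it a.
  split.
    by apply: eq_integrable h1 => // t _; rewrite /= uE.
  under eq_Rintegral do rewrite uE.
  rewrite h2; apply: eq_bigr => a _; have [i1 i2] := it a.
  by rewrite RintegralZl// i2.
have [iW _] := integral_poly_weight (fun i => Q (k i)).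
have [||||h1 _ h2] := @dominated_convergenceR _ _ _ (lebesgue_power d) (cube d) u
    (eigenvalue_integrand n Kt Q k) (fun t => B * `|W t|) mcube.
- by move=> m; have [/measurable_int/measurable_EFinP] := iu m.
- move=> t Dt; apply: cvgM; last exact: cvg_cst.
  by apply: cvgK => i; rewrite mxE; have := Dt i; rewrite /= in_itv.
- apply: integrableRZ => //; exact: integrable_norm.
- move=> m t Dt; rewrite normrM ler_wpM2r//; apply: SB => i.
  by rewrite mxE; have := Dt i; rewrite /= in_itv.
split=> //; have -> : (cube_moment ^~ k) = fun m => \int[lebesgue_power d]_(t in cube d) u m t.
  by apply/funext => m; have [_ ->] := iu m.
exact: h2.
Qed.

Hypothesis gQ : gegenbauer n Q.

(** For a single monomial of the kernel the integral factors over the d spheres, and [funk_hecke]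
    acts on each factor. The limit in m is then identified by uniqueness of limits. *)
Lemma kernel_mev_prod_expansion (k : 'I_d -> nat) (p : 'I_d -> mp) x :
  (forall i, homog (k i) (p i) /\ laplacian (p i) = 0) -> MS x ->
  mu.-integrable MS (EFin \o (fun z => Kt (dots x z) * mev_prod p z)) /\
  \int[mu]_(z in MS) (Kt (dots x z) * mev_prod p z) =
  @dim_ratio R n ^+ d * \int[lebesgue_power d]_(t in cube d) eigenvalue_integrand n Kt Q k t *
  mev_prod p x.
Proof.
move=> hp Dx; have mMS := @measurable_multisphere R n d.
have [B SB] := partial_series_bounded; have [_ _ cvgK] := hK.
have dots1 z i : MS z -> -1 <= dots x z 0 i <= 1.
  by move=> Dz; rewrite mxE; apply: dotp_sphere_bound; [exact: Dx|exact: Dz].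
pose q a (i : 'I_d) : mp := linform (fun j => tnth (tnth x i) j) ^+ a i * p i.
pose u m z := S m (dots x z) * mev_prod p z.
have uE m z : u m z = \sum_(a : {ffun 'I_d -> 'I_m}) taylor_coef Kt (fun i => a i) *
    mev_prod (q (fun i => a i)) z.
  rewrite /u /S mulr_suml; apply: eq_bigr => a _; rewrite -mulrA; congr (_ * _).
  rewrite /mev_prod -big_split/=; apply: eq_bigr => i _.
  by rewrite mevM mevXn mev_linform mxE.
have iu m : mu.-integrable MS (EFin \o u m) /\
    \int[mu]_(z in MS) u m z = @dim_ratio R n ^+ d * cube_moment m k * mev_prod p x.
  have it (a : {ffun 'I_d -> 'I_m}) := integral_mev_prod (q (fun i => a i)).
  have [|h1 h2] := @Rintegral_sum _ _ _ mu _
    (index_enum {ffun 'I_d -> 'I_m}) MS (fun a z => taylor_coef Kt (fun i => a i) *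
    mev_prod (q (fun i => a i)) z) mMS.
    by move=> a; apply: integrableRZ => //; have [] := it a.
  split.
    by apply: eq_integrable h1 => // t _; rewrite /= uE.
  under eq_Rintegral do rewrite uE.
  rewrite h2 /cube_moment mulr_sumr mulr_suml; apply: eq_bigr => a _.
  have [i1 i2] := it a; rewrite RintegralZl// i2.
  suff -> : \prod_(i < d) L (q (fun i => a i) i) =
      @dim_ratio R n ^+ d * \prod_(i < d) M ('X^(a i) * Q (k i)) * mev_prod p x.
    by move: (taylor_coef _ _) => c; rewrite -!mulrA mulrCA.
  have -> : @dim_ratio R n ^+ d = \prod_(i < d) @dim_ratio R n.
    by rewrite prodr_const card_ord.
  rewrite -!big_split/=.
  apply: eq_bigr => i _.
  by have [hpi lpi] := hp i; exact: (funk_hecke n2 gQ (a i) (Dx i) hpi lpi).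
have [_ cI] := eigenvalue_integrand_expansion k.
have [C hC] := mev_prod_bounded p.
have [||||h1 _ h2] := @dominated_convergenceR _ _ _ mu MS u
    (fun z => Kt (dots x z) * mev_prod p z) (fun=> B * C) mMS.
- by move=> m; have [/measurable_int/measurable_EFinP] := iu m.
- move=> z Dz; apply: cvgM; last exact: cvg_cst.
  by apply: cvgK => i; exact: dots1.
- apply: (bounded_integrableR (M := `|B * C|)) => //.
  exact: multisphere_measure_fin.
- move=> m z Dz; rewrite normrM ler_pM// ?hC// SB// => i; exact: dots1.
split=> //; apply: (cvg_unique _ h2) => //=.
have -> : (fun m => \int[mu]_(z in MS) u m z) =
    fun m => @dim_ratio R n ^+ d * cube_moment m k * mev_prod p x.
  by apply/funext => m; have [_ ->] := iu m.
by apply: cvgM; [apply: cvgM => //; exact: cvg_cst|exact: cvg_cst].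
Qed.

End kernel_expansion.

Theorem lemmaA6 (R : realType) (zeta d : nat) :
  (2 <= zeta)%N -> (1 <= d)%N ->
  exists C : R,
    forall (N : nat -> nat)
      (Y : forall k, 'I_(N k) -> zeta.-tuple (measurableTypeR R) -> R)
      (Q : nat -> {poly R})
      (K : d.-tuple (zeta.-tuple (measurableTypeR R)) ->
           d.-tuple (zeta.-tuple (measurableTypeR R)) -> R)
      (Kt : 'rV[R]_d -> R),
    (forall k, harmonic_basis k (@Y k)) ->
    gegenbauer zeta Q ->
    multi_dot_product_kernel K Kt ->
    [/\ orthonormal_basis (multisphere_measure zeta d) (multisphere zeta d)
          (harmonic_product Y),
        forall k : 'I_d -> nat,
          (lebesgue_power d).-integrable (cube d)
            (fun t => (eigenvalue_integrand zeta Kt Q k t)%:E)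
      & forall p : {ffun 'I_d -> {k : nat & 'I_(N k)}},
          eigenfunction (multisphere_measure zeta d) (multisphere zeta d) K
            (C * \int[lebesgue_power d]_(t in cube d)
                   eigenvalue_integrand zeta Kt Q (fun i => tag (p i)) t)
            (harmonic_product Y p)].
Proof.
(* Classically |S^(zeta-2)|^d, fixed before [Y], [Q] and the kernel are introduced. *)
move=> n2 _; exists (@dim_ratio R zeta ^+ d) => N Y Q K Kt hY gQ [hK KE].
have ob := harmonic_product_basis (d := d) n2 hY.
split=> //; first by move=> k; have [] := eigenvalue_integrand_expansion n2 hK Q k.
have [sqi on _] := ob => p; have [mY iY] := sqi p; split=> //.
(* A product of harmonics cannot vanish almost everywhere, because its square integrates to 1. *)
- move=> Y0; have := on p p; rewrite eqxx /Rintegral.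
  rewrite (@ae_eq_integral _ _ _ _ _ (cst 0%E)).
  + by rewrite integral0 /= => /esym/eqP; rewrite oner_eq0.
  + exact: measurable_multisphere.
  + by apply/measurable_EFinP; exact: measurable_funM.
  + exact: measurable_cst.
  + by apply: filterS Y0 => x h Dx; rewrite h// mul0r.
have [rep hrep] := harmonic_representative hY => x Dx.
have hpE z : multisphere zeta d z -> harmonic_product Y p z = mev_prod (fun i => rep (p i)) z.
  move=> Dz; apply: eq_bigr => i _; have [_ _ ->//] := hrep (p i); exact: Dz.
have [|h1 h2] := kernel_mev_prod_expansion n2 hK gQ
    (k := fun i => tag (p i)) (p := fun i => rep (p i)) _ Dx.
  by move=> i; have [] := hrep (p i).
have E z : multisphere zeta d z ->
    K x z * harmonic_product Y p z = Kt (dots x z) * mev_prod (fun i => rep (p i)) z.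
  by move=> Dz; rewrite KE// hpE.
split.
  apply: eq_integrable h1; first exact: measurable_multisphere.
  by move=> z /set_mem Dz; rewrite /= E.
by rewrite hpE// -h2; apply: eq_Rintegral => z /set_mem Dz; exact: E.
Qed.
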